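(* Let $r>\frac12$ and $T>0$, and let $\Phi$ be a solution of the Dirac-Poisson system (DP) with $\Phi\in L^\infty((0,T);H^r)$. Let $\Phi^n$ be the numerical solution produced by the first-order ULI scheme $\Phi^0=\Phi_0$, $\Phi^{n+1}=\Theta_{\mathrm{DP}}(\Phi^n)$, $n\ge 0$, with time step $\tau$. Then there exist constants $\tau_0,C>0$, depending on $\|\Phi\|_{L^\infty((0,T);H^r)}$ and $T$, such that for all $0<\tau\le\tau_0$ and all $n$ with $0\le t_n=n\tau\le T$, $$\|\Phi(t_n)-\Phi^n\|_r\le C\tau .$$ The same statement holds if $\Phi$ is instead a solution of the nonlinear Dirac equation (NDE) with given potential $V$, with $\Phi\in L^\infty((0,T);H^r)$, and $\Phi^n$ is produced by the first-order ULI scheme $\Phi^0=\Phi_0$, $\Phi^{n+1}=\Theta_{\mathrm{ext}}(\Phi^n)$, $n\ge0$.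
   Context: Setting. $\mathbb T=\mathbb R/2\pi\mathbb Z$; $\lambda\in\mathbb R$ is a fixed parameter; $\Phi=(\phi_1,\phi_2)^T:[0,\infty)\times\mathbb T\to\mathbb C^2$; $\Phi^*=\overline\Phi^T$; $$\alpha=\begin{pmatrix}0&1\\1&0\end{pmatrix},\quad \beta=\begin{pmatrix}1&0\\0&-1\end{pmatrix},\quad F(\Phi)=\lambda(\Phi^*\beta\Phi)\beta\Phi=\lambda(|\phi_1|^2-|\phi_2|^2)\beta\Phi .$$ (NDE): $i\partial_t\Phi=-i\alpha\partial_x\Phi+\beta\Phi+V\Phi+F(\Phi)$ for $t>0$, $x\in\mathbb T$, $\Phi(0)=\Phi_0$, where $V=V_e(x)$ is a given real-valued smooth function on $\mathbb T$. (DP): the same equation, with $V=V(t,x)$ determined by $-\partial_{xx}V=|\Phi|^2$, $\int_{\mathbb T}V\,dx=0$, i.e. $V=-\partial_{xx}^{-1}|\Phi|^2$, where for $\psi:\mathbb T\to\mathbb C$, $\partial_{xx}^{-1}\psi:=-\sum_{l\ne0}l^{-2}\widehat\psi_l e^{ilx}$ ($\widehat\psi_l$ the Fourier coefficients of $\psi$). Solutions satisfy Duhamel's formula $\Phi(t+s)=e^{-s\alpha\partial_x}\Phi(t)-i\int_0^s e^{-(s-\rho)\alpha\partial_x}[\beta\Phi+V\Phi+F(\Phi)](t+\rho)\,d\rho$. Norms. $\|\cdot\|_r$ is the standard norm of $H^r=H^r(\mathbb T)$; for $\Psi=(\psi_1,\psi_2)^T$, $\|\Psi\|_r=\sqrt{\|\psi_1\|_r^2+\|\psi_2\|_r^2}$.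 Operators. $\varphi_1(z)=\frac{e^z-1}{z}$ (with $\varphi_1(0)=1$); for $s\in\mathbb R$, $\varphi_1(s\partial_x)$ is the Fourier multiplier with symbol $\varphi_1(isl)$, $l\in\mathbb Z$. $\Pi_+=\frac12\begin{pmatrix}1&1\\1&1\end{pmatrix}$, $\Pi_-=\frac12\begin{pmatrix}1&-1\\-1&1\end{pmatrix}$, and $e^{s\alpha\partial_x}=e^{s\partial_x}\Pi_++e^{-s\partial_x}\Pi_-$, where $e^{s\partial_x}$ has Fourier symbol $e^{isl}$. Schemes. With time step $\tau>0$, $t_n=n\tau$, $\Phi^n=(\phi_1^n,\phi_2^n)^T$, $\phi_\pm^n=\phi_1^n\pm\phi_2^n$, both schemes have the form $$\Phi^{n+1}=e^{-\tau\alpha\partial_x}\Phi^n-i e^{-\tau\alpha\partial_x}(I_1^n+I_2^n+I_3^n),$$ with $$I_1^n=\tau[\varphi_1(2\tau\partial_x)\beta\Pi_-+\varphi_1(-2\tau\partial_x)\beta\Pi_+]\Phi^n,$$ $$I_3^n=\frac{\tau\lambda}{4}\begin{pmatrix}a^n+b^n\\ a^n-b^n\end{pmatrix},\quad \begin{aligned}a^n&=\overline{\phi_+^n}\,\varphi_1(2\tau\partial_x)(\phi_-^n)^2+\phi_+^n\,\varphi_1(2\tau\partial_x)|\phi_-^n|^2,\\ b^n&=\phi_-^n\,\varphi_1(-2\tau\partial_x)|\phi_+^n|^2+\overline{\phi_-^n}\,\varphi_1(-2\tau\partial_x)(\phi_+^n)^2.\end{aligned}$$ For $\Theta_{\mathrm{ext}}$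 (for (NDE)): $$I_2^n=\tau[(\varphi_1(\tau\partial_x)V)\Pi_++(\varphi_1(-\tau\partial_x)V)\Pi_-]\Phi^n.$$ For $\Theta_{\mathrm{DP}}$ (for (DP)): $$I_2^n=-\frac{\tau}{4}\begin{pmatrix}c^n+d^n\\ c^n-d^n\end{pmatrix},\quad \begin{aligned}c^n&=\phi_+^n\,\partial_{xx}^{-1}\big[\varphi_1(2\tau\partial_x)|\phi_-^n|^2+|\phi_+^n|^2\big],\\ d^n&=\phi_-^n\,\partial_{xx}^{-1}\big[\varphi_1(-2\tau\partial_x)|\phi_+^n|^2+|\phi_-^n|^2\big].\end{aligned}$$ The right-hand side as a function of $\Phi^n$ defines the maps $\Theta_{\mathrm{ext}}$ and $\Theta_{\mathrm{DP}}$ respectively. *)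

(* Defs.v *)
From HB Require Import structures.
From mathcomp Require Import all_boot all_order all_algebra.
From mathcomp Require Import complex.
From mathcomp Require Import all_classical all_reals all_analysis.
From mathcomp Require Import ess_sup_inf.
Import Order.TTheory GRing.Theory Num.Theory.
Import numFieldNormedType.Exports.

Set Implicit Arguments.
Unset Strict Implicit.
Unset Printing Implicit Defensive.

Local Open Scope classical_set_scope.
Local Open Scope ring_scope.
Local Open Scope complex_scope.

Section FourierAnalysis.
Context {R : realType}.
Implicit Types (f : R -> R[i]) (m : int -> R[i]) (l : int) (r s x : R).

(* The complex exponential; imag y is the purely imaginary number iy. *)
Definition cexp (z : R[i]) : R[i] :=
  (expR (complex.Re z))%:C * (cos (complex.Im z) +i* sin (complex.Im z)).

Definition imag (y : R) : R[i] := 0 +i* y.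

Definition cintegral (D : set R) f : R[i] :=
  (\int[lebesgue_measure]_(x in D) complex.Re (f x))
  +i* (\int[lebesgue_measure]_(x in D) complex.Im (f x)).

(* Sum of a bilateral series, as the limit of its symmetric partial sums over
   |l| <= N.  Convergence is taken separately on real and imaginary parts. *)
Definition zpartial (a : int -> R[i]) (N : nat) : R[i] :=
  \sum_(k < N.*2.+1) a (k%:Z - N%:Z).

Definition zseries (a : int -> R[i]) : R[i] :=
  limn (fun N => complex.Re (zpartial a N))
  +i* limn (fun N => complex.Im (zpartial a N)).

(* Functions on the torus R/2piZ are 2pi-periodic functions on R. *)
Definition periodic2pi (T : Type) (f : R -> T) : Prop :=
  forall x, f (x + 2 * pi) = f x.

Definition fourier f l : R[i] :=
  ((2 * pi)^-1)%:C
  * cintegral `[0, 2 * pi] (fun x => f x * cexp (imag (- (l%:~R * x)))).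

(* The Fourier multiplier with symbol m. *)
Definition fmult m f : R -> R[i] :=
  fun x => zseries (fun l => m l * fourier f l * cexp (imag (l%:~R * x))).

Definition square_integrable f : Prop :=
  [/\ periodic2pi f,
      measurable_fun setT (fun x => complex.Re (f x)),
      measurable_fun setT (fun x => complex.Im (f x)) &
      lebesgue_measure.-integrable `[0, 2 * pi]
        (fun x => (Normc.normc (f x) ^+ 2)%:E)].

(* The H^r norm, with value +oo outside H^r (for r >= 0). *)
Definition sobolev_norm r f : \bar R :=
  if `[< square_integrable f >] then
    sqrte (\esum_(l in [set: int])
      ((1 + l%:~R ^+ 2) `^ r * Normc.normc (fourier f l) ^+ 2)%:E)
  else +oo%E.

Definition phi1 (z : R[i]) : R[i] := if z == 0 then 1 else (cexp z - 1) / z.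

(* phi1_dx s is phi_1(s d_x), and exp_dx s is e^{s d_x}. *)
Definition phi1_dx s f : R -> R[i] := fmult (fun l => phi1 (imag (s * l%:~R))) f.

Definition exp_dx s f : R -> R[i] := fmult (fun l => cexp (imag (s * l%:~R))) f.

Definition dxx_inv f : R -> R[i] :=
  fmult (fun l => if l == 0 then 0 else - (l%:~R ^+ 2)^-1) f.

End FourierAnalysis.

Section Spinors.
Context {R : realType}.

Notation spinor := 'cV[R[i]]_2.
Notation sfield := (R -> spinor).
Implicit Types (Psi : sfield) (r s x lam tau T : R).

Definition vec2 (a b : R[i]) : spinor := \col_i (if i == 0 then a else b).

Definition comp1 Psi : R -> R[i] := fun x => Psi x 0 0.
Definition comp2 Psi : R -> R[i] := fun x => Psi x 1 0.

Definition mat2 (a b c d : R[i]) : 'M[R[i]]_2 :=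
  \matrix_(i, j) (if i == 0 then (if j == 0 then a else b)
                  else (if j == 0 then c else d)).

Definition beta : 'M[R[i]]_2 := mat2 1 0 0 (-1).
Definition Pi_plus : 'M[R[i]]_2 := 2^-1 *: mat2 1 1 1 1.
Definition Pi_minus : 'M[R[i]]_2 := 2^-1 *: mat2 1 (-1) (-1) 1.

(* Left multiplication by a constant matrix, and componentwise action of an
   operator on scalar functions. *)
Definition mx_act (A : 'M[R[i]]_2) Psi : sfield := fun x => A *m Psi x.

Definition lift2 (op : (R -> R[i]) -> (R -> R[i])) Psi : sfield :=
  fun x => vec2 (op (comp1 Psi) x) (op (comp2 Psi) x).

Definition Hr_norm r Psi : \bar R :=
  sqrte (sobolev_norm r (comp1 Psi) ^+ 2 + sobolev_norm r (comp2 Psi) ^+ 2)%E.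

(* The norm of L^oo((0,T); H^r). *)
Definition Linfty_Hr_norm T r (Phi : R -> sfield) : \bar R :=
  ess_sup lebesgue_measure ((fun t => Hr_norm r (Phi t)) \_ `]0, T[).

(* flow s is e^{s alpha d_x}, where alpha = Pi_plus - Pi_minus. *)
Definition flow s Psi : sfield := fun x =>
  lift2 (exp_dx s) (mx_act Pi_plus Psi) x
  + lift2 (exp_dx (- s)) (mx_act Pi_minus Psi) x.

Definition adjoint (u : spinor) : 'rV[R[i]]_2 := map_mx Num.conj u^T.

Definition nonlin lam (u : spinor) : spinor :=
  (lam%:C * (adjoint u *m beta *m u) 0 0) *: (beta *m u).

Definition dirac_rhs lam (V : R -> R[i]) Psi : sfield := fun x =>
  beta *m Psi x + V x *: Psi x + nonlin lam (Psi x).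

(* Phi is a mild H^r-valued solution on [0, T] for the potential V.  Since H^r
   is separable, (Borel) measurability of t |-> Phi t is that of its Fourier
   coefficients.  The Duhamel formula is stated pointwise in x: for r > 1/2
   point evaluation is continuous on H^r, so it commutes with the H^r-valued
   integral.  At s = 0 it forces Phi t to be the continuous representative. *)
Record mild_solution lam T r (V : R -> R -> R[i]) (Phi : R -> sfield) : Prop := {
  mild_Hr : forall t : R, 0 <= t <= T -> (Hr_norm r (Phi t) < +oo)%E ;
  mild_measurable : forall (l : int) (i : 'I_2),
    measurable_fun `]0, T[
      (fun t => complex.Re (fourier (fun x => Phi t x i 0) l)) /\
    measurable_fun `]0, T[
      (fun t => complex.Im (fourier (fun x => Phi t x i 0) l)) ;
  mild_duhamel : forall t s x : R, 0 <= t -> 0 <= s -> t + s <= T ->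
    Phi (t + s) x = flow (- s) (Phi t) x
      - 'i *: \col_(i < 2) cintegral `[0, s] (fun rho =>
          flow (- (s - rho))
            (dirac_rhs lam (V (t + rho)) (Phi (t + rho))) x i 0)
}.

(* The self-consistent potential - d_xx^{-1} |Psi|^2. *)
Definition poisson_potential Psi : R -> R[i] := fun x =>
  - dxx_inv (fun y => `|comp1 Psi y| ^+ 2 + `|comp2 Psi y| ^+ 2) x.

Definition DP_solution lam T r (Phi : R -> sfield) : Prop :=
  mild_solution lam T r (fun t => poisson_potential (Phi t)) Phi.

Definition smooth (V : R -> R) : Prop :=
  forall (n : nat) (x : R), derivable (derive1n n V) x 1.

Definition NDE_solution lam T r (Ve : R -> R) (Phi : R -> sfield) : Prop :=
  mild_solution lam T r (fun _ x => (Ve x)%:C) Phi.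

Definition phi_p Psi : R -> R[i] := fun x => comp1 Psi x + comp2 Psi x.
Definition phi_m Psi : R -> R[i] := fun x => comp1 Psi x - comp2 Psi x.

Definition I1 tau Psi : sfield := fun x =>
  tau%:C *: (lift2 (phi1_dx (2 * tau)) (mx_act (beta *m Pi_minus) Psi) x
           + lift2 (phi1_dx (- (2 * tau))) (mx_act (beta *m Pi_plus) Psi) x).

Definition I2_ext (Ve : R -> R) tau Psi : sfield := fun x =>
  let V := fun y => (Ve y)%:C in
  tau%:C *: (phi1_dx tau V x *: (Pi_plus *m Psi x)
           + phi1_dx (- tau) V x *: (Pi_minus *m Psi x)).

Definition I2_DP tau Psi : sfield := fun x =>
  let p := phi_p Psi in
  let m := phi_m Psi in
  let c := p x * dxx_inv (fun y =>
    phi1_dx (2 * tau) (fun z => `|m z| ^+ 2) y + `|p y| ^+ 2) x in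
  let d := m x * dxx_inv (fun y =>
    phi1_dx (- (2 * tau)) (fun z => `|p z| ^+ 2) y + `|m y| ^+ 2) x in
  - (tau / 4)%:C *: vec2 (c + d) (c - d).

Definition I3 lam tau Psi : sfield := fun x =>
  let p := phi_p Psi in
  let m := phi_m Psi in
  let a := Num.conj (p x) * phi1_dx (2 * tau) (fun y => m y ^+ 2) x
         + p x * phi1_dx (2 * tau) (fun y => `|m y| ^+ 2) x in
  let b := m x * phi1_dx (- (2 * tau)) (fun y => `|p y| ^+ 2) x
         + Num.conj (m x) * phi1_dx (- (2 * tau)) (fun y => p y ^+ 2) x in
  (tau * lam / 4)%:C *: vec2 (a + b) (a - b).

Definition uli_step lam tau (I2 : sfield -> sfield) Psi : sfield := fun x =>
  flow (- tau) Psi x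
  - 'i *: flow (- tau) (fun y => I1 tau Psi y + I2 Psi y + I3 lam tau Psi y) x.

Definition Theta_ext lam (Ve : R -> R) tau : sfield -> sfield :=
  uli_step lam tau (I2_ext Ve tau).

Definition Theta_DP lam tau : sfield -> sfield := uli_step lam tau (I2_DP tau).

End Spinors.

(* Main.v *)
Require Import Defs.
From mathcomp Require Import all_boot all_order all_algebra.
From mathcomp Require finmap.
From mathcomp Require Import complex ring lra zify.
From mathcomp Require Import all_classical all_reals all_analysis.
From mathcomp Require Import measurable_realfun ess_sup_inf.
Import Order.TTheory GRing.Theory Num.Theory.
Import numFieldNormedType.Exports.

(** Why the theorem holds.

    In the characteristic components p = phi_1 + phi_2 and m = phi_1 - phi_2 the
    free Dirac flow is a pair of translations, p(x - t) and m(x + t)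
    ([flow_pm]), hence an isometry of H^r; and for r > 1/2 the space H^r is an
    algebra ([WM]), so that the right-hand side N(Phi) = beta Phi + V Phi +
    F(Phi) is bounded and Lipschitz on balls of H^r ([fam_Nlin],
    [fam_Nlin_lip]). The point of the scheme is that its terms I_1, I_2, I_3
    are not mere quadratures: s phi_1(k s d_x) f (x) is the integral of
    f (x + k t) over 0 <= t <= s ([phi1_dx_integral]), and therefore one step
    is exactly Duhamel's formula in which the unknown solution inside the
    integral is replaced by the free wave issued from the current value
    ([uli_step_pm]).

    The exact solution differs from its own free wave by O(tau) over a time
    step, in the H^r norm itself and thus without loss of derivatives
    ([free_flow_error]). Comparing the two Duhamel formulas, the error
    satisfies E_(n+1) <= E_n + tau L (K tau + E_n) ([error_step]), and summation
    gives O(tau) as long as the numerical solution stays in a fixed ball, which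
    the estimate itself guarantees for small tau ([uli_convergence]). A bound at
    every time for the exact solution, rather than almost everywhere, comes
    from Duhamel's formula once more ([uniform_bound]).

    The two systems differ only in their potential. Both are instances of the
    record [potential], whose main field asks that the term I_2 integrate the
    potential exactly along free waves. For the Poisson potential this holds
    because |p|^2 and |m|^2 are transported and d_xx^{-1} commutes with
    translations ([poisson_is_potential]); for a given potential it is the
    formula for phi_1 again ([external_is_potential]), once V is known to lie
    in H^r, which for a smooth function amounts to the decay of its Fourier
    coefficients and to the pointwise convergence of its Fourier series
    ([smooth_W]).

    Throughout, H^r is represented by its balls: W r B f says that f is the sum
    of its Fourier series, whose weighted l^2 norm is at most B, with the rate
    of convergence that Cauchy-Schwarz gives. Integrals of H^r-valued functions
    of time are pointwise integrals, estimated coefficientwise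
    ([fam_integral]). *)

Set Implicit Arguments.
Unset Strict Implicit.
Unset Printing Implicit Defensive.

Local Open Scope classical_set_scope.
Local Open Scope ring_scope.
Local Open Scope complex_scope.

(** * Complex numbers and the unit circle *)

Local Notation normc := Normc.normc.
Local Notation mu := lebesgue_measure.
Local Notation Icc a b := [set` `[a, b]].

Section ComplexBasics.
Context {R : realType}.
Implicit Types (z w : R[i]) (x y s : R).

Lemma cReD z w : complex.Re (z + w) = complex.Re z + complex.Re w.
Proof. by case: z w => [? ?] [? ?]. Qed.
Lemma cImD z w : complex.Im (z + w) = complex.Im z + complex.Im w.
Proof. by case: z w => [? ?] [? ?]. Qed.
Lemma cReN z : complex.Re (- z) = - complex.Re z.
Proof. by case: z. Qed.
Lemma cImN z : complex.Im (- z) = - complex.Im z.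
Proof. by case: z. Qed.
Lemma cReM z w : complex.Re (z * w) =
  complex.Re z * complex.Re w - complex.Im z * complex.Im w.
Proof. by case: z w => [? ?] [? ?]. Qed.
Lemma cImM z w : complex.Im (z * w) =
  complex.Re z * complex.Im w + complex.Im z * complex.Re w.
Proof. by case: z w => [? ?] [? ?]. Qed.
Lemma cReRe x : complex.Re x%:C = x. Proof. by []. Qed.

Lemma complexP z w : complex.Re z = complex.Re w ->
  complex.Im z = complex.Im w -> z = w.
Proof. by case: z w => [a b] [c d] /= -> ->. Qed.

Lemma conjE z : Num.conj z = (z^*)%C.
Proof. by []. Qed.

Lemma normcE2 z : normc z ^+ 2 = complex.Re z ^+ 2 + complex.Im z ^+ 2.
Proof. by case: z => a b /=; rewrite sqr_sqrtr // addr_ge0 ?sqr_ge0. Qed.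

Lemma normc_ge0 z : 0 <= normc z.
Proof. by case: z => a b; exact: sqrtr_ge0. Qed.

Lemma normcR x : normc x%:C = `|x|.
Proof. by rewrite /= expr0n addr0 sqrtr_sqr. Qed.

Lemma normC_normc z : `|z| = (normc z)%:C.
Proof. by case: z. Qed.

Lemma normc_conj z : normc (Num.conj z) = normc z.
Proof. by rewrite conjE; case: z => a b /=; rewrite sqrrN. Qed.

Lemma le_Re_normc z : `|complex.Re z| <= normc z.
Proof.
case: z => a b /=; rewrite -sqrtr_sqr ler_sqrt ?addr_ge0 ?sqr_ge0 //.
by rewrite lerDl sqr_ge0.
Qed.

Lemma le_Im_normc z : `|complex.Im z| <= normc z.
Proof.
case: z => a b /=; rewrite -sqrtr_sqr ler_sqrt ?addr_ge0 ?sqr_ge0 //.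
by rewrite lerDr sqr_ge0.
Qed.

Lemma normc_le_ReIm z : normc z <= `|complex.Re z| + `|complex.Im z|.
Proof.
rewrite -(@ler_pXn2r _ 2) ?nnegrE ?normc_ge0 ?addr_ge0 // normcE2 sqrrD.
by rewrite !real_normK ?num_real // -addrA lerD2l lerDr mulrn_wge0 ?mulr_ge0.
Qed.

Lemma normc_sum (I : Type) (s : seq I) (P : pred I) (F : I -> R[i]) :
  normc (\sum_(i <- s | P i) F i) <= \sum_(i <- s | P i) normc (F i).
Proof.
elim/big_rec2: _ => [|i y z _ h]; first by rewrite Normc.normc0.
by apply: le_trans (le_normcD _ _) _; rewrite lerD2l.
Qed.

(** The exponential of the imaginary number ix, with real trigonometric
    functions as parts so that measurability and integrals are read off
    directly. *)
Definition cis x : R[i] := cos x +i* sin x.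

Lemma cexp_imag x : cexp (imag x) = cis x.
Proof. by rewrite /cexp /= expR0 mul1r. Qed.

Lemma cisD x y : cis (x + y) = cis x * cis y.
Proof. by apply: complexP; rewrite ?cReM ?cImM /= ?cosD ?sinD; ring. Qed.

Lemma cis0 : cis 0 = 1.
Proof. by rewrite /cis cos0 sin0. Qed.

Lemma normc_cis x : normc (cis x) = 1.
Proof. by rewrite /= cos2Dsin2 sqrtr1. Qed.

Lemma conj_cis x : Num.conj (cis x) = cis (- x).
Proof. by rewrite conjE /cis cosN sinN. Qed.

Lemma cis2pi : cis (2 * pi) = 1.
Proof. by rewrite /cis (mulrC 2) mulr_natr cos2pi sin2pi. Qed.

Lemma cis2pi_int (l : int) : cis (l%:~R * (2 * pi)) = 1.
Proof.
have H (n : nat) : cis (n%:R * (2 * pi)) = 1.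
  elim: n => [|n IH]; first by rewrite mul0r cis0.
  by rewrite -natr1 mulrDl mul1r cisD IH cis2pi mulr1.
case: l => n; first by rewrite -pmulrn H.
by rewrite NegzE mulrNz mulNr -conj_cis -pmulrn H rmorph1.
Qed.

Lemma cis_periodic (l : int) x : cis (l%:~R * (x + 2 * pi)) = cis (l%:~R * x).
Proof. by rewrite mulrDr cisD cis2pi_int mulr1. Qed.

Lemma continuous_cis_Re (k : R) : continuous (fun x : R => cos (k * x)).
Proof.
by move=> x; apply: continuous_comp; [exact: mulrl_continuous|exact: continuous_cos].
Qed.

Lemma continuous_cis_Im (k : R) : continuous (fun x : R => sin (k * x)).
Proof.
by move=> x; apply: continuous_comp; [exact: mulrl_continuous|exact: continuous_sin].
Qed.

End ComplexBasics.

(** * Bounded measurable functions and their integrals *)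

Section BoundedMeasurable.
Context {R : realType}.
Implicit Types (D : set R) (f g : R -> R[i]) (s : R).

Definition cmfun D f := measurable_fun D (fun x => complex.Re (f x)) /\
  measurable_fun D (fun x => complex.Im (f x)).

Lemma cmfun_ext D f g : (forall x, D x -> f x = g x) -> cmfun D f -> cmfun D g.
Proof.
move=> fg [mr mi]; split.
- by apply: eq_measurable_fun mr => x /set_mem Dx; rewrite fg.
- by apply: eq_measurable_fun mi => x /set_mem Dx; rewrite fg.
Qed.

Lemma cmfun_cst D (c : R[i]) : cmfun D (fun=> c).
Proof. by split. Qed.

Lemma cmfunD D f g : cmfun D f -> cmfun D g -> cmfun D (fun x => f x + g x).
Proof.
move=> [fr fi] [gr gi]; split.
- by apply: eq_measurable_fun (measurable_funD fr gr) => x _; rewrite cReD.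
- by apply: eq_measurable_fun (measurable_funD fi gi) => x _; rewrite cImD.
Qed.

Lemma cmfunM D f g : cmfun D f -> cmfun D g -> cmfun D (fun x => f x * g x).
Proof.
move=> [fr fi] [gr gi]; split.
- apply: eq_measurable_fun (measurable_funB (measurable_funM fr gr)
    (measurable_funM fi gi)) => x _; by rewrite cReM.
- apply: eq_measurable_fun (measurable_funD (measurable_funM fr gi)
    (measurable_funM fi gr)) => x _; by rewrite cImM.
Qed.

Lemma cmfunN D f : cmfun D f -> cmfun D (fun x => - f x).
Proof.
move=> mf; apply: cmfun_ext (cmfunM (cmfun_cst D (-1)) mf) => x _.
by rewrite mulN1r.
Qed.

Lemma cmfunJ D f : cmfun D f -> cmfun D (fun x => Num.conj (f x)).
Proof.
move=> [fr fi]; split.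
  by apply: eq_measurable_fun fr => x _; rewrite conjE; case: (f x).
apply: (@eq_measurable_fun _ _ _ _ D (fun x => - complex.Im (f x))).
  by move=> x _; rewrite conjE; case: (f x).
exact: measurableT_comp.
Qed.

Lemma cmfun_sum D (I : Type) (s : seq I) (F : I -> R -> R[i]) :
  (forall i, cmfun D (F i)) -> cmfun D (fun x => \sum_(i <- s) F i x).
Proof.
move=> mF; elim: s => [|i s IH].
  by apply: cmfun_ext (cmfun_cst D 0) => x _; rewrite big_nil.
by apply: cmfun_ext (cmfunD (mF i) IH) => x _; rewrite big_cons.
Qed.

Lemma cmfun_comp (E D : set R) f (g : R -> R) : measurable E ->
  (forall x, D x -> E (g x)) -> cmfun E f -> measurable_fun D g ->
  cmfun D (fun x => f (g x)).
Proof.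
move=> mE DE [fr fi] mg.
have h : g @` D `<=` E by move=> _ [x Dx <-]; exact: DE.
split.
- exact: (measurable_comp mE h fr mg).
- exact: (measurable_comp mE h fi mg).
Qed.

(** Pointwise limits of measurable functions are measurable. The rate d n *
    B x is the form in which Fourier series converge; B is an arbitrary function
    of the point. *)
Lemma cmfun_lim D (F : nat -> R -> R[i]) f (d : nat -> R) (B : R -> R) :
  (forall n, cmfun D (F n)) -> d @ \oo --> 0 ->
  (forall n x, D x -> normc (f x - F n x) <= d n * B x) -> cmfun D f.
Proof.
move=> mF d0 dF.
have dB x : (fun n => d n * B x) @ \oo --> 0 by rewrite -(mul0r (B x)); exact: cvgMl.
have key (g : R -> nat -> R) (h : R -> R) : (forall x n, D x -> `|h x - g x n| <= d n * B x) ->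
   forall x, D x -> g x @ \oo --> h x.
  move=> H x Dx; apply/cvgrPdist_le => e e0.
  move/cvgrPdist_le: (dB x) => /(_ e e0); apply: filterS => n.
  rewrite sub0r normrN => hn; apply: le_trans (H x n Dx) _.
  exact: le_trans (ler_norm _) hn.
split.
- apply: (@measurable_fun_cvg _ _ _ D (fun n x => complex.Re (F n x))).
    by move=> n; case: (mF n).
  apply: (key (fun x n => complex.Re (F n x)) (fun x => complex.Re (f x))) => x n Dx.
  apply: le_trans (dF n x Dx); rewrite -cReN -cReD; exact: le_Re_normc.
- apply: (@measurable_fun_cvg _ _ _ D (fun n x => complex.Im (F n x))).
    by move=> n; case: (mF n).
  apply: (key (fun x n => complex.Im (F n x)) (fun x => complex.Im (f x))) => x n Dx.
  apply: le_trans (dF n x Dx); rewrite -cImN -cImD; exact: le_Im_normc.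
Qed.

Lemma cmfun_cis D (k : R) : measurable D -> cmfun D (fun x => cis (k * x)).
Proof.
move=> mD; split => /=.
- apply: measurable_funTS; apply: continuous_measurable_fun; exact: continuous_cis_Re.
- apply: measurable_funTS; apply: continuous_measurable_fun; exact: continuous_cis_Im.
Qed.

Definition cbdd D f := exists B : R, forall x, D x -> normc (f x) <= B.

(** Bounded measurable functions are stable under sums and products and
    integrable on bounded intervals: integrability is automatic for them. *)
Definition bmfun D f := cmfun D f /\ cbdd D f.

Lemma bmfun_ext D f g : (forall x, D x -> f x = g x) -> bmfun D f -> bmfun D g.
Proof.
move=> fg [mf [B bf]]; split; first exact: cmfun_ext mf.
by exists B => x Dx; rewrite -fg //; exact: bf.
Qed.

Lemma bmfun_cst D (c : R[i]) : bmfun D (fun=> c).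
Proof. by split; [exact: cmfun_cst|exists (normc c)]. Qed.

Lemma bmfunD D f g : bmfun D f -> bmfun D g -> bmfun D (fun x => f x + g x).
Proof.
move=> [mf [B bf]] [mg [A bg]]; split; first exact: cmfunD.
by exists (B + A) => x Dx; apply: le_trans (le_normcD _ _) _; apply: lerD; auto.
Qed.

Lemma bmfunM D f g : bmfun D f -> bmfun D g -> bmfun D (fun x => f x * g x).
Proof.
move=> [mf [B bf]] [mg [A bg]]; split; first exact: cmfunM.
exists (B * A) => x Dx; rewrite Normc.normcM; apply: ler_pM; rewrite ?normc_ge0 //; auto.
Qed.

Lemma bmfunN D f : bmfun D f -> bmfun D (fun x => - f x).
Proof.
move=> mf; apply: bmfun_ext (bmfunM (bmfun_cst D (-1)) mf) => x _.
by rewrite mulN1r.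
Qed.

Lemma bmfunB D f g : bmfun D f -> bmfun D g -> bmfun D (fun x => f x - g x).
Proof. by move=> hf hg; apply: bmfunD => //; exact: bmfunN. Qed.

Lemma bmfun_sum D (I : Type) (s : seq I) (F : I -> R -> R[i]) :
  (forall i, bmfun D (F i)) -> bmfun D (fun x => \sum_(i <- s) F i x).
Proof.
move=> mF; elim: s => [|i s IH].
  by apply: bmfun_ext (bmfun_cst D 0) => x _; rewrite big_nil.
by apply: bmfun_ext (bmfunD (mF i) IH) => x _; rewrite big_cons.
Qed.

Lemma bmfun_cis D (k : R) : measurable D -> bmfun D (fun x => cis (k * x)).
Proof.
move=> mD; split; first exact: cmfun_cis.
by exists 1 => x _; rewrite normc_cis.
Qed.

Lemma lebesgue_Icc_fin (a b : R) : (@lebesgue_measure R (Icc a b) < +oo)%E.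
Proof.
by rewrite lebesgue_measure_itv /=; case: ifPn => // _; rewrite -EFinB ltry.
Qed.

Lemma Rintegral_cst_Icc (a b r : R) : a <= b ->
  \int[mu]_(x in Icc a b) r = r * (b - a).
Proof.
move=> ab; have h : fine (@lebesgue_measure R (Icc a b)) = b - a.
  rewrite lebesgue_measure_itv /= lte_fin; case: ltP => // ba.
  by rewrite /= (le_anti (introT andP (conj ab ba))) subrr.
by rewrite -h; apply: Rintegral_cst.
Qed.

Lemma bm_integrable (a b : R) (u : R -> R) (B : R) :
  measurable_fun `[a, b] u -> (forall x, Icc a b x -> `|u x| <= B) ->
  mu.-integrable `[a, b] (EFin \o u).
Proof.
move=> mu_ bu; apply: measurable_bounded_integrable => //.
  exact: lebesgue_Icc_fin.
exists B; split; first exact: num_real.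
by move=> C BC x Dx /=; apply: le_trans (ltW BC); exact: bu.
Qed.

Lemma bmfun_intRe (a b : R) f : bmfun `[a, b] f ->
  mu.-integrable `[a, b] (EFin \o (fun x => complex.Re (f x))).
Proof.
move=> [[mr _] [B bf]]; apply: (@bm_integrable _ _ _ B) => // x Dx.
exact: le_trans (le_Re_normc _) (bf x Dx).
Qed.

Lemma bmfun_intIm (a b : R) f : bmfun `[a, b] f ->
  mu.-integrable `[a, b] (EFin \o (fun x => complex.Im (f x))).
Proof.
move=> [[_ mi] [B bf]]; apply: (@bm_integrable _ _ _ B) => // x Dx.
exact: le_trans (le_Im_normc _) (bf x Dx).
Qed.

Lemma eq_cintegral D f g : (forall x, D x -> f x = g x) ->
  cintegral D f = cintegral D g.
Proof.
move=> fg; congr (_ +i* _); apply: eq_Rintegral => x /set_mem Dx; by rewrite fg.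
Qed.

Definition cintble (a b : R) f :=
  mu.-integrable `[a, b] (EFin \o (fun x => complex.Re (f x))) /\
  mu.-integrable `[a, b] (EFin \o (fun x => complex.Im (f x))).

Lemma bm_cintble (a b : R) f : bmfun `[a, b] f -> cintble a b f.
Proof. by move=> hf; split; [exact: bmfun_intRe|exact: bmfun_intIm]. Qed.

Lemma cintegralD_int (a b : R) f g : cintble a b f -> cintble a b g ->
  cintegral `[a, b] (fun x => f x + g x) = cintegral `[a, b] f + cintegral `[a, b] g.
Proof.
move=> [fr fi] [gr gi]; apply: complexP; rewrite ?cReD ?cImD /=.
- by rewrite -RintegralD //; apply: eq_Rintegral => x _; rewrite cReD.
- by rewrite -RintegralD //; apply: eq_Rintegral => x _; rewrite cImD.
Qed.

Lemma integrable_scale (a b k : R) (u : R -> R) :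
  mu.-integrable `[a, b] (EFin \o u) ->
  mu.-integrable `[a, b] (EFin \o (fun x => k * u x)).
Proof. by move=> iu; apply: (integrableZl _ k iu). Qed.

Lemma cintegralZ_int (a b : R) (c : R[i]) f : cintble a b f ->
  cintegral `[a, b] (fun x => c * f x) = c * cintegral `[a, b] f.
Proof.
move=> [hr hi]; apply: complexP; rewrite ?cReM ?cImM /=.
- rewrite -!RintegralZl // -RintegralB //; [|exact: integrable_scale..].
  by apply: eq_Rintegral => x _; rewrite cReM.
- rewrite -!RintegralZl // -RintegralD //; [|exact: integrable_scale..].
  by apply: eq_Rintegral => x _; rewrite cImM.
Qed.

Lemma cintegralD (a b : R) f g : bmfun `[a, b] f -> bmfun `[a, b] g ->
  cintegral `[a, b] (fun x => f x + g x) = cintegral `[a, b] f + cintegral `[a, b] g.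
Proof. by move=> hf hg; apply: cintegralD_int; exact: bm_cintble. Qed.

Lemma cintegralZ (a b : R) (c : R[i]) f : bmfun `[a, b] f ->
  cintegral `[a, b] (fun x => c * f x) = c * cintegral `[a, b] f.
Proof. by move=> hf; apply: cintegralZ_int; exact: bm_cintble. Qed.

Lemma cintegralB (a b : R) f g : bmfun `[a, b] f -> bmfun `[a, b] g ->
  cintegral `[a, b] (fun x => f x - g x) = cintegral `[a, b] f - cintegral `[a, b] g.
Proof.
move=> hf hg; rewrite cintegralD //; last exact: bmfunN.
congr (_ + _); rewrite -mulN1r -cintegralZ //.
by apply: eq_cintegral => x _; rewrite mulN1r.
Qed.

Lemma cintegral_ae (D N : set R) f g : measurable D -> measurable N -> lebesgue_measure N = 0%E ->
  cmfun D f -> cmfun D g ->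
  (forall rho, D rho -> ~ N rho -> f rho = g rho) ->
  cintegral D f = cintegral D g.
Proof.
move=> mD mN N0 [fr fi] [gr gi] fg.
have ae (h : R[i] -> R) : ae_eq lebesgue_measure D (EFin \o (h \o f)) (EFin \o (h \o g)).
  exists N; split=> // rho /= hn; apply: contrapT => nN; apply: hn => hrho /=.
  by rewrite fg.
apply: complexP; rewrite /cintegral /=; congr fine; apply: ae_eq_integral => //.
- by apply/measurable_EFinP.
- by apply/measurable_EFinP.
- exact: ae.
- by apply/measurable_EFinP.
- by apply/measurable_EFinP.
- exact: ae.
Qed.

Lemma cintegral_cst (a b : R) (c : R[i]) : a <= b ->
  cintegral `[a, b] (fun=> c) = c * (b - a)%:C.
Proof.
by move=> ab; apply: complexP; rewrite ?cReM ?cImM /= Rintegral_cst_Icc //; ring.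
Qed.

Lemma cintegral0 (a b : R) : cintegral `[a, b] (fun=> 0) = 0.
Proof. by apply: complexP; rewrite /= Rintegral_cst // mul0r. Qed.

Lemma cintegral_pt (a : R) f : cintegral `[a, a] f = 0.
Proof. by rewrite /cintegral set_itv1 !Rintegral_set1. Qed.

Lemma cintegral_sum (a b : R) (I : Type) (s : seq I) (F : I -> R -> R[i]) :
  (forall i, bmfun `[a, b] (F i)) ->
  cintegral `[a, b] (fun x => \sum_(i <- s) F i x) =
  \sum_(i <- s) cintegral `[a, b] (F i).
Proof.
move=> mF; elim: s => [|i s IH].
  rewrite big_nil -[RHS](cintegral0 a b).
  by apply: eq_cintegral => x _; rewrite big_nil.
rewrite big_cons -IH -cintegralD //; last exact: bmfun_sum.
by apply: eq_cintegral => x _; rewrite big_cons.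
Qed.

Lemma Rintegral_norm_le (a b : R) (u : R -> R) (B : R) : a <= b ->
  measurable_fun `[a, b] u -> (forall x, Icc a b x -> `|u x| <= B) ->
  `|\int[mu]_(x in `[a, b]) u x| <= (b - a) * B.
Proof.
move=> ab mu_ bu; have iu := bm_integrable mu_ bu.
apply: le_trans (le_normr_Rintegral _ iu) _; first by [].
have -> : (b - a) * B = \int[mu]_(x in `[a, b]) B.
  by rewrite Rintegral_cst_Icc // mulrC.
apply: le_Rintegral => //.
- apply: (@bm_integrable _ _ _ B); first exact: measurableT_comp.
  by move=> x Dx; rewrite normr_id; exact: bu.
- by apply: (@bm_integrable _ _ _ `|B|).
Qed.

(** Bounding real and imaginary parts separately costs a factor 2, which is
    harmless where no sharp constant is needed. *)
Lemma cintegral_bound (a b : R) f (B : R) : a <= b -> cmfun `[a, b] f ->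
  (forall x, Icc a b x -> normc (f x) <= B) ->
  normc (cintegral `[a, b] f) <= (b - a) * (2 * B).
Proof.
move=> ab [fr fi] bf; apply: le_trans (normc_le_ReIm _) _ => /=.
rewrite (_ : 2 * B = B + B) ?mulrDr; last by ring.
apply: lerD; apply: Rintegral_norm_le => // x Dx.
- exact: le_trans (le_Re_normc _) (bf x Dx).
- exact: le_trans (le_Im_normc _) (bf x Dx).
Qed.

(** Cauchy-Schwarz against the constant 1, from the nonnegativity of the
    variance of u. *)
Lemma Rintegral_sqr_le (s : R) (u : R -> R) (B : R) : 0 <= s ->
  measurable_fun `[0, s] u -> (forall x, Icc 0 s x -> `|u x| <= B) ->
  (\int[mu]_(x in `[0, s]) u x) ^+ 2 <= s * \int[mu]_(x in `[0, s]) (u x ^+ 2).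
Proof.
rewrite le_eqVlt => /predU1P[<-|s0] mu_ bu.
  by rewrite set_itv1 Rintegral_set1 mul0r expr0n.
have iu := bm_integrable mu_ bu.
have iu2 : mu.-integrable `[0, s] (EFin \o (fun x => u x ^+ 2)).
  apply: (@bm_integrable _ _ _ (B ^+ 2)); first exact: measurable_funX.
  by move=> x Dx; rewrite normrX lerXn2r ?nnegrE // ?(le_trans _ (bu x Dx)) ?bu.
set I := \int[mu]_(x in `[0, s]) u x.
set J := \int[mu]_(x in `[0, s]) (u x ^+ 2).
pose k := 2 * (I / s).
have iku : mu.-integrable `[0, s] (EFin \o (fun x => k * u x)).
  exact: (integrableZl _ k iu).
have ic : mu.-integrable `[0, s] (EFin \o (fun x : R => (I / s) ^+ 2)).
  by apply: (@bm_integrable _ _ _ `|(I / s) ^+ 2|).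
have : 0 <= \int[mu]_(x in `[0, s]) ((u x ^+ 2 - k * u x) + (I / s) ^+ 2).
  apply: Rintegral_ge0 => x _.
  have -> : u x ^+ 2 - k * u x + (I / s) ^+ 2 = (u x - I / s) ^+ 2.
    by rewrite /k; ring.
  exact: sqr_ge0.
rewrite RintegralD //; last first.
  exact: (integrableB _ iu2 iku).
rewrite RintegralB // RintegralZl // (Rintegral_cst_Icc _ (ltW s0)) subr0 -/I -/J => h.
have sn0 : s != 0 by rewrite gt_eqF.
have {h} : 0 <= J - I ^+ 2 / s.
  suff -> : J - I ^+ 2 / s = J - k * I + (I / s) ^+ 2 * s by [].
  by rewrite /k; field.
by rewrite subr_ge0 ler_pdivrMr // mulrC.
Qed.

(** Unlike [cintegral_bound], this estimate has the sharp constant;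
    Minkowski's inequality for integrals in H^r rests on it. *)
Lemma cintegral_sqr (s : R) f : 0 <= s -> bmfun `[0, s] f ->
  normc (cintegral `[0, s] f) ^+ 2 <=
  s * \int[mu]_(x in `[0, s]) (normc (f x) ^+ 2).
Proof.
move=> s0 [[fr fi] [B bf]].
have br x : Icc 0 s x -> `|complex.Re (f x)| <= B.
  by move=> Dx; apply: le_trans (le_Re_normc _) (bf x Dx).
have bi x : Icc 0 s x -> `|complex.Im (f x)| <= B.
  by move=> Dx; apply: le_trans (le_Im_normc _) (bf x Dx).
have sq (u : R -> R) : measurable_fun `[0, s] u ->
    (forall x, Icc 0 s x -> `|u x| <= B) ->
    mu.-integrable `[0, s] (EFin \o (fun x => u x ^+ 2)).
  move=> mu_ bu; apply: (@bm_integrable _ _ _ (B ^+ 2)); first exact: measurable_funX.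
  by move=> x Dx; rewrite normrX lerXn2r ?nnegrE // ?(le_trans _ (bu x Dx)) ?bu.
rewrite normcE2 /=; apply: le_trans (lerD (Rintegral_sqr_le s0 fr br) (Rintegral_sqr_le s0 fi bi)) _.
rewrite -mulrDr ler_wpM2l // -RintegralD //; [|exact: sq..].
rewrite le_eqVlt; apply/orP; left; apply/eqP.
by apply: eq_Rintegral => x _; rewrite normcE2.
Qed.

Lemma Rintegral_derive (s : R) u v : 0 < s ->
  (forall x, is_derive (x : R) 1 u (v x)) -> continuous v ->
  \int[mu]_(x in `[0, s]) v x = u s - u 0.
Proof.
move=> s0 dF cf; rewrite /Rintegral (@continuous_FTC2 _ v u 0 s) //.
- exact: continuous_subspaceT.
- split.
  + move=> x _; exact: (@ex_derive _ _ _ _ _ _ _ (dF x)).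
  + apply: cvg_at_right_filter; apply: differentiable_continuous.
    by apply/derivable1_diffP; apply: (@ex_derive _ _ _ _ _ _ _ (dF 0)).
  + apply: cvg_at_left_filter; apply: differentiable_continuous.
    by apply/derivable1_diffP; apply: (@ex_derive _ _ _ _ _ _ _ (dF s)).
- by move=> x _; rewrite derive1E; apply: derive_val.
Qed.

Lemma cintegral_cis (s k : R) : 0 <= s -> k != 0 ->
  cintegral `[0, s] (fun x => cis (k * x)) = (cis (k * s) - 1) / imag k.
Proof.
rewrite le_eqVlt => /predU1P[<-|s0] k0.
  by rewrite cintegral_pt mulr0 cis0 subrr mul0r.
have c1 : \int[mu]_(x in `[0, s]) cos (k * x) = k^-1 * sin (k * s).
  apply: etrans (@Rintegral_derive s (fun x => k^-1 * sin (k * x)) _ s0 _ _) _.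
  - by move=> x; apply: is_derive_eq; rewrite /GRing.scale /=; field.
  - exact: continuous_cis_Re.
  - by rewrite mulr0 sin0 mulr0 subr0.
have c2 : \int[mu]_(x in `[0, s]) sin (k * x) = k^-1 * (1 - cos (k * s)).
  apply: etrans (@Rintegral_derive s (fun x => - k^-1 * cos (k * x)) _ s0 _ _) _.
  - by move=> x; apply: is_derive_eq; rewrite /GRing.scale /=; field.
  - exact: continuous_cis_Im.
  - by rewrite mulr0 cos0; ring.
rewrite /cintegral /= c1 c2.
have ik : imag k != 0 :> R[i] by rewrite /imag eq_complex /= eqxx.
apply: (mulIf ik); rewrite divfK //.
by apply: complexP; rewrite ?cReM ?cImM ?cReD ?cImD /=; field.
Qed.

End BoundedMeasurable.

(** * Finite sums over integers *)

(** The integers of absolute value at most N. The lock keeps simplification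
    from enumerating them. *)
Definition zrange (N : nat) : seq int :=
  locked [seq k%:Z - N%:Z | k <- iota 0 N.*2.+1].

Section FiniteSums.

Lemma sum_uniq_le (R : realType) (I : eqType) (s s' : seq I) (F : I -> R) :
  uniq s -> uniq s' -> {subset s <= s'} -> (forall i, 0 <= F i) ->
  \sum_(i <- s) F i <= \sum_(i <- s') F i.
Proof.
move=> us us' ss' F0; rewrite [leRHS](bigID (mem s)) /= -[leLHS]addr0.
apply: lerD; last exact: sumr_ge0.
rewrite -[X in _ <= X]big_filter le_eqVlt; apply/orP; left; apply/eqP.
apply: perm_big; apply: uniq_perm => //; first exact: filter_uniq.
move=> i; rewrite mem_filter /=; case: (boolP (i \in s)) => //= /ss' -> //.
Qed.

Lemma sum_uniq_supp (V : nmodType) (I : eqType) (s s' : seq I) (F : I -> V) :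
  uniq s -> uniq s' -> {subset s <= s'} ->
  (forall i, i \in s' -> i \notin s -> F i = 0) ->
  \sum_(i <- s') F i = \sum_(i <- s) F i.
Proof.
move=> us us' ss' F0; rewrite (bigID (mem s)) /= [X in _ + X]big1_seq ?addr0; last first.
  by move=> i /andP[si s'i]; exact: F0.
rewrite -big_filter; apply: perm_big; apply: uniq_perm => //; first exact: filter_uniq.
move=> i; rewrite mem_filter /=; case: (boolP (i \in s)) => //= /ss' -> //.
Qed.

Lemma cauchy_schwarz_sum (R : realType) (I : Type) (s : seq I) (a b : I -> R) :
  (\sum_(i <- s) a i * b i) ^+ 2 <=
  (\sum_(i <- s) a i ^+ 2) * (\sum_(i <- s) b i ^+ 2).
Proof.
elim: s => [|i s IH]; first by rewrite !big_nil expr0n mulr0.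
rewrite !big_cons; set S := \sum_(j <- s) a j * b j in IH *.
have : 0 <= \sum_(j <- s) a j ^+ 2 by apply: sumr_ge0 => j _; exact: sqr_ge0.
have : 0 <= \sum_(j <- s) b j ^+ 2 by apply: sumr_ge0 => j _; exact: sqr_ge0.
move: IH; set A := \sum_(j <- s) a j ^+ 2; set B := \sum_(j <- s) b j ^+ 2.
move: (a i) (b i) => x y SAB B0 A0.
have h : 2 * (x * y * S) <= x ^+ 2 * B + y ^+ 2 * A.
  apply: le_trans (ler_norm _) _.
  have p0 : 0 <= x ^+ 2 * B + y ^+ 2 * A by rewrite addr_ge0 // mulr_ge0 // sqr_ge0.
  rewrite -(@ler_pXn2r _ 2) ?nnegrE // real_normK ?num_real //.
  have h1 : 0 <= (x ^+ 2 * B - y ^+ 2 * A) ^+ 2 by exact: sqr_ge0.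
  have h2 : (x * y) ^+ 2 * S ^+ 2 <= (x * y) ^+ 2 * (A * B).
    by rewrite ler_wpM2l ?sqr_ge0.
  lra.
lra.
Qed.

Lemma zrange_uniq N : uniq (zrange N).
Proof. by rewrite /zrange -lock map_inj_uniq ?iota_uniq // => a b; lia. Qed.

Lemma mem_zrange N (l : int) : (l \in zrange N) = (`|l| <= N)%N.
Proof.
rewrite /zrange -lock; apply/mapP/idP => [[k]|lN]; first by rewrite mem_iota => + ->; lia.
exists (absz (l + N%:Z)); first by rewrite mem_iota; lia.
lia.
Qed.

Lemma zrange_mono (N M : nat) : (N <= M)%N -> {subset zrange N <= zrange M}.
Proof. by move=> NM l; rewrite !mem_zrange => h; apply: leq_trans NM. Qed.

Lemma zrange_cover (s : seq int) : exists M, {subset s <= zrange M}.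
Proof.
elim: s => [|l s [M hM]]; first by exists 0%N.
exists (maxn `|l|%N M) => k; rewrite in_cons => /predU1P[->|/hM].
  by rewrite mem_zrange leq_maxl.
by rewrite !mem_zrange => h; rewrite leq_max h orbT.
Qed.

Lemma zpartialE (R : realType) (a : int -> R[i]) N :
  zpartial a N = \sum_(l <- zrange N) a l.
Proof.
rewrite /zpartial /zrange -lock big_map -[X in iota 0 X]subn0.
by rewrite -/(index_iota 0 _) big_mkord.
Qed.

Lemma big_zrangeS (V : nmodType) (F : int -> V) N :
  \sum_(l <- zrange N.+1) F l =
  F N.+1%:Z + (F (- N.+1%:Z) + \sum_(l <- zrange N) F l).
Proof.
have -> : F N.+1%:Z + (F (- N.+1%:Z) + \sum_(l <- zrange N) F l) =
    \sum_(l <- [:: N.+1%:Z, - N.+1%:Z & zrange N]) F l by rewrite !big_cons.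
apply: perm_big; apply: uniq_perm; first exact: zrange_uniq.
  rewrite 2!cons_uniq zrange_uniq andbT in_cons !mem_zrange; lia.
by move=> l; rewrite 2!in_cons !mem_zrange; lia.
Qed.

End FiniteSums.

(** * The weights of the Sobolev norm *)

Section Weights.
Context {R : realType} (r : R) (hr : 2^-1 < r).

Definition wt (l : int) : R := (1 + l%:~R ^+ 2) `^ r.

Let r0 : 0 < r. Proof. by apply: lt_trans hr; rewrite invr_gt0. Qed.

Lemma wt_base_ge1 (l : int) : 1 <= 1 + l%:~R ^+ 2 :> R.
Proof. by rewrite lerDl sqr_ge0. Qed.

Lemma wt_gt0 l : 0 < wt l.
Proof. by apply: powR_gt0; apply: lt_le_trans (wt_base_ge1 l). Qed.

Lemma wt_ge0 l : 0 <= wt l.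
Proof. exact: ltW (wt_gt0 l). Qed.

Lemma wt_ge1 l : 1 <= wt l.
Proof.
rewrite -(_ : 1 `^ r = 1); last by rewrite powR1.
apply: ge0_ler_powR; rewrite ?nnegrE //; first exact: ltW.
  by apply: le_trans (wt_base_ge1 l).
exact: wt_base_ge1.
Qed.

Lemma wtN l : wt (- l) = wt l.
Proof. by rewrite /wt mulrNz sqrrN. Qed.

Definition wt_split_cst : R := 4 `^ r.

(** The inequality behind the algebra property: since l = j + (l - j), one
    of j and l - j is at least of the size of l / 2. *)
Lemma wt_split l j : wt l <= wt_split_cst * (wt j + wt (l - j)).
Proof.
set a : R := 1 + j%:~R ^+ 2; set b : R := 1 + (l - j)%:~R ^+ 2.
have ab : 1 + l%:~R ^+ 2 <= 4 * Num.max a b.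
  (* 1 + l^2 <= 2 (1 + j^2) + 2 (1 + (l - j)^2), from (l - 2 j)^2 >= 0 *)
  have h : 1 + l%:~R ^+ 2 <= 2 * a + 2 * b.
    rewrite /a /b rmorphB /=; have := sqr_ge0 (l%:~R - 2 * j%:~R : R); lra.
  have : a <= Num.max a b by rewrite le_max lexx.
  have : b <= Num.max a b by rewrite le_max lexx orbT.
  lra.
have a1 := wt_base_ge1 j; have b1 := wt_base_ge1 (l - j).
have m0 : 0 <= Num.max a b by rewrite le_max (le_trans _ a1).
have p0 : 0 <= wt_split_cst by exact: powR_ge0.
apply: le_trans (_ : (4 * Num.max a b) `^ r <= _).
  apply: ge0_ler_powR; rewrite ?nnegrE ?(ltW r0) ?mulr_ge0 //.
  exact: le_trans (wt_base_ge1 l).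
rewrite powRM // ler_wpM2l //; case: (leP a b) => _.
  by rewrite lerDr wt_ge0.
by rewrite lerDl wt_ge0.
Qed.

Definition wtsum (N : nat) : R := \sum_(l <- zrange N) (wt l)^-1.

Lemma wtV_ge0 l : 0 <= (wt l)^-1.
Proof. by rewrite invr_ge0 wt_ge0. Qed.

Lemma wtV_le1 l : (wt l)^-1 <= 1.
Proof. by rewrite invf_le1 ?wt_gt0 // wt_ge1. Qed.

Lemma wtsumS N : wtsum N.+1 = wtsum N + 2 * (wt N.+1%:Z)^-1.
Proof. by rewrite /wtsum big_zrangeS wtN; ring. Qed.

(** With q = 2 r - 1 > 0, the term n^(-1-q) is compared with the decrement
    of n^(-q), whose sum telescopes. This is where r > 1/2 is used. *)
Lemma wtV_telescope (n : nat) :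
  (wt n.+2%:Z)^-1 * (2 * r - 1) <=
  n.+1%:R `^ (- (2 * r - 1)) - n.+2%:R `^ (- (2 * r - 1)).
Proof.
set q := 2 * r - 1; have q0 : 0 < q by rewrite /q; move: hr; lra.
set a : R := ln n.+2%:R; set b : R := ln n.+1%:R.
have n1 : 0 < n.+1%:R :> R by rewrite ltr0n.
have n2 : 0 < n.+2%:R :> R by rewrite ltr0n.
have ab : n.+2%:R^-1 <= a - b.
  have : ln (1 - n.+2%:R^-1) <= - n.+2%:R^-1 :> R.
    (* ln (1 - 1/(n+2)) <= - 1/(n+2), hence the difference of the logarithms
       of n+2 and n+1 is at least 1/(n+2) *)
    apply: le_ln1Dx; rewrite ltrN2 invf_lt1 // ltr1n //.
  have -> : 1 - n.+2%:R^-1 = n.+1%:R / n.+2%:R :> R.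
    have : n.+2%:R = n.+1%:R + 1 :> R by rewrite -natr1.
    move=> e; apply: (mulIf (lt0r_neq0 n2)); rewrite divfK ?gt_eqF // mulrBl mulVf ?gt_eqF //.
    by rewrite e; ring.
  rewrite ln_div ?posrE // -/a -/b => h; by rewrite -(opprB b a) lerNr.
have e2 : n.+2%:R `^ (- q) = expR (- q * a) by rewrite /powR gt_eqF.
have e1 : n.+1%:R `^ (- q) = expR (- q * a) * expR (q * (a - b)).
  by rewrite /powR gt_eqF // -expRD; congr expR; rewrite -/b; ring.
have h : 1 + q * n.+2%:R^-1 <= expR (q * (a - b)).
  apply: le_trans (expR_ge1Dx _); rewrite lerD2l ler_wpM2l // ltW //.
have w : (wt n.+2%:Z)^-1 <= expR (- q * a) * n.+2%:R^-1.
  rewrite -[leRHS]invrK invfM invrK -expRN mulNr opprK.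
  rewrite lef_pV2 ?posrE ?wt_gt0 ?mulr_gt0 ?expR_gt0 //.
  have -> : expR (q * a) * n.+2%:R = (n.+2%:R ^+ 2) `^ r.
    rewrite -powR_mulrn ?ltW // -powRrM /powR gt_eqF // -/a.
    rewrite -[X in _ * X](lnK n2) -/a -expRD.
    by congr expR; rewrite /q; ring.
  apply: ge0_ler_powR; rewrite ?nnegrE ?(ltW r0) ?sqr_ge0 //.

  by rewrite -pmulrn lerDr.
rewrite e1 e2; have E := expR_gt0 (- q * a).
apply: le_trans (_ : expR (- q * a) * n.+2%:R^-1 * q <= _).
  by rewrite ler_wpM2r // ltW.
have : expR (- q * a) * (1 + q * n.+2%:R^-1) <= expR (- q * a) * expR (q * (a - b)).
  by rewrite ler_wpM2l // ltW.
rewrite mulrDr mulr1 => h'; rewrite lerBrDl; apply: le_trans h'.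
by rewrite lerD2l [q / _]mulrC mulrA.
Qed.

Lemma wtsum_bound : exists Q : R, forall N, wtsum N <= Q.
Proof.
have q0 : 0 < 2 * r - 1 by move: hr; lra.
set q := 2 * r - 1 in q0 *.
have w0 : wtsum 0 <= 1 by rewrite /wtsum /zrange -lock /= big_seq1 wtV_le1.
have H N : wtsum N.+1 <= 3 + 2 / q * (1 - N.+1%:R `^ (- q)).
  elim: N => [|N IH].
    rewrite wtsumS powR1 subrr mulr0 addr0; have := wtV_le1 1%:Z; lra.
  rewrite wtsumS; have h := wtV_telescope N.
  have : 2 / q * ((wt N.+2)^-1 * q) <= 2 / q * (N.+1%:R `^ (- q) - N.+2%:R `^ (- q)).
    by rewrite ler_wpM2l // divr_ge0 // ltW.
  have -> : 2 / q * ((wt N.+2)^-1 * q) = 2 * (wt N.+2)^-1.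
    have wn := lt0r_neq0 (wt_gt0 N.+2%:Z); have qn := lt0r_neq0 q0.
    by field; rewrite wn qn.
  lra.
exists (3 + 2 / q) => -[|N].
  apply: le_trans w0 _; have h : 0 <= 2 / q by rewrite divr_ge0 // ltW.
  lra.
apply: le_trans (H N) _; rewrite lerD2l ler_piMr ?divr_ge0 ?(ltW q0) //.
Qed.

Lemma wtsum_nondec : nondecreasing_seq wtsum.
Proof.
apply/nondecreasing_seqP => N; rewrite wtsumS lerDl mulr_ge0 //; exact: wtV_ge0.
Qed.

Lemma wtsum_cvg : cvgn wtsum.
Proof.
apply: nondecreasing_is_cvgn; first exact: wtsum_nondec.
by have [Q hQ] := wtsum_bound; exists Q => _ [N _ <-].
Qed.

Definition wttot : R := limn wtsum.

Lemma wtsum_le N : wtsum N <= wttot.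
Proof. exact: (nondecreasing_cvgn_le wtsum_nondec wtsum_cvg). Qed.

(** delta N is the l^2 norm of 1 / sqrt w outside [-N, N], and kappa the one
    over all integers: by Cauchy-Schwarz, delta N bounds the error of the N-th
    symmetric partial sum of a Fourier series of H^r norm 1, uniformly in the
    point. *)
Definition delta (N : nat) : R := Num.sqrt (wttot - wtsum N).
Definition kappa : R := Num.sqrt wttot.

Lemma delta_ge0 N : 0 <= delta N. Proof. exact: sqrtr_ge0. Qed.

Lemma wttot_ge0 : 0 <= wttot.
Proof. by apply: le_trans (wtsum_le 0); apply: sumr_ge0 => l _; exact: wtV_ge0. Qed.

Lemma kappa_ge0 : 0 <= kappa. Proof. exact: sqrtr_ge0. Qed.

Lemma delta_kappa N : delta N <= kappa.
Proof.
apply: ler_wsqrtr; rewrite gerBl; apply: sumr_ge0 => l _; exact: wtV_ge0.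
Qed.

Lemma delta_cvg : delta @ \oo --> 0.
Proof.
rewrite -(@sqrtr0 R).
apply: (@continuous_cvg _ _ _ (nbhs \oo) _ (fun N => wttot - wtsum N) (@Num.sqrt R)).
  exact: sqrt_continuous.
rewrite -(subrr wttot); apply: cvgB; [exact: cvg_cst|exact: wtsum_cvg].
Qed.

Lemma wtV_tail (N : nat) (s : seq int) : uniq s ->
  {in s, forall l, l \notin zrange N} ->
  \sum_(l <- s) (wt l)^-1 <= delta N ^+ 2.
Proof.
move=> us sN; rewrite sqr_sqrtr ?subr_ge0 ?wtsum_le // lerBrDr.
have [M hM] := zrange_cover (s ++ zrange N).
apply: le_trans (wtsum_le M); rewrite /wtsum -big_cat /=.
apply: sum_uniq_le => //; [|exact: zrange_uniq|exact: wtV_ge0].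
rewrite cat_uniq us zrange_uniq andbT andTb; apply/hasPn => l lN; apply/negP => /= ls.
by move: (sN l ls); rewrite lN.
Qed.

Lemma wtV_sum (s : seq int) : uniq s -> \sum_(l <- s) (wt l)^-1 <= kappa ^+ 2.
Proof.
move=> us; rewrite sqr_sqrtr ?wttot_ge0 //.
have [M hM] := zrange_cover s; apply: le_trans (wtsum_le M).
by apply: sum_uniq_le => //; [exact: zrange_uniq|exact: wtV_ge0].
Qed.

Implicit Types (c d : int -> R[i]) (B : R) (s : seq int).

Definition wsum s c : R := \sum_(l <- s) wt l * normc (c l) ^+ 2.

Lemma wsum_ge0 s c : 0 <= wsum s c.
Proof. by apply: sumr_ge0 => l _; rewrite mulr_ge0 ?wt_ge0 ?sqr_ge0. Qed.

(** The weighted l^2 norm of c is at most B. Quantifying over finite sets of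
    frequencies avoids infinite sums. *)
Definition wnorm_le c B := 0 <= B /\ forall s, uniq s -> wsum s c <= B ^+ 2.

(** Cauchy-Schwarz: |c l| is the product of (w l)^(-1/2) and (w l)^(1/2) |c
    l|. *)
Lemma l1_weighted s c (D B : R) : 0 <= D -> 0 <= B ->
  \sum_(l <- s) (wt l)^-1 <= D ^+ 2 -> wsum s c <= B ^+ 2 ->
  \sum_(l <- s) normc (c l) <= D * B.
Proof.
move=> D0 B0 hD hB.
have e l : normc (c l) = Num.sqrt (wt l)^-1 * (Num.sqrt (wt l) * normc (c l)).
  by rewrite mulrA -sqrtrM ?wtV_ge0 // mulVf ?gt_eqF ?wt_gt0 // sqrtr1 mul1r.
rewrite -(@ler_pXn2r _ 2) ?nnegrE ?mulr_ge0 //; last first.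
  by apply: sumr_ge0 => l _; exact: normc_ge0.
rewrite (eq_bigr _ (fun l _ => e l)); apply: le_trans (cauchy_schwarz_sum _ _ _) _.
rewrite exprMn; apply: ler_pM.
- by apply: sumr_ge0 => l _; exact: sqr_ge0.
- by apply: sumr_ge0 => l _; exact: sqr_ge0.
- by rewrite (eq_bigr (fun l => (wt l)^-1)) // => l _; rewrite sqr_sqrtr ?wtV_ge0.
- rewrite (eq_bigr (fun l => wt l * normc (c l) ^+ 2)) // => l _.
  by rewrite exprMn sqr_sqrtr ?wt_ge0.
Qed.

Lemma wnorm_tail c B N s : wnorm_le c B -> uniq s -> {in s, forall l, l \notin zrange N} ->
  \sum_(l <- s) normc (c l) <= delta N * B.
Proof.
move=> [B0 hB] us sN; apply: l1_weighted => //; first exact: delta_ge0.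
- exact: wtV_tail.
- exact: hB.
Qed.

Lemma wnorm_l1 c B s : wnorm_le c B -> uniq s -> \sum_(l <- s) normc (c l) <= kappa * B.
Proof.
move=> [B0 hB] us; apply: l1_weighted => //; first exact: kappa_ge0.
- exact: wtV_sum.
- exact: hB.
Qed.

Lemma wnorm_coef c B l : wnorm_le c B -> normc (c l) <= B.
Proof.
move=> [B0 hB]; rewrite -(@ler_pXn2r _ 2) ?nnegrE ?normc_ge0 //.
apply: le_trans (hB [:: l] isT); rewrite /wsum big_seq1.
by rewrite ler_peMl ?sqr_ge0 // wt_ge1.
Qed.

Lemma wsum_minkowski s c d :
  Num.sqrt (wsum s (fun l => c l + d l)) <= Num.sqrt (wsum s c) + Num.sqrt (wsum s d).
Proof.
have c0 := wsum_ge0 s c; have d0 := wsum_ge0 s d.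
rewrite -(@ler_pXn2r _ 2) ?nnegrE ?addr_ge0 ?sqrtr_ge0 //.
rewrite sqr_sqrtr ?wsum_ge0 // sqrrD !sqr_sqrtr //.
set X := \sum_(l <- s) (Num.sqrt (wt l) * normc (c l)) * (Num.sqrt (wt l) * normc (d l)).
have hX : X <= Num.sqrt (wsum s c) * Num.sqrt (wsum s d).
  rewrite -sqrtrM // -(@ler_pXn2r _ 2) ?nnegrE ?sqrtr_ge0 //; last first.
    by apply: sumr_ge0 => l _; rewrite !mulr_ge0 ?sqrtr_ge0 ?normc_ge0.
  rewrite sqr_sqrtr ?mulr_ge0 //; apply: le_trans (cauchy_schwarz_sum _ _ _) _.
  have e (g : int -> R[i]) :
      \sum_(i <- s) (Num.sqrt (wt i) * normc (g i)) ^+ 2 = wsum s g.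
    by apply: eq_bigr => l _; rewrite exprMn sqr_sqrtr ?wt_ge0.
  by rewrite !e.
apply: le_trans (_ : wsum s c + 2 * X + wsum s d <= _); last first.
  by rewrite mulr2n; move: hX; lra.
rewrite /wsum /X mulr_sumr -!big_split /=; apply: ler_sum => l _.
have hn := le_normcD (c l) (d l).
have : normc (c l + d l) ^+ 2 <= (normc (c l) + normc (d l)) ^+ 2.
  by rewrite ler_pXn2r ?nnegrE ?addr_ge0 ?normc_ge0.
move=> h2; apply: le_trans (_ : wt l * (normc (c l) + normc (d l)) ^+ 2 <= _).
  by rewrite ler_wpM2l ?wt_ge0.
rewrite (_ : Num.sqrt (wt l) * normc (c l) * _ =
  (Num.sqrt (wt l)) ^+ 2 * normc (c l) * normc (d l)); last by ring.
by rewrite sqr_sqrtr ?wt_ge0 // le_eqVlt; apply/orP; left; apply/eqP; ring.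
Qed.

Lemma sqrt_wsum_le s c B : wnorm_le c B -> uniq s -> Num.sqrt (wsum s c) <= B.
Proof.
move=> [B0 hB] us; rewrite -(@ler_pXn2r _ 2) ?nnegrE ?sqrtr_ge0 //.
by rewrite sqr_sqrtr ?wsum_ge0 // hB.
Qed.

Lemma wnorm_P c B : 0 <= B -> (forall s, uniq s -> Num.sqrt (wsum s c) <= B) -> wnorm_le c B.
Proof.
move=> B0 h; split=> // s us; rewrite -(sqr_sqrtr (wsum_ge0 s c)).
by rewrite ler_pXn2r ?nnegrE ?sqrtr_ge0 // h.
Qed.

Lemma wnorm_D c d B A : wnorm_le c B -> wnorm_le d A -> wnorm_le (fun l => c l + d l) (B + A).
Proof.
move=> hc hd; apply: wnorm_P; first by rewrite addr_ge0 ?hc.1 ?hd.1.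
move=> s us; apply: le_trans (wsum_minkowski _ _ _) _.
by apply: lerD; apply: sqrt_wsum_le.
Qed.

Lemma wnorm_M c (m : int -> R[i]) B K : 0 <= K -> (forall l, normc (m l) <= K) ->
  wnorm_le c B -> wnorm_le (fun l => m l * c l) (K * B).
Proof.
move=> K0 hm [B0 hB]; split; first exact: mulr_ge0.
move=> s us; apply: le_trans (_ : K ^+ 2 * wsum s c <= _).
  rewrite /wsum mulr_sumr; apply: ler_sum => l _.
  rewrite Normc.normcM exprMn [leRHS]mulrCA ler_wpM2l ?wt_ge0 //.
  rewrite ler_wpM2r ?sqr_ge0 // ler_pXn2r ?nnegrE ?normc_ge0 //; exact: hm.
by rewrite exprMn ler_wpM2l ?sqr_ge0 // hB.
Qed.

Lemma wnorm_mono c B A : B <= A -> wnorm_le c B -> wnorm_le c A.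
Proof.
move=> BA [B0 hB]; have A0 := le_trans B0 BA; split=> // s us.
by apply: le_trans (hB s us) _; rewrite ler_pXn2r ?nnegrE.
Qed.

Lemma wnorm_reflect c B : wnorm_le c B -> wnorm_le (fun l => Num.conj (c (- l))) B.
Proof.
move=> [B0 hB]; split=> // s us.
apply: le_trans (_ : wsum [seq - l | l <- s] c <= _).
  rewrite /wsum big_map le_eqVlt; apply/orP; left; apply/eqP.
  by apply: eq_bigr => l _; rewrite normc_conj wtN.
by apply: hB; rewrite map_inj_uniq //; exact: oppr_inj.
Qed.

End Weights.

(** * Fourier coefficients and trigonometric polynomials *)

Section Fourier.
Context {R : realType}.
Implicit Types (f g : R -> R[i]) (c d : int -> R[i]) (B x : R) (l k : int).

Local Notation D2pi := (Icc 0 (2 * pi) : set R).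

Let pi2_gt0 : 0 < 2 * pi :> R. Proof. by rewrite mulr_gt0 // pi_gt0. Qed.

Lemma fourierE f l : fourier f l =
  ((2 * pi)^-1)%:C * cintegral D2pi (fun x => f x * cis (- l%:~R * x)).
Proof.
rewrite /fourier; congr (_ * _); apply: eq_cintegral => x _.
by rewrite cexp_imag mulNr.
Qed.

Let bm_cis l : bmfun D2pi (fun x => cis (- l%:~R * x)).
Proof. exact: bmfun_cis. Qed.

Lemma eq_fourier f g l : (forall x, f x = g x) -> fourier f l = fourier g l.
Proof. by move=> /funext ->. Qed.

Lemma fourierD f g l : bmfun D2pi f -> bmfun D2pi g ->
  fourier (fun x => f x + g x) l = fourier f l + fourier g l.
Proof.
move=> hf hg; rewrite !fourierE -mulrDr -cintegralD; [|exact: bmfunM..].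
by congr (_ * _); apply: eq_cintegral => x _; rewrite mulrDl.
Qed.

Lemma fourierZ (a : R[i]) f l : bmfun D2pi f ->
  fourier (fun x => a * f x) l = a * fourier f l.
Proof.
move=> hf; rewrite !fourierE [RHS]mulrCA -(@cintegralZ _ 0 (2 * pi) a); last exact: bmfunM.
by congr (_ * _); apply: eq_cintegral => x _; rewrite mulrA.
Qed.

Lemma fourierB f g l : bmfun D2pi f -> bmfun D2pi g ->
  fourier (fun x => f x - g x) l = fourier f l - fourier g l.
Proof.
move=> hf hg; rewrite fourierD //; last exact: bmfunN.
rewrite -(mulN1r (fourier g l)) -fourierZ //; congr (_ + _).
by apply: eq_fourier => x; rewrite mulN1r.
Qed.

Lemma fourier_sum (I : Type) (s : seq I) (F : I -> R -> R[i]) l :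
  (forall i, bmfun D2pi (F i)) ->
  fourier (fun x => \sum_(i <- s) F i x) l = \sum_(i <- s) fourier (F i) l.
Proof.
move=> hF; rewrite fourierE.
have -> : cintegral D2pi (fun x => (\sum_(i <- s) F i x) * cis (- l%:~R * x)) =
    cintegral D2pi (fun x => \sum_(i <- s) F i x * cis (- l%:~R * x)).
  by apply: eq_cintegral => x _; rewrite mulr_suml.
rewrite cintegral_sum; last by move=> i; exact: bmfunM.
by rewrite mulr_sumr; apply: eq_bigr => i _; rewrite fourierE.
Qed.

Lemma fourier_bound f l B : cmfun D2pi f ->
  (forall x, D2pi x -> normc (f x) <= B) -> normc (fourier f l) <= 2 * B.
Proof.
move=> mf bf; rewrite fourierE Normc.normcM normcR ger0_norm ?invr_ge0 ?(ltW pi2_gt0) //.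
rewrite ler_pdivrMl // -[X in _ <= X * _]subr0.
apply: cintegral_bound; first exact: ltW.
  by apply: cmfunM => //; exact: (bm_cis l).1.
by move=> x Dx; rewrite Normc.normcM normc_cis mulr1 bf.
Qed.

Lemma fourier_cis k l : fourier (fun x : R => cis (k%:~R * x)) l = (k == l)%:R.
Proof.
rewrite fourierE.
have -> : cintegral D2pi (fun x => cis (k%:~R * x) * cis (- l%:~R * x)) =
   cintegral D2pi (fun x => cis ((k - l)%:~R * x)).
  by apply: eq_cintegral => x _; rewrite -cisD rmorphB mulrBl mulNr.
have [->|kl] := eqVneq k l.
  rewrite subrr (eq_cintegral (g := fun=> 1)); last by move=> x _; rewrite mul0r cis0.
  rewrite cintegral_cst ?ltW // subr0 mul1r -rmorphM mulVf ?gt_eqF //.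
rewrite cintegral_cis ?ltW ?intr_eq0 ?subr_eq0 //.
by rewrite cis2pi_int subrr mul0r mulr0.
Qed.

Lemma fourier_cisM f k l : fourier (fun x => cis (k%:~R * x) * f x) l = fourier f (l - k).
Proof.
rewrite !fourierE; congr (_ * _); apply: eq_cintegral => x _.
rewrite mulrAC -cisD mulrC rmorphB; congr (_ * cis _); ring.
Qed.

Definition tsum (s : seq int) c x : R[i] := \sum_(l <- s) c l * cis (l%:~R * x).

Lemma tsum_bm (D : set R) s c : measurable D -> bmfun D (tsum s c).
Proof.
move=> mD; apply: bmfun_sum => l; apply: bmfunM; first exact: bmfun_cst.
exact: bmfun_cis.
Qed.

Lemma fourier_tsum s c l : uniq s ->
  fourier (tsum s c) l = if l \in s then c l else 0.
Proof.
move=> us; rewrite fourier_sum; last first.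
  by move=> k; apply: bmfunM; [exact: bmfun_cst|exact: bmfun_cis].
rewrite (eq_bigr (fun k => c k * (k == l)%:R)); last first.
  by move=> k _; rewrite fourierZ ?fourier_cis //; exact: bmfun_cis.
case: ifPn => ls.
  rewrite (bigD1_seq l) //= eqxx mulr1 big1 ?addr0 // => k /negPf ->.
  by rewrite mulr0.
rewrite big_seq big1 // => k ks; case: eqP => [e|]; last by rewrite mulr0.
by move: ls; rewrite -e ks.
Qed.

Lemma normc_tsum s c x : normc (tsum s c x) <= \sum_(l <- s) normc (c l).
Proof.
apply: le_trans (normc_sum _ _ _) _; apply: ler_sum => l _.
by rewrite Normc.normcM normc_cis mulr1.
Qed.

Lemma tsumD s c d x : tsum s (fun l => c l + d l) x = tsum s c x + tsum s d x.
Proof. by rewrite /tsum -big_split; apply: eq_bigr => l _; rewrite mulrDl. Qed.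

Lemma tsumZ s (a : R[i]) c x : tsum s (fun l => a * c l) x = a * tsum s c x.
Proof. by rewrite /tsum mulr_sumr; apply: eq_bigr => l _; rewrite mulrA. Qed.

Lemma tsumB s c d x : tsum s (fun l => c l - d l) x = tsum s c x - tsum s d x.
Proof. by rewrite /tsum -sumrB; apply: eq_bigr => l _; rewrite mulrBl. Qed.

Lemma tsum_shift s c x y :
  tsum s c (x + y) = tsum s (fun l => cis (l%:~R * y) * c l) x.
Proof.
apply: eq_bigr => l _; rewrite mulrDr cisD; ring.
Qed.

Lemma tsum_periodic s c x : tsum s c (x + 2 * pi) = tsum s c x.
Proof. by apply: eq_bigr => l _; rewrite cis_periodic. Qed.

Lemma zrange_opp N : perm_eq [seq - l | l <- zrange N] (zrange N).
Proof.
apply: uniq_perm; last 1 first.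
- move=> l; rewrite mem_zrange; apply/mapP/idP => [[k]|h].
    by rewrite mem_zrange => + ->; rewrite abszN.
  by exists (- l); rewrite ?opprK // mem_zrange abszN.
- by rewrite map_inj_uniq ?zrange_uniq //; exact: oppr_inj.
- exact: zrange_uniq.
Qed.

Lemma tsum_conj N c x : tsum (zrange N) (fun l => Num.conj (c (- l))) x =
  Num.conj (tsum (zrange N) c x).
Proof.
rewrite /tsum rmorph_sum -(perm_big _ (zrange_opp N)) big_map /=.
apply: eq_bigr => l _; rewrite opprK rmorphM; congr (_ * _).
by rewrite mulrNz mulNr; symmetry; exact: conj_cis.
Qed.

End Fourier.

(** * Balls of the Sobolev space as an algebra of Fourier series *)

Section SobolevBall.
Context {R : realType} (r : R) (hr : 2^-1 < r).
Implicit Types (f g : R -> R[i]) (c d : int -> R[i]) (B x : R) (l k : int).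

Local Notation D2pi := (Icc 0 (2 * pi) : set R).
Local Notation delta := (delta r).
Local Notation kappa := (kappa r).
Local Notation wnorm_le := (wnorm_le r).

Lemma delta_small (C e : R) : 0 < e -> exists N0, forall N, (N0 <= N)%N -> delta N * C <= e.
Proof.
move=> e0; have : (fun N => delta N * C) @ \oo --> 0.
  by rewrite -(mul0r C); apply: cvgMl; exact: delta_cvg.
move/cvgrPdist_le => /(_ e e0) [N0 _ h]; exists N0 => N NN.
by have := h N NN; rewrite sub0r normrN; apply: le_trans; exact: ler_norm.
Qed.

Lemma eq0_delta (z : R[i]) (C : R) N0 :
  (forall N, (N0 <= N)%N -> normc z <= delta N * C) -> z = 0.
Proof.
move=> h; apply: Normc.eq0_normc; apply/eqP; rewrite eq_le normc_ge0 andbT.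
apply/ler_addgt0Pr => e e0; rewrite add0r.
have [N1 h1] := delta_small C e0.
apply: le_trans (h (maxn N0 N1) (leq_maxl _ _)) _; apply: h1; exact: leq_maxr.
Qed.

Lemma zseries_eq (a : int -> R[i]) (z : R[i]) (C : R) :
  (forall N, normc (z - \sum_(l <- zrange N) a l) <= delta N * C) -> zseries a = z.
Proof.
move=> h; have dC : (fun N => delta N * C) @ \oo --> 0.
  by rewrite -(mul0r C); apply: cvgMl; exact: delta_cvg.
have key (p : nat -> R) (y : R) : (forall N, `|y - p N| <= delta N * C) -> limn p = y.
  move=> hp; apply: cvg_lim => //; apply/cvgrPdist_le => e e0.
  move/cvgrPdist_le: dC => /(_ e e0); apply: filterS => n.
  rewrite sub0r normrN => hn; apply: le_trans (hp n) _.
  exact: le_trans (ler_norm _) hn.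
apply: complexP; rewrite /zseries /=; apply: key => N; rewrite zpartialE;
  apply: le_trans (h N).
- by apply: le_trans (le_Re_normc _); rewrite cReD cReN.
- by apply: le_trans (le_Im_normc _); rewrite cImD cImN.
Qed.

(** f is the sum of the Fourier series with coefficients c, whose H^r norm
    is at most B. The pointwise rate of convergence selects the continuous
    representative, and it reduces limits in H^r to uniform limits. *)
Definition WC B f c := wnorm_le c B /\
  forall N x, normc (f x - tsum (zrange N) c x) <= delta N * B.

(** The closed ball of radius B of H^r, in terms of continuous functions. *)
Definition W B f := WC B f (fourier f).

Lemma WC_ext B f g c : (forall x, f x = g x) -> WC B f c -> WC B g c.
Proof. by move=> /funext ->. Qed.

Lemma WC_coef_ext B f c d : (forall l, c l = d l) -> WC B f c -> WC B f d.
Proof. by move=> /funext ->. Qed.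

Lemma WC_ge0 B f c : WC B f c -> 0 <= B. Proof. by move=> [[]]. Qed.

Lemma WC_mono B A f c : B <= A -> WC B f c -> WC A f c.
Proof.
move=> BA [hc ht]; split; first exact: wnorm_mono hc.
by move=> N x; apply: le_trans (ht N x) _; rewrite ler_wpM2l ?delta_ge0.
Qed.

Lemma WC_bound B f c x : WC B f c -> normc (f x) <= 2 * kappa * B.
Proof.
move=> [hc ht]; rewrite -(subrK (tsum (zrange 0) c x) (f x)).
apply: le_trans (le_normcD _ _) _; rewrite -mulrA mulrDl mul1r; apply: lerD.
  by apply: le_trans (ht 0%N x) _; rewrite ler_wpM2r ?(hc.1) // delta_kappa.
apply: le_trans (normc_tsum _ _ _) _; apply: wnorm_l1 => //; exact: zrange_uniq.
Qed.

Lemma WC_bm (D : set R) B f c : measurable D -> WC B f c -> bmfun D f.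
Proof.
move=> mD hf; split; last by exists (2 * kappa * B) => x _; exact: WC_bound hf.
apply: (@cmfun_lim _ _ (fun N => tsum (zrange N) c) f delta (fun=> B)).
- by move=> N; exact: (tsum_bm _ _ mD).1.
- exact: delta_cvg.
- by move=> N x _; exact: hf.2.
Qed.

(** The coefficients of a uniformly convergent trigonometric series are its
    Fourier coefficients: the l-th one of a partial sum is eventually c l. *)
Lemma WC_fourier B f c l : WC B f c -> fourier f l = c l.
Proof.
move=> hf; apply/eqP; rewrite -subr_eq0; apply/eqP.
apply: (@eq0_delta _ (2 * B) `|l|%N) => N lN.
have lz : l \in zrange N by rewrite mem_zrange.
have bmf : bmfun D2pi f by exact: WC_bm hf.
have bmt : bmfun D2pi (tsum (zrange N) c) by exact: tsum_bm.
have <- : fourier (tsum (zrange N) c) l = c l by rewrite fourier_tsum ?zrange_uniq ?lz.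
rewrite -fourierB // mulrCA; apply: fourier_bound.
  exact: (bmfunB bmf bmt).1.
by move=> x _; exact: hf.2.
Qed.

Lemma WC_W B f c : WC B f c -> W B f.
Proof. by move=> hf; apply: (WC_coef_ext _ hf) => l; rewrite (WC_fourier l hf). Qed.

Lemma W_bm (D : set R) B f : measurable D -> W B f -> bmfun D f.
Proof. exact: WC_bm. Qed.

Lemma WC_periodic B f c x : WC B f c -> f (x + 2 * pi) = f x.
Proof.
move=> hf; apply/eqP; rewrite -subr_eq0; apply/eqP.
apply: (@eq0_delta _ (B + B) 0) => N _; rewrite [leRHS]mulrDr.
have -> : f (x + 2 * pi) - f x = (f (x + 2 * pi) - tsum (zrange N) c (x + 2 * pi))
    + - (f x - tsum (zrange N) c x) by rewrite tsum_periodic; ring.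
apply: le_trans (le_normcD _ _) _; rewrite normcN; apply: lerD; exact: hf.2.
Qed.

Lemma WCD B A f g c d : WC B f c -> WC A g d ->
  WC (B + A) (fun x => f x + g x) (fun l => c l + d l).
Proof.
move=> hf hg; split; first exact: wnorm_D hf.1 hg.1.
move=> N x; rewrite tsumD opprD addrACA mulrDr.
apply: le_trans (le_normcD _ _) _; apply: lerD; [exact: hf.2|exact: hg.2].
Qed.

Lemma WCZ (a : R[i]) B f c : WC B f c ->
  WC (normc a * B) (fun x => a * f x) (fun l => a * c l).
Proof.
move=> hf; split; first by apply: wnorm_M hf.1 => //; exact: normc_ge0.
move=> N x; rewrite tsumZ -mulrBr Normc.normcM mulrCA ler_wpM2l ?normc_ge0 //.
exact: hf.2.
Qed.

Lemma WCN B f c : WC B f c -> WC B (fun x => - f x) (fun l => - c l).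
Proof.
move=> /(WCZ (-1)); rewrite normcN Normc.normc1 mul1r => h.
by apply: WC_ext (WC_coef_ext _ h) => t; rewrite mulN1r.
Qed.

Lemma WC_conj B f c : WC B f c ->
  WC B (fun x => Num.conj (f x)) (fun l => Num.conj (c (- l))).
Proof.
move=> hf; split; first exact: wnorm_reflect hf.1.
by move=> N x; rewrite tsum_conj -rmorphB normc_conj; exact: hf.2.
Qed.

Lemma WC_shift (y : R) B f c : WC B f c ->
  WC B (fun x => f (x + y)) (fun l => cis (l%:~R * y) * c l).
Proof.
move=> hf; split.
  by rewrite -(mul1r B); apply: wnorm_M hf.1 => // l; rewrite normc_cis.
by move=> N x; rewrite -tsum_shift; exact: hf.2.
Qed.

Lemma WC0 : WC 0 (fun=> 0) (fun=> 0).
Proof.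
split; last by move=> N x; rewrite mulr0 /tsum big1 ?subrr ?Normc.normc0 // => l _; rewrite mul0r.
split=> // s _; rewrite /wsum big1 ?sqr_ge0 // => l _.
by rewrite Normc.normc0 expr0n mulr0.
Qed.

(** Every weighted l^2 sequence is the sequence of coefficients of a
    function in H^r: by [wnorm_tail] the partial sums are uniformly Cauchy. *)
Lemma WC_series B c : wnorm_le c B -> WC B (fun x => zseries (fun l => c l * cis (l%:~R * x))) c.
Proof.
move=> hc; split=> // N x.
set S := fun N => tsum (zrange N) c x.
have SMN n m : (n <= m)%N -> normc (S m - S n) <= delta n * B.
  move=> nm; rewrite /S /tsum (bigID (mem (zrange n))) /=.
  rewrite -[X in X + _ - _]big_filter (perm_big (zrange n)); last first.
    apply: uniq_perm; rewrite ?filter_uniq ?zrange_uniq // => l.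
    rewrite mem_filter; apply: andb_idr; exact: zrange_mono.
  rewrite addrAC subrr add0r -big_filter.
  apply: le_trans (normc_sum _ _ _) _.
  rewrite (eq_bigr (fun l => normc (c l))); last first.
    by move=> l _; rewrite Normc.normcM normc_cis mulr1.
  apply: wnorm_tail => //; first by rewrite filter_uniq ?zrange_uniq.
  by move=> l; rewrite mem_filter => /andP[].
have cv (p : nat -> R) : (forall n m, (n <= m)%N -> `|p m - p n| <= delta n * B) ->
    cvgn p.
  move=> hp; apply/cauchy_cvgP; apply: cauchy_exP => e e0.
  have [n0 hn0] := @delta_small B (e / 2) (divr_gt0 e0 (ltr0Sn _ 1)).
  exists (p n0); exists n0 => // m nm.
  rewrite /ball /= distrC; apply: le_lt_trans (hp n0 m nm) _.
  apply: le_lt_trans (hn0 n0 (leqnn _)) _; rewrite ltr_pdivrMr //; lra.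
have cr : cvgn (fun n => complex.Re (S n)).
  apply: cv => n m nm; apply: le_trans (SMN n m nm).
  by rewrite -cReN -cReD le_Re_normc.
have ci : cvgn (fun n => complex.Im (S n)).
  apply: cv => n m nm; apply: le_trans (SMN n m nm).
  by rewrite -cImN -cImD le_Im_normc.
set z := zseries _.
have zr : (fun n => complex.Re (S n)) @ \oo --> complex.Re z.
  suff -> : complex.Re z = limn (fun n => complex.Re (S n)) by [].
  by congr (limn _); apply/funext => n; rewrite zpartialE.
have zi : (fun n => complex.Im (S n)) @ \oo --> complex.Im z.
  suff -> : complex.Im z = limn (fun n => complex.Im (S n)) by [].
  by congr (limn _); apply/funext => n; rewrite zpartialE.
apply/ler_addgt0Pr => e e0.
have e2 : 0 < e / 2 by rewrite divr_gt0.
move/cvgrPdist_le: zr => /(_ _ e2) [n1 _ h1].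
move/cvgrPdist_le: zi => /(_ _ e2) [n2 _ h2].
pose m := maxn N (maxn n1 n2).
have {}h1 := h1 m (leq_trans (leq_maxl _ _) (leq_maxr _ _)).
have {}h2 := h2 m (leq_trans (leq_maxr _ _) (leq_maxr _ _)).
rewrite -(subrK (S m) z) -addrA; apply: le_trans (le_normcD _ _) _.
rewrite [leLHS]addrC; apply: lerD; first by apply: SMN; exact: leq_maxl.
apply: le_trans (normc_le_ReIm _) _; rewrite cReD cImD cReN cImN.
have -> : e = e / 2 + e / 2 by field.
exact: lerD.
Qed.

Lemma fmultE m f x : fmult m f x = zseries (fun l => m l * fourier f l * cis (l%:~R * x)).
Proof. by rewrite /fmult; congr zseries; apply/funext => l; rewrite cexp_imag. Qed.

Lemma WC_fmult (m : int -> R[i]) (K : R) B f c : 0 <= K -> (forall l, normc (m l) <= K) ->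
  WC B f c -> WC (K * B) (fmult m f) (fun l => m l * c l).
Proof.
move=> K0 hm hf; have h := WC_series (wnorm_M K0 hm hf.1).
apply: WC_ext h => x; rewrite fmultE; congr zseries; apply/funext => l.
by rewrite (WC_fourier l hf).
Qed.

Lemma WC_tsum B s c : 0 <= B -> uniq s -> wsum r s c <= B ^+ 2 ->
  WC B (tsum s c) (fun l => if l \in s then c l else 0).
Proof.
move=> B0 us hs; set c' := fun l => if l \in s then c l else 0.
have nc : wnorm_le c' B.
  split=> // s' us'; apply: le_trans hs.
  rewrite /wsum (bigID (mem s)) /= [X in _ + X]big1 ?addr0; last first.
    by move=> l /negPf ls; rewrite /c' ls Normc.normc0 expr0n mulr0.
  rewrite -[leLHS]big_filter.
  apply: le_trans (_ : \sum_(l <- [seq i <- s' | i \in s]) wt r l * normc (c l) ^+ 2 <= _).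
    rewrite !big_seq; apply: ler_sum => l; rewrite mem_filter => /andP[ls _].
    by rewrite /c' ls.
  apply: sum_uniq_le; rewrite ?filter_uniq //.
    by move=> l; rewrite mem_filter => /andP[].
  by move=> l; rewrite mulr_ge0 ?wt_ge0 ?sqr_ge0.
split=> // N x.
have -> : tsum s c x = tsum s c' x.
  by rewrite /tsum big_seq [RHS]big_seq; apply: eq_bigr => l ls; rewrite /c' ls.
have -> : tsum s c' x - tsum (zrange N) c' x =
    tsum [seq l <- s | l \notin zrange N] c' x.
  have -> : tsum (zrange N) c' x = tsum [seq l <- s | l \in zrange N] c' x.
    apply: sum_uniq_supp; rewrite ?filter_uniq ?zrange_uniq //.
      by move=> l; rewrite mem_filter => /andP[].
    move=> l lN; rewrite mem_filter lN /= => /negPf ls.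
    by rewrite /c' ls mul0r.
  rewrite {1}/tsum (bigID (mem (zrange N))) /= /tsum !big_filter.
  by rewrite addrAC subrr add0r.
apply: le_trans (normc_tsum _ _ _) _; apply: wnorm_tail => //.
  by rewrite filter_uniq.
by move=> l; rewrite mem_filter => /andP[].
Qed.

(** Balls of H^r are closed under uniform limits: Fourier coefficients
    depend continuously on the function in the uniform norm, and the bounds to
    be shown involve finitely many coefficients at a time. *)
Lemma W_closure B f : 0 <= B ->
  (forall e, 0 < e -> exists2 g, W B g & forall x, normc (f x - g x) <= e) -> W B f.
Proof.
move=> B0 H.
have mf : bmfun D2pi f.
  have e0 (n : nat) : 0 < n.+1%:R^-1 :> R by rewrite invr_gt0.
  pose G n := projT1 (cid2 (H _ (e0 n))).
  have GW n : W B (G n) by rewrite /G; case: cid2.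
  have Gf n x : normc (f x - G n x) <= n.+1%:R^-1 by rewrite /G; case: cid2.
  split.
    apply: (@cmfun_lim _ _ G f (fun n => n.+1%:R^-1) (fun=> 1)).
    - by move=> n; apply: (WC_bm _ (GW n)).1.
    - exact: cvg_harmonic.
    - by move=> n x _; rewrite mulr1.
  exists (1 + 2 * kappa * B) => x _; rewrite -(subrK (G 0%N x) (f x)).
  apply: le_trans (le_normcD _ _) _; apply: lerD; first by rewrite -[leRHS]invr1 Gf.
  exact: WC_bound (GW 0%N).
have Fdiff g e l : W B g -> (forall x, normc (f x - g x) <= e) ->
    normc (fourier f l - fourier g l) <= 2 * e.
  move=> Wg h; have mg : bmfun D2pi g by apply: WC_bm Wg.
  rewrite -fourierB //; apply: fourier_bound; first exact: (bmfunB mf mg).1.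
  by move=> x _.
split.
  apply: wnorm_P => // s us; apply/ler_addgt0Pr => e e0.
  set X := \sum_(l <- s) wt r l.
  have X0 : 0 <= X by apply: sumr_ge0 => l _; exact: wt_ge0.
  have [g Wg hg] := H (e / (2 * (X + 1))) (divr_gt0 e0 (mulr_gt0 (ltr0Sn _ 1) (ltr_wpDl X0 ltr01))).
  (* the total weight of s is X, so a uniform error e / (2 (X + 1))
     contributes at most e to the weighted norm *)
  set e' := e / _ in hg.
  have e'0 : 0 <= e' by apply: divr_ge0; rewrite ?ltW // mulr_gt0 // ltr_wpDl.
  have -> : fourier f = (fun l => fourier g l + (fourier f l - fourier g l)).
    by apply/funext => l; ring.
  apply: le_trans (wsum_minkowski _ _ _ _) _; apply: lerD.
    exact: sqrt_wsum_le Wg.1 us.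
  rewrite -(@ler_pXn2r _ 2) ?nnegrE ?sqrtr_ge0 ?(ltW e0) // sqr_sqrtr ?wsum_ge0 //.
  apply: le_trans (_ : X * (2 * e') ^+ 2 <= _).
    rewrite /wsum mulr_suml; apply: ler_sum => l _; rewrite ler_wpM2l ?wt_ge0 //.
    have h := Fdiff g e' l Wg hg; have h0 := normc_ge0 (fourier f l - fourier g l).
    by rewrite ler_pXn2r ?nnegrE // (le_trans h0).
  have -> : 2 * e' = e / (X + 1) by rewrite /e'; field; rewrite gt_eqF // ltr_wpDl.
  rewrite expr_div_n mulrA ler_pdivrMr ?exprn_gt0 ?ltr_wpDl // mulrC.
  rewrite ler_wpM2l ?sqr_ge0 //; have := sqr_ge0 X; lra.
move=> N x; apply/ler_addgt0Pr => e e0.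
set n := (size (zrange N))%:R : R.
have n0 : 0 <= n by rewrite /n.
have [g Wg hg] := H (e / (1 + 2 * n)) (divr_gt0 e0 (ltr_pwDl ltr01 (mulr_ge0 (ler0n _ 2) n0))).
set e' := e / _ in hg.
have -> : f x - tsum (zrange N) (fourier f) x = (g x - tsum (zrange N) (fourier g) x) +
  ((f x - g x) + - tsum (zrange N) (fun l => fourier f l - fourier g l) x).
  by rewrite tsumB; ring.
apply: le_trans (le_normcD _ _) _; apply: lerD; first exact: Wg.2.
apply: le_trans (le_normcD _ _) _; rewrite normcN.
have -> : e = e' + n * (2 * e').
  by rewrite /e'; field; rewrite gt_eqF // ltr_pwDl // mulr_ge0.
apply: lerD; first exact: hg.
apply: le_trans (normc_tsum _ _ _) _.
apply: le_trans (_ : \sum_(l <- zrange N) 2 * e' <= _).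
  by apply: ler_sum => l _; exact: Fdiff.
by rewrite big_const_seq count_predT iter_addr addr0 /n [leRHS]mulr_natl.
Qed.

Definition algcst : R := Num.sqrt (2 * wt_split_cst r) * kappa.

Lemma algcst_ge0 : 0 <= algcst.
Proof. by rewrite mulr_ge0 ?sqrtr_ge0. Qed.

(** The convolution is estimated by Cauchy-Schwarz with the weights w_j
    w_(l-j), together with w_l / (w_j w_(l-j)) <= C (1/w_j + 1/w_(l-j)) from
    [wt_split], whose sum over j is bounded. *)
Lemma wnorm_conv (s : seq int) a b A B : uniq s -> wnorm_le a A -> wnorm_le b B ->
  wnorm_le (fun l => \sum_(j <- s) a j * b (l - j)) (algcst * A * B).
Proof.
move=> us [A0 hA] [B0 hB]; split; first by rewrite (mulr_ge0 (mulr_ge0 algcst_ge0 A0) B0).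
move=> s' us'.
have Cw0 : 0 <= wt_split_cst r by exact: powR_ge0.
have step l : wt r l * normc (\sum_(j <- s) a j * b (l - j)) ^+ 2 <=
    (2 * wt_split_cst r * kappa ^+ 2) *
    \sum_(j <- s) wt r j * normc (a j) ^+ 2 * (wt r (l - j) * normc (b (l - j)) ^+ 2).
  pose p j := Num.sqrt ((wt r j)^-1 * (wt r (l - j))^-1).
  pose q j := Num.sqrt (wt r j * wt r (l - j)) * (normc (a j) * normc (b (l - j))).
  have pq j : normc (a j * b (l - j)) = p j * q j.
    rewrite /p /q mulrA -sqrtrM ?mulr_ge0 ?wtV_ge0 //.
    rewrite mulrACA !mulVf ?gt_eqF ?wt_gt0 // mul1r sqrtr1 mul1r.
    by rewrite Normc.normcM.
  apply: le_trans (_ : wt r l * (\sum_(j <- s) p j * q j) ^+ 2 <= _).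
    rewrite ler_wpM2l ?wt_ge0 // ler_pXn2r ?nnegrE ?normc_ge0 //.
      apply: le_trans (normc_sum _ _ _) _; apply: ler_sum => j _; by rewrite pq.
    by apply: sumr_ge0 => j _; rewrite -pq normc_ge0.
  apply: le_trans (_ : wt r l * ((\sum_(j <- s) p j ^+ 2) * (\sum_(j <- s) q j ^+ 2)) <= _).
    by rewrite ler_wpM2l ?wt_ge0 // cauchy_schwarz_sum.
  rewrite mulrA; have -> : \sum_(j <- s) q j ^+ 2 =
      \sum_(j <- s) wt r j * normc (a j) ^+ 2 * (wt r (l - j) * normc (b (l - j)) ^+ 2).
    apply: eq_bigr => j _; rewrite /q exprMn sqr_sqrtr ?mulr_ge0 ?wt_ge0 //; ring.
  apply: ler_wpM2r.
    by apply: sumr_ge0 => j _; rewrite !mulr_ge0 ?wt_ge0 ?normc_ge0.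
  have hs1 := wtV_sum hr us.
  have hs2 : \sum_(j <- s) (wt r (l - j))^-1 <= kappa ^+ 2.
    have := @wtV_sum _ _ hr [seq l - j | j <- s].
    rewrite big_map; apply; rewrite map_inj_uniq // => i j /addrI /oppr_inj //.
  apply: le_trans (_ : wt_split_cst r * \sum_(j <- s) ((wt r j)^-1 + (wt r (l - j))^-1) <= _).
    rewrite !mulr_sumr; apply: ler_sum => j _.
    rewrite /p sqr_sqrtr ?mulr_ge0 ?wtV_ge0 //.
    have wj := wt_gt0 r j; have wlj := wt_gt0 r (l - j).
    have -> : (wt r j)^-1 + (wt r (l - j))^-1 =
       (wt r j + wt r (l - j)) * ((wt r j)^-1 * (wt r (l - j))^-1).
      by field; rewrite !gt_eqF.
    rewrite mulrA ler_wpM2r ?mulr_ge0 ?wtV_ge0 //; exact: wt_split.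
  rewrite big_split /= -mulrA mulrCA ler_wpM2l //; lra.
apply: le_trans (_ : \sum_(l <- s') (2 * wt_split_cst r * kappa ^+ 2) *
    \sum_(j <- s) wt r j * normc (a j) ^+ 2 * (wt r (l - j) * normc (b (l - j)) ^+ 2) <= _).
  by apply: ler_sum => l _; exact: step.
rewrite -mulr_sumr exchange_big /= !exprMn (@sqr_sqrtr _ (2 * wt_split_cst r)) ?mulr_ge0 //.
rewrite -[leRHS]mulrA ler_wpM2l ?mulr_ge0 ?kappa_ge0 //.
apply: le_trans (_ : \sum_(j <- s) wt r j * normc (a j) ^+ 2 * B ^+ 2 <= _); last first.
  by rewrite -mulr_suml ler_wpM2r ?sqr_ge0 // hA.
apply: ler_sum => j _; rewrite -mulr_sumr ler_wpM2l ?mulr_ge0 ?wt_ge0 ?normc_ge0 //.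
have := hB [seq l - j | l <- s']; rewrite /wsum big_map; apply.
by rewrite map_inj_uniq // => i k /addIr.
Qed.

Lemma tsum_mul N a b x :
  tsum (zrange N) a x * tsum (zrange N) b x =
  tsum (zrange (N + N)) (fun l => \sum_(j <- zrange N) a j *
     (if l - j \in zrange N then b (l - j) else 0)) x.
Proof.
rewrite {1}/tsum mulr_suml.
have -> : tsum (zrange (N + N)) (fun l => \sum_(j <- zrange N) a j *
     (if l - j \in zrange N then b (l - j) else 0)) x =
   \sum_(j <- zrange N) \sum_(l <- zrange (N + N)) a j *
     (if l - j \in zrange N then b (l - j) else 0) * cis (l%:~R * x).
  rewrite exchange_big /=; apply: eq_bigr => l _; exact: mulr_suml.
rewrite big_seq [RHS]big_seq; apply: eq_bigr => j; rewrite mem_zrange => jN.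
pose h k := (if k \in zrange N then b k else 0) * cis (k%:~R * x).
rewrite (eq_bigr (fun l => a j * cis (j%:~R * x) * h (l - j))); last first.
  move=> l _; rewrite /h.
  have -> : cis (l%:~R * x) = cis (j%:~R * x) * cis ((l - j)%:~R * x).
    by rewrite -cisD -mulrDl -rmorphD /= addrC subrK.
  exact: mulrACA.
rewrite -mulr_sumr; congr (_ * _).
rewrite -(big_map (fun l => l - j) xpredT h).
rewrite (@sum_uniq_supp _ _ (zrange N)) ?zrange_uniq //.
- by rewrite /tsum big_seq [RHS]big_seq; apply: eq_bigr => l lN; rewrite /h lN.
- by rewrite map_inj_uniq ?zrange_uniq // => i k /addIr.
- move=> k; rewrite mem_zrange => kN; apply/mapP; exists (k + j); last by rewrite addrK.
  by rewrite mem_zrange; lia.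
- by move=> k _ /negPf kN; rewrite /h kN mul0r.
Qed.

(** H^r is an algebra. The bound is that of [wnorm_conv] on trigonometric
    polynomials, where the coefficients of a product are a finite convolution,
    and it passes to the limit by [W_closure]. *)
Lemma WM B A f g : W B f -> W A g -> W (algcst * B * A) (fun x => f x * g x).
Proof.
move=> hf hg; have B0 := WC_ge0 hf; have A0 := WC_ge0 hg.
have K0 : 0 <= algcst * B * A by rewrite (mulr_ge0 (mulr_ge0 algcst_ge0 B0) A0).
apply: W_closure => // e e0.
have [N hN] := @delta_small (3 * kappa * B * A) e e0.
exists (fun x => tsum (zrange N) (fourier f) x * tsum (zrange N) (fourier g) x).
  set g' := fun k => if k \in zrange N then fourier g k else 0.
  have ng' : wnorm_le g' A.
    rewrite -(mul1r A).
    have := @wnorm_M _ r (fourier g) (fun k => (k \in zrange N)%:R) A 1 ler01 _ hg.1.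
    have h1 k : normc (k \in zrange N)%:R <= 1 :> R.
      by case: (k \in _); rewrite ?Normc.normc1 ?Normc.normc0.
    move=> /(_ h1); congr (wnorm_le _ _); apply/funext => k; rewrite /g'.
    by case: (k \in _); rewrite ?mul1r ?mul0r.
  apply: WC_W; apply: WC_ext (WC_tsum K0 (zrange_uniq (N + N)) _).
    by move=> x; rewrite tsum_mul.
  apply: (wnorm_conv (zrange_uniq N) hf.1 ng').2; exact: zrange_uniq.
move=> x; set fN := tsum _ _ x; set gN := tsum _ _ x.
have -> : f x * g x - fN * gN = (f x - fN) * g x + fN * (g x - gN) by ring.
apply: le_trans (le_normcD _ _) _; rewrite !Normc.normcM.
apply: le_trans (hN N (leqnn _)).
have -> : delta N * (3 * kappa * B * A) =
   (delta N * B) * (2 * kappa * A) + (kappa * B) * (delta N * A) by ring.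
apply: lerD; apply: ler_pM; rewrite ?normc_ge0 //.
- exact: hf.2.
- exact: WC_bound hg.
- apply: le_trans (normc_tsum _ _ _) _; apply: wnorm_l1 hf.1 _ => //; exact: zrange_uniq.
- exact: hg.2.
Qed.

(** The Fourier coefficients of a product as limits of finite convolutions,
    at the rate delta; measurability in time of the coefficients of a product
    follows. *)
Lemma fourierM_approx B A f g l N : W B f -> W A g ->
  normc (fourier (fun x => f x * g x) l -
         \sum_(j <- zrange N) fourier f j * fourier g (l - j))
  <= delta N * (4 * kappa * B * A).
Proof.
move=> hf hg; have mg : bmfun D2pi g by apply: WC_bm hg.
have mf : bmfun D2pi f by apply: WC_bm hf.
have mt : bmfun D2pi (tsum (zrange N) (fourier f)) by apply: tsum_bm.
have -> : \sum_(j <- zrange N) fourier f j * fourier g (l - j) =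
    fourier (fun x => tsum (zrange N) (fourier f) x * g x) l.
  under eq_fourier do rewrite /tsum mulr_suml.
  rewrite fourier_sum; last first.
    move=> j; apply: bmfunM => //; apply: bmfunM; first exact: bmfun_cst.
    exact: bmfun_cis.
  apply: eq_bigr => j _; rewrite -fourier_cisM -fourierZ; last first.
    by apply: bmfunM => //; exact: bmfun_cis.
  by apply: eq_fourier => x; rewrite mulrA.
rewrite -fourierB; [|exact: bmfunM..].
have -> : delta N * (4 * kappa * B * A) = 2 * ((delta N * B) * (2 * kappa * A)) by ring.
apply: fourier_bound; first exact: (bmfunB (bmfunM mf mg) (bmfunM mt mg)).1.
move=> x _; rewrite -mulrBl Normc.normcM; apply: ler_pM; rewrite ?normc_ge0 //.
- exact: hf.2.
- exact: WC_bound hg.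
Qed.

End SobolevBall.

(** * Periodic differentiable functions *)

Section PeriodicFunctions.
Context {R : realType}.
Implicit Types (u v : R -> R) (x y : R).

Let pi2_gt0 : 0 < 2 * pi :> R. Proof. by rewrite mulr_gt0 // pi_gt0. Qed.

Lemma periodic_int (T : Type) (f : R -> T) (k : int) x :
  periodic2pi f -> f (x + k%:~R * (2 * pi)) = f x.
Proof.
move=> fp; have H (n : nat) y : f (y + n%:R * (2 * pi)) = f y.
  elim: n => [|n IH]; first by rewrite mul0r addr0.
  by rewrite -natr1 mulrDl mul1r addrA fp IH.
case: k => n; first by rewrite -pmulrn H.
by rewrite NegzE mulrNz mulNr -pmulrn -(H n.+1 (x - _)) subrK.
Qed.

Lemma period_reduction x : exists k : int, 0 <= x + k%:~R * (2 * pi) <= 2 * pi.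
Proof.
exists (- Num.floor (x / (2 * pi))); rewrite mulrNz mulNr subr_ge0 lerBlDl.
rewrite -ler_pdivlMr // floor_le /=.
have := floorD1_gt (x / (2 * pi)); rewrite ltr_pdivrMr // rmorphD mulrDl mul1r.
by move/ltW; rewrite addrC.
Qed.

Lemma periodic_bounded u : periodic2pi u -> continuous u ->
  exists B : R, forall x, `|u x| <= B.
Proof.
move=> pu cu; have cn : {within `[0, 2 * pi], continuous (fun x => `|u x|)}.
  apply: continuous_subspaceT => x; apply: continuous_comp; first exact: cu.
  exact: norm_continuous.
have [c _ hc] := EVT_max (ltW pi2_gt0) cn.
exists `|u c| => x; have [k hk] := period_reduction x.
by rewrite -(periodic_int k x pu); apply: hc; rewrite in_itv.
Qed.

Lemma periodic_derive1 u : periodic2pi u -> periodic2pi (derive1 u).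
Proof.
move=> pu x; rewrite /derive1.
suff -> : (fun h : R => h^-1 *: (u (h + (x + 2 * pi)) - u (x + 2 * pi))) =
  (fun h => h^-1 *: (u (h + x) - u x)) by [].
by apply/funext => h; rewrite addrA !pu.
Qed.

Lemma periodic_derive1n u n : periodic2pi u -> periodic2pi (derive1n n u).
Proof.
by move=> pu; elim: n => [|n IH] //; rewrite derive1nS; exact: periodic_derive1.
Qed.

Lemma smooth_derive u n x : smooth u ->
  is_derive x 1 (derive1n n u) (derive1n n.+1 u x).
Proof.
by move=> su; rewrite derive1nS derive1E; apply: DeriveDef => //; exact: su.
Qed.

Lemma smooth_continuous u n : smooth u -> continuous (derive1n n u).
Proof.
move=> su x; apply: differentiable_continuous; apply/derivable1_diffP; exact: su.
Qed.

Lemma smooth_lipschitz u : smooth u -> periodic2pi u ->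
  exists2 L : R, 0 <= L & forall x y, `|u x - u y| <= L * `|x - y|.
Proof.
move=> su pu.
have [L hL] := periodic_bounded (periodic_derive1n 1 pu) (smooth_continuous (n := 1) su).
exists L; first exact: le_trans (hL 0).
suff key x y : y < x -> `|u x - u y| <= L * `|x - y|.
  move=> x y; have [|h|->] := ltgtP x y; last by rewrite !subrr normr0 mulr0.
    by move=> /key; rewrite distrC [X in _ * X]distrC.
  exact: key.
move=> yx; have [||c _ ->] := @MVT _ u (derive1n 1 u) y x yx.
- by move=> z _; exact: (smooth_derive 0 z su).
- by apply: continuous_subspaceT => z; exact: (smooth_continuous (n := 0) su).
by rewrite normrM ler_wpM2r.
Qed.

(** The sum of t cos t <= sin t, by the mean value theorem, and of t (1 -
    cos t) <= pi sin t, since 1 - cos t <= sin t on the quarter circle. *)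
Lemma le_sin_quarter x : 0 <= x <= pi / 2 -> x <= (1 + pi) * sin x.
Proof.
move=> /andP[x0 xp]; have p0 := pi_gt0 R.
have xpi : x <= pi by apply: le_trans xp _; rewrite ler_pdivrMr // ler_pMr // ler1n.
have s0 : 0 <= sin x by apply: sin_ge0_pi; rewrite x0.
have c0 : 0 <= cos x.
  by apply: cos_ge0_pihalf; rewrite xp andbT; apply: le_trans x0; rewrite oppr_le0 ltW // divr_gt0.
have h1 : x * cos x <= sin x.
  move: x0; rewrite le_eqVlt => /predU1P[<-|x0]; first by rewrite mul0r sin0.
  have [|c] := @MVT _ sin cos 0 x x0 (fun z _ => is_derive_sin z).
    by apply: continuous_subspaceT; exact: continuous_sin.
  rewrite in_itv /= => /andP[c00 cx]; rewrite sin0 !subr0 => ->.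
  rewrite mulrC ler_wpM2r ?(ltW x0) //.
  by rewrite ltW // ltr_cos // in_itv /= ?(ltW x0) ?(ltW c00) //= (le_trans (ltW cx)).
have h2 : 1 - cos x <= sin x.
  have := cos2Dsin2 x; have := cos_le1 x; have := sin_le1 x.
  move: (cos x) (sin x) c0 s0 => c s c0 s0 s1 c1 e.
  have : s * (1 - s) >= 0 by rewrite mulr_ge0 // subr_ge0.
  have : c * (1 - c) >= 0 by rewrite mulr_ge0 // subr_ge0.
  nra.
have h3 : x * (1 - cos x) <= pi * sin x.
  by apply: ler_pM => //; rewrite subr_ge0 cos_le1.
lra.
Qed.

Lemma normc_cis_sub1 x : normc (cis x - 1) = 2 * `|sin (x / 2)|.
Proof.
apply: (@pexpIrn _ 2); rewrite ?nnegrE ?normc_ge0 ?mulr_ge0 //.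
rewrite normcE2 cReD cImD /= exprMn real_normK ?num_real //.
have -> : x = x / 2 + x / 2 by field.
rewrite cosD sinD; have -> : (x / 2 + x / 2) / 2 = x / 2 by field.
have := cos2Dsin2 (x / 2); move: (cos _) (sin _) => c s e.
rewrite subr0; have -> : (c * c - s * s - 1) ^+ 2 + (s * c + c * s) ^+ 2 =
  (c ^+ 2 - s ^+ 2 - 1) ^+ 2 + 4 * s ^+ 2 * c ^+ 2 by ring.
have -> : c ^+ 2 = 1 - s ^+ 2 by rewrite -e addrK.
ring.
Qed.

(** The increment of a Lipschitz periodic function is bounded by the length
    of the chord between the two points of the circle: this is clear for the
    arc, which is comparable to the chord. *)
Lemma smooth_chord u x0 : smooth u -> periodic2pi u ->
  exists C : R, forall x, `|u x - u x0| <= C * normc (cis (x - x0) - 1).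
Proof.
move=> su pu; have [L L0 hL] := smooth_lipschitz su pu.
have p0 := pi_gt0 R.
exists (L * (1 + pi)) => x; have [k hk] := period_reduction (x - x0).
set y := x - x0 + _ in hk.
have -> : u x = u (x0 + y).
  by rewrite /y addrA (addrC x0) subrK periodic_int.
have -> : cis (x - x0) = cis y.
  by rewrite /y (cisD (x - x0)) cis2pi_int mulr1.
have /andP[y0 y2] := hk; rewrite normc_cis_sub1 -mulrA.
have [yp|/ltW py] := leP y pi.
- have /le_sin_quarter h : 0 <= y / 2 <= pi / 2 by rewrite divr_ge0 //= ler_pM2r ?invr_gt0.
  apply: le_trans (hL _ _) _; rewrite ler_wpM2l //.
  have -> : x0 + y - x0 = y by ring.
  rewrite ger0_norm // mulrCA -[leLHS](mulfVK (_ : 2 != 0 :> R)) // mulrC ler_wpM2l //.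
  by apply: le_trans h _; rewrite ler_wpM2l ?ler_norm // addr_ge0 // ltW.
- have /le_sin_quarter h : 0 <= pi - y / 2 <= pi / 2.
    rewrite subr_ge0 ler_pdivrMr // [pi * 2]mulrC y2 /= lerBlDl -lerBlDr.
    have -> : pi - pi / 2 = pi / 2 :> R by field.
    by rewrite ler_pM2r ?invr_gt0.
  have -> : u x0 = u (x0 + 2 * pi) by rewrite pu.
  apply: le_trans (hL _ _) _; rewrite ler_wpM2l //.
  have -> : x0 + y - (x0 + 2 * pi) = - (2 * (pi - y / 2)) by field.
  rewrite sinB sinpi cospi mul0r sub0r mulN1r opprK in h.
  have h0 : 0 <= 2 * (pi - y / 2) by rewrite mulrBr subr_ge0 mulrCA divff ?mulr1.
  rewrite normrN ger0_norm // mulrCA ler_wpM2l //.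
  by apply: le_trans h _; rewrite ler_wpM2l ?ler_norm // addr_ge0 // ltW.
Qed.

End PeriodicFunctions.

(** * Smooth periodic functions belong to every Sobolev space *)

Section SmoothPotential.
Context {R : realType} (r : R) (hr : 2^-1 < r).
Implicit Types (u v : R -> R) (f h : R -> R[i]) (x : R) (l : int).

Local Notation D2pi := (Icc 0 (2 * pi) : set R).

Let pi2_gt0 : 0 < 2 * pi :> R. Proof. by rewrite mulr_gt0 // pi_gt0. Qed.

Lemma real_bm u (D : set R) : periodic2pi u -> continuous u -> measurable D ->
  bmfun D (fun x => (u x)%:C).
Proof.
move=> pu cu mD; split.
  split=> //=; apply: measurable_funTS; exact: continuous_measurable_fun.
by have [B hB] := periodic_bounded pu cu; exists B => x _; rewrite normcR.
Qed.

(** Integration by parts: the integral over a period of the derivative of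
    u(x) e^(-ilx) vanishes. *)
Lemma fourier_derive u v l : periodic2pi u ->
  (forall x, is_derive (x : R) 1 u (v x)) -> periodic2pi v -> continuous v ->
  fourier (fun x => (v x)%:C) l = imag l%:~R * fourier (fun x => (u x)%:C) l.
Proof.
move=> pu du pv cv.
have cu : continuous u.
  move=> x; apply: differentiable_continuous; apply/derivable1_diffP.
  by apply: (@ex_derive _ _ _ _ _ _ _ (du x)).
have bu := real_bm pu cu (measurable_itv `[0, 2 * pi]).
have bv := real_bm pv cv (measurable_itv `[0, 2 * pi]).
have bc : bmfun D2pi (fun x => cis (- l%:~R * x)) by exact: bmfun_cis.
have u0 : u (2 * pi) = u 0 by rewrite -(pu 0) add0r.
rewrite !fourierE mulrCA -(cintegralZ _ (bmfunM bu bc)); congr (_ * _).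
apply: subr0_eq; rewrite -(cintegralB (bmfunM bv bc) (bmfunM (bmfun_cst _ _) (bmfunM bu bc))).
set k := - l%:~R.
have ck : continuous (fun x : R => cos (k * x)) by exact: continuous_cis_Re.
have sk : continuous (fun x : R => sin (k * x)) by exact: continuous_cis_Im.
have endc : cos (k * (2 * pi)) = 1 /\ sin (k * (2 * pi)) = 0 :> R.
  by have := cis2pi_int (- l) (R := R); rewrite mulrNz -/k => -[].
apply: complexP; rewrite /cintegral /=.
- have -> : \int[mu]_(x in D2pi) complex.Re ((v x)%:C * cis (k * x) -
      imag l%:~R * ((u x)%:C * cis (k * x))) =
      \int[mu]_(x in D2pi) (v x * cos (k * x) - u x * (k * sin (k * x))).
    by apply: eq_Rintegral => x _; rewrite /k /imag /=; ring.
  apply: etrans (@Rintegral_derive R _ (fun x => u x * cos (k * x)) _ pi2_gt0 _ _) _.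
  + move=> x; have dx := du x; apply: is_derive_eq; rewrite /GRing.scale /=; ring.
  + move=> x; apply: cvgB; apply: cvgM; [exact: cv|exact: ck|exact: cu|].
    by apply: cvgM; [exact: cvg_cst|exact: sk].
  + by rewrite endc.1 mulr0 cos0 u0 subrr.
- have -> : \int[mu]_(x in D2pi) complex.Im ((v x)%:C * cis (k * x) -
      imag l%:~R * ((u x)%:C * cis (k * x))) =
      \int[mu]_(x in D2pi) (v x * sin (k * x) + u x * (k * cos (k * x))).
    by apply: eq_Rintegral => x _; rewrite /k /imag /=; ring.
  apply: etrans (@Rintegral_derive R _ (fun x => u x * sin (k * x)) _ pi2_gt0 _ _) _.
  + move=> x; have dx := du x; apply: is_derive_eq; rewrite /GRing.scale /=; ring.
  + move=> x; apply: cvgD; apply: cvgM; [exact: cv|exact: sk|exact: cu|].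
    by apply: cvgM; [exact: cvg_cst|exact: ck].
  + by rewrite endc.2 !mulr0 sin0 mulr0 subrr.
Qed.

Lemma smooth_fourier_decay u n : smooth u -> periodic2pi u ->
  exists C : R, forall l, `|l%:~R| ^+ n * normc (fourier (fun x => (u x)%:C) l) <= C.
Proof.
move=> su pu; have cs m : continuous (derive1n m u) := smooth_continuous su.
have ps m : periodic2pi (derive1n m u) := periodic_derive1n m pu.
have key m l : normc (fourier (fun x => (derive1n m u x)%:C) l) =
    `|l%:~R| ^+ m * normc (fourier (fun x => (u x)%:C) l).
  elim: m => [|m IH]; first by rewrite expr0 mul1r.
  rewrite (fourier_derive l (ps m) (fun x => smooth_derive m x su) (ps m.+1) (cs m.+1)).
  by rewrite Normc.normcM IH exprS mulrA /= expr0n add0r sqrtr_sqr.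
have [mf [B hB]] := real_bm (ps n) (cs n) (measurable_itv `[0, 2 * pi]).
by exists (2 * B) => l; rewrite -key; exact: fourier_bound.
Qed.

(** Each derivative gains one power of l in the decay of the coefficients;
    enough of them make w_l |c_l| bounded, and the squared norm is then
    controlled by the sum of 1 / w_l. *)
Lemma smooth_wnorm u : smooth u -> periodic2pi u ->
  exists B, wnorm_le r (fourier (fun x => (u x)%:C)) B.
Proof.
move=> su pu; set c := fourier _; pose K := (Num.trunc r).+1.
have rK : r <= K%:R by exact/ltW/truncnS_gt.
have [C0 h0] := smooth_fourier_decay 0 su pu.
have [C1 h1] := smooth_fourier_decay (2 * K) su pu.
pose C := 2 ^+ K * (C0 + C1).
have hC l : wt r l * normc (c l) <= C.
  have n0 := normc_ge0 (c l).
  have wK : wt r l <= (1 + `|l%:~R| ^+ 2) ^+ K.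
    rewrite /wt real_normK ?num_real // -(@powR_mulrn _ _ K) ?addr_ge0 ?sqr_ge0 //.
    by apply: ler_powR => //; exact: wt_base_ge1.
  apply: le_trans (ler_wpM2r n0 wK) _.
  (* (1 + y)^K <= 2^K (1 + y^K), according as y is at most 1 or not *)
  have hx : (1 + `|l%:~R| ^+ 2) ^+ K <= 2 ^+ K * (1 + `|l%:~R| ^+ (2 * K)) :> R.
    rewrite exprM; have := sqr_ge0 (`|l%:~R| : R); move: (`|l%:~R| ^+ 2) => y y0.
    have [y1|y1] := leP y 1.
      rewrite mulrDr mulr1 -[leLHS]addr0 lerD ?mulr_ge0 ?exprn_ge0 //.
      by apply: lerXn2r; rewrite ?nnegrE ?addr_ge0 // [leRHS](_ : _ = 1 + 1) ?lerD2l.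
    rewrite mulrDr -exprMn -[leLHS]add0r lerD ?mulr_ge0 ?exprn_ge0 //.
    apply: lerXn2r; rewrite ?nnegrE ?addr_ge0 ?mulr_ge0 //.
    by rewrite [leRHS](_ : _ = y + y) ?lerD2r ?(ltW y1) // mulr_natl.
  apply: le_trans (ler_wpM2r n0 hx) _.
  rewrite -mulrA ler_wpM2l ?exprn_ge0 // mulrDl; apply: lerD; last exact: h1.
  by have := h0 l; rewrite expr0.
have C_ge0 : 0 <= C by apply: le_trans (hC 0); rewrite mulr_ge0 ?wt_ge0 ?normc_ge0.
exists (C * kappa r); split; first by rewrite mulr_ge0 ?kappa_ge0.
move=> s us; rewrite exprMn; apply: le_trans (ler_wpM2l (sqr_ge0 _) (wtV_sum hr us)).
rewrite mulr_sumr; apply: ler_sum => l _.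
have w0 := wt_gt0 r l; rewrite ler_pdivlMr //.
have -> : wt r l * normc (c l) ^+ 2 * wt r l = (wt r l * normc (c l)) ^+ 2 by ring.
by apply: lerXn2r; rewrite ?nnegrE ?hC // mulr_ge0 ?wt_ge0 ?normc_ge0.
Qed.

(** Bessel's inequality, from the nonnegativity of the mean of |f - p|^2,
    where p is the partial Fourier sum of f over s. The factor 2 comes from
    [fourier_bound]. *)
Lemma bessel f (B : R) (s : seq int) : bmfun D2pi f ->
  (forall x, D2pi x -> normc (f x) <= B) -> uniq s ->
  \sum_(l <- s) normc (fourier f l) ^+ 2 <= 2 * B ^+ 2.
Proof.
move=> hf bf us; set c := fourier f; set S := \sum_(l <- s) _.
have mD : measurable D2pi by exact: measurable_itv.
have ht := tsum_bm s c mD.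
have conj_bm h : bmfun D2pi h -> bmfun D2pi (fun x => Num.conj (h x)).
  move=> [mh [A hA]]; split; first exact: cmfunJ.
  by exists A => x Dx; rewrite normc_conj; exact: hA.
have normE z : z * Num.conj z = (normc z ^+ 2)%:C :> R[i].
  by rewrite -normCK normC_normc -rmorphXn.
have cross h : bmfun D2pi h -> fourier (fun x => h x * Num.conj (tsum s c x)) 0 =
    \sum_(l <- s) Num.conj (c l) * fourier h l.
  move=> hh; transitivity (fourier (fun x => \sum_(l <- s) Num.conj (c l) * (cis ((- l)%:~R * x) * h x)) 0).
    apply: eq_fourier => x; rewrite /tsum rmorph_sum mulr_sumr; apply: eq_bigr => l _.
    have -> : cis ((- l)%:~R * x) = Num.conj (cis (l%:~R * x)) by rewrite conj_cis mulrNz mulNr.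
    by rewrite rmorphM mulrCA [X in _ * X]mulrC.
  have bl l : bmfun D2pi (fun x => cis ((- l)%:~R * x) * h x).
    by apply: bmfunM => //; exact: bmfun_cis.
  rewrite fourier_sum; last by move=> l; apply: bmfunM; [exact: bmfun_cst|exact: bl].
  by apply: eq_bigr => l _; rewrite (fourierZ _ _ (bl l)) fourier_cisM sub0r opprK.
have e1 : fourier (fun x => f x * Num.conj (tsum s c x)) 0 = S%:C.
  rewrite cross // /S rmorph_sum; apply: eq_bigr => l _ /=; by rewrite mulrC normE.
have e2 : fourier (fun x => tsum s c x * Num.conj (tsum s c x)) 0 = S%:C.
  rewrite cross // /S rmorph_sum big_seq [RHS]big_seq; apply: eq_bigr => l ls /=.
  by rewrite fourier_tsum // ls mulrC normE.
have conj_fourier h : complex.Re (fourier (fun x => Num.conj (h x)) 0) =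
    complex.Re (fourier h 0).
  rewrite !fourierE !cReM /= !mul0r; congr (_ * _ - _).
  apply: eq_Rintegral => x _; rewrite mulr0z oppr0 mul0r cis0 !mulr1 conjE; by case: (h x).
have e3 : complex.Re (fourier (fun x => tsum s c x * Num.conj (f x)) 0) = S.
  rewrite -[RHS]cReRe -e1 -conj_fourier.
  congr complex.Re; apply: eq_fourier => x; move: (f x) (tsum s c x) => [a b] [a' b'].
  by rewrite !conjE; apply: complexP => /=; ring.
set P := fourier (fun x => f x * Num.conj (f x)) 0.
pose p x := f x - tsum s c x.
have hp : 0 <= complex.Re (fourier (fun x => p x * Num.conj (p x)) 0).
  rewrite fourierE cReM /= mul0r subr0; apply: mulr_ge0; first by rewrite invr_ge0 ltW.
  apply: Rintegral_ge0 => x _; rewrite mulr0z oppr0 mul0r cis0 mulr1 normE /=.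
  exact: sqr_ge0.
have eP : fourier (fun x => p x * Num.conj (p x)) 0 =
    P - fourier (fun x => f x * Num.conj (tsum s c x)) 0 -
    (fourier (fun x => tsum s c x * Num.conj (f x)) 0 -
     fourier (fun x => tsum s c x * Num.conj (tsum s c x)) 0).
  have b1 := bmfunM hf (conj_bm _ hf); have b2 := bmfunM hf (conj_bm _ ht).
  have b3 := bmfunM ht (conj_bm _ hf); have b4 := bmfunM ht (conj_bm _ ht).
  rewrite -(fourierB _ b1 b2) -(fourierB _ b3 b4) -(fourierB _ (bmfunB b1 b2) (bmfunB b3 b4)).
  by apply: eq_fourier => x; rewrite /p rmorphB; ring.
have hP : complex.Re P <= 2 * B ^+ 2.
  apply: le_trans (ler_norm _) _; apply: le_trans (le_Re_normc _) _.
  have bff := bmfunM hf (conj_bm _ hf).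
  apply: fourier_bound bff.1 _ => x Dx.
  have b0 : 0 <= B by apply: le_trans (bf x Dx); exact: normc_ge0.
  by rewrite Normc.normcM normc_conj -expr2; apply: lerXn2r; rewrite ?nnegrE ?normc_ge0 ?bf.
move: hp hP; rewrite eP e1 e2 !cReD !cReN cReD cReN e3 !cReRe.
by move: (complex.Re P) => X; lra.
Qed.

(** Chernoff's quotient: it is bounded by [smooth_chord], and where its
    denominator vanishes so does its numerator. *)
Lemma chord_bm u x0 : smooth u -> periodic2pi u -> exists2 h : R -> R[i],
  bmfun D2pi h & forall x, (u x)%:C - (u x0)%:C = h x * (cis (x - x0) - 1).
Proof.
move=> su pu; have [C hC] := smooth_chord x0 su pu.
(* division by 0 gives 0, a value compatible with the factorisation because
   the numerator vanishes there too *)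
pose h x := ((u x)%:C - (u x0)%:C) / (cis (x - x0) - 1).
have hE x : (u x)%:C - (u x0)%:C = h x * (cis (x - x0) - 1).
  have [D0|D0] := eqVneq (cis (x - x0) - 1) 0; last by rewrite /h divfK.
  rewrite D0 mulr0; have := hC x; rewrite D0 Normc.normc0 mulr0 normr_le0 => /eqP e.
  by rewrite -rmorphB e.
have cu := smooth_continuous (n := 0) su.
have mD : measurable D2pi by exact: measurable_itv.
have md : cmfun D2pi (fun x => cis (x - x0) - 1).
  apply: cmfunD (cmfun_cst _ _).
  apply: cmfun_ext (cmfunM (cmfun_cst _ (cis (- x0))) (cmfun_cis 1 mD)) => x _.
  by rewrite mul1r mulrC -cisD.
exists h => //; split; last first.
  exists (Num.max C 0) => x _; have [D0|D0] := eqVneq (cis (x - x0) - 1) 0.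
    by rewrite /h D0 invr0 mulr0 Normc.normc0 le_max lexx orbT.
  have d0 : 0 < normc (cis (x - x0) - 1).
    by rewrite lt_def normc_ge0 andbT; apply: contra D0 => /eqP /Normc.eq0_normc ->.
  rewrite -(ler_pM2r d0) -Normc.normcM -hE -rmorphB normcR.
  by apply: le_trans (hC x) _; rewrite ler_wpM2r ?normc_ge0 // le_max lexx.
(* measurability: the inverse of z is conj z / |z|^2, and the real inverse
   is the power -1 *)
pose n x := normc (cis (x - x0) - 1) ^+ 2.
have mn : measurable_fun D2pi (fun x => n x `^ (-1)).
  have mn0 : measurable_fun D2pi n.
    apply: eq_measurable_fun (measurable_funD (measurable_funX 2 md.1) (measurable_funX 2 md.2)).
    by move=> x _; rewrite /n normcE2.
  exact: (measurableT_comp (measurable_powR _) mn0).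
have mi : cmfun D2pi (fun x => (n x `^ (-1))%:C) by split.
apply: cmfun_ext (cmfunM (cmfunD (real_bm pu cu mD).1 (cmfun_cst _ (- (u x0)%:C)))
  (cmfunM mi (cmfunJ md))) => x _.
rewrite powR_inv1 ?sqr_ge0 // /h; congr (_ * _).
have [->|D0] := eqVneq (cis (x - x0) - 1) 0; first by rewrite rmorph0 mulr0 invr0.
apply: (mulfI D0); rewrite divff //.
have nE : (cis (x - x0) - 1) * Num.conj (cis (x - x0) - 1) = (n x)%:C.
  by rewrite -normCK normC_normc -rmorphXn.
rewrite mulrCA nE fmorphV mulVf // /n fmorph_eq0 sqrf_eq0.
by apply: contra D0 => /eqP /Normc.eq0_normc ->.
Qed.

(** Multiplication by e^(ix) shifts Fourier coefficients, so the partial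
    sums of the Fourier series of h (e^(i(x-x0)) - 1) at x0 telescope in this
    way. *)
Lemma zrange_telescope (a : int -> R[i]) N :
  \sum_(l <- zrange N) (a (l - 1) - a l) = a (- N%:Z - 1) - a N%:Z.
Proof.
elim: N => [|N IH]; first by rewrite /zrange -lock /= big_seq1 oppr0 sub0r.
rewrite big_zrangeS IH.
have -> : N.+1%:Z - 1 = N%:Z by lia.
have -> : - N%:Z - 1 = - N.+1%:Z by lia.
ring.
Qed.

(** The Riemann-Lebesgue lemma along a subsequence, by Bessel: the sums of
    |c_l|^2 over [-N, N] converge, so their last terms are eventually small. *)
Lemma fourier_vanish f : bmfun D2pi f -> forall e : R, 0 < e -> forall N0,
  exists2 N, (N0 <= N)%N & normc (fourier f N%:Z) + normc (fourier f (- N%:Z - 1)) <= e.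
Proof.
move=> hf e e0 N0; have [B hB] := hf.2.
pose S N := \sum_(l <- zrange N) normc (fourier f l) ^+ 2.
have Snd : nondecreasing_seq S.
  apply/nondecreasing_seqP => N; rewrite /S big_zrangeS addrA lerDr addr_ge0 // sqr_ge0 //.
have Scvg : cvgn S.
  apply: nondecreasing_is_cvgn => //; exists (2 * B ^+ 2) => _ [N _ <-].
  by apply: bessel => //; exact: zrange_uniq.
have d0 : 0 < (e / 2) ^+ 2 by rewrite exprn_gt0 // divr_gt0.
move/cvgrPdist_le : (Scvg) => /(_ _ d0) [N1 _ hN].
exists (maxn N0 N1).+1; first by rewrite ltnW // ltnS leq_maxl.
set N := maxn N0 N1.
have SN : S N <= limn S by exact: nondecreasing_cvgn_le.
have gap l : (`|l| <= N.+2)%N -> (N < `|l|)%N -> normc (fourier f l) <= e / 2.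
  move=> l2 l1; rewrite -(@ler_pXn2r _ 2) ?nnegrE ?normc_ge0 ?divr_ge0 ?(ltW e0) //.
  have h : normc (fourier f l) ^+ 2 + S N <= limn S.
    apply: le_trans (_ : S N.+2 <= _); last exact: nondecreasing_cvgn_le.
    have -> : normc (fourier f l) ^+ 2 + S N =
      \sum_(k <- l :: zrange N) normc (fourier f k) ^+ 2 by rewrite big_cons.
    apply: sum_uniq_le.
    - by rewrite /= zrange_uniq andbT mem_zrange -ltnNge.
    - exact: zrange_uniq.
    - move=> k; rewrite in_cons => /predU1P[->|]; rewrite ?mem_zrange // => kN.
      by apply: leq_trans kN _; rewrite ltnW.
    - by move=> k; exact: sqr_ge0.
  have := hN N (leq_maxr _ _) => /= h'.
  apply: le_trans (_ : limn S - S N <= _); first by rewrite lerBrDr.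
  by apply: le_trans h'; exact: ler_norm.
have -> : e = e / 2 + e / 2 by field.
by apply: lerD; apply: gap; rewrite -/N; lia.
Qed.

(** Pointwise convergence of the Fourier series (Chernoff): u - u(x0) is h
    (e^(i(x-x0)) - 1) with h bounded, so its partial sums at x0 reduce to two
    Fourier coefficients of h, which tend to 0. Hence u is the sum of its
    absolutely convergent Fourier series. *)
Theorem smooth_W u : smooth u -> periodic2pi u -> exists B, W r B (fun x => (u x)%:C).
Proof.
move=> su pu; have [B hc] := smooth_wnorm su pu; exists B.
have cu := smooth_continuous (n := 0) su.
have mD : measurable D2pi by exact: measurable_itv.
have bu := real_bm pu cu mD.
set c := fourier _ in hc; have hs := WC_series hr hc.
apply: WC_ext (hs) => x0; apply/eqP; rewrite -subr_eq0; apply/eqP.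
set s0 := zseries _.
have [h bh hE] := chord_bm x0 su pu; pose g := fourier h.
have dE l : c l - (l == 0)%:R * (u x0)%:C = cis (- x0) * g (l - 1) - g l.
  transitivity (fourier (fun x => (u x)%:C - (u x0)%:C) l).
    rewrite (fourierB _ bu (bmfun_cst _ _)); congr (_ - _).
    have -> : (fun=> (u x0)%:C) = (fun x => (u x0)%:C * cis (0%:~R * x)) :> (R -> R[i]).
      by apply/funext => x; rewrite mul0r cis0 mulr1.
    by rewrite fourierZ ?fourier_cis; [rewrite mulrC eq_sym|exact: bmfun_cis].
  have b1 : bmfun D2pi (fun x => cis (1%:~R * x) * h x) by apply: bmfunM => //; exact: bmfun_cis.
  rewrite -[g (l - 1)]fourier_cisM -(fourierZ _ _ b1) -(fourierB _ _ bh).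
    apply: eq_fourier => x; rewrite hE mul1r addrC cisD; ring.
  by apply: bmfunM => //; exact: bmfun_cst.
have tele N : tsum (zrange N) c x0 - (u x0)%:C =
    cis ((- N%:Z - 1)%:~R * x0) * g (- N%:Z - 1) - cis (N%:Z%:~R * x0) * g N%:Z.
  rewrite -(zrange_telescope (fun l => cis (l%:~R * x0) * g l)).
  have -> : (u x0)%:C = \sum_(l <- zrange N) (l == 0)%:R * (u x0)%:C * cis (l%:~R * x0).
    rewrite (bigD1_seq 0) ?zrange_uniq ?mem_zrange // mulr0z mul0r cis0 mulr1 mul1r.
    by rewrite big1 /= ?addr0 // => l /negPf ->; rewrite !mul0r.
  rewrite /tsum -sumrB; apply: eq_bigr => l _; rewrite -mulrBl dE.
  have -> : cis ((l - 1)%:~R * x0) = cis (l%:~R * x0) * cis (- x0).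
    by rewrite -cisD; congr cis; rewrite rmorphB mulrBl mul1r.
  ring.
apply: Normc.eq0_normc; apply/eqP; rewrite eq_le normc_ge0 andbT.
apply/ler_addgt0Pr => e e0; rewrite add0r.
have e20 : 0 < e / 2 by rewrite divr_gt0.
have [N1 h1] := delta_small hr B e20.
have [N NN hN] := fourier_vanish bh e20 N1.
have -> : s0 - (u x0)%:C = (s0 - tsum (zrange N) c x0) + (tsum (zrange N) c x0 - (u x0)%:C) by ring.
apply: le_trans (le_normcD _ _) _; rewrite [leRHS](splitr e); apply: lerD.
  by apply: le_trans (hs.2 N x0) _; exact: h1.
rewrite tele; apply: le_trans (le_normcD _ _) _.
have rot (y : R) (z : R[i]) : normc (cis y * z) = normc z by rewrite Normc.normcM normc_cis mul1r.
by rewrite normcN !rot addrC.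
Qed.

End SmoothPotential.

(** * Fourier multipliers *)

Section Multipliers.
Context {R : realType} (r : R) (hr : 2^-1 < r).
Implicit Types (f g : R -> R[i]) (c d : int -> R[i]) (B x : R) (l k : int).

Local Notation delta := (delta r).
Local Notation WC := (WC r).
Local Notation W := (W r).

Lemma WC_uniq B A f g c : WC B f c -> WC A g c -> forall x, f x = g x.
Proof.
move=> hf hg x; apply/eqP; rewrite -subr_eq0; apply/eqP.
apply: (@eq0_delta _ r hr _ (B + A) 0) => N _; rewrite [leRHS]mulrDr.
have -> : f x - g x = (f x - tsum (zrange N) c x) + - (g x - tsum (zrange N) c x) by ring.
apply: le_trans (le_normcD _ _) _; rewrite normcN; apply: lerD; [exact: hf.2|exact: hg.2].
Qed.

(** A multiplier is computed by exhibiting a function of H^r with the right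
    coefficients. *)
Lemma fmult_eq B A (m : int -> R[i]) (K : R) f g : 0 <= K -> (forall l, normc (m l) <= K) ->
  W B f -> WC A g (fun l => m l * fourier f l) -> forall x, fmult m f x = g x.
Proof. by move=> K0 hm hf hg; apply: (WC_uniq (WC_fmult hr K0 hm hf) hg). Qed.

Lemma exp_dxE s B f x : W B f -> exp_dx s f x = f (x + s).
Proof.
move=> hf.
have hm l : normc (cexp (imag (s * l%:~R))) <= 1 :> R by rewrite cexp_imag normc_cis.
apply: (fmult_eq ler01 hm hf (WC_coef_ext _ (WC_shift s hf))) => l.
by rewrite cexp_imag (mulrC s).
Qed.

Definition dxx_sym (l : int) : R[i] := if l == 0 then 0 else - (l%:~R ^+ 2)^-1.

Lemma normc_dxx_sym l : normc (dxx_sym l) <= 1.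
Proof.
rewrite /dxx_sym; case: eqP => [_|/eqP l0]; first by rewrite Normc.normc0.
rewrite normcN Normc.normcV (_ : l%:~R = (l%:~R : R)%:C :> R[i]); last by rewrite rmorph_int.
rewrite -rmorphXn normcR normrX invf_le1; last by rewrite exprn_gt0 // normr_gt0 intr_eq0.
rewrite -[leLHS](expr1n _ 2) ler_pXn2r ?nnegrE // -intr_norm ler1z.
by rewrite -gtz0_ge1 normr_gt0.
Qed.

Lemma dxx_invC B f : W B f -> WC B (dxx_inv f) (fun l => dxx_sym l * fourier f l).
Proof.
by move=> hf; rewrite -(mul1r B); apply: WC_fmult (ler01) normc_dxx_sym hf.
Qed.

Lemma dxx_invD B A f g x : W B f -> W A g ->
  dxx_inv (fun y => f y + g y) x = dxx_inv f x + dxx_inv g x.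
Proof.
move=> hf hg; have hfg := WCD hf hg.
apply: (fmult_eq ler01 normc_dxx_sym (WC_W hr hfg)
  (WC_coef_ext _ (WCD (dxx_invC hf) (dxx_invC hg)))) => l.
by rewrite (WC_fourier hr l hfg) mulrDr.
Qed.

Lemma dxx_inv_shift B f s x : W B f -> dxx_inv (fun y => f (y + s)) x = dxx_inv f (x + s).
Proof.
move=> hf; have hs := WC_shift s hf.
apply: (fmult_eq ler01 normc_dxx_sym (WC_W hr hs)
  (WC_coef_ext _ (WC_shift s (dxx_invC hf)))) => l.
by rewrite (WC_fourier hr l hs) mulrCA.
Qed.

(** tau phi_1(i k tau) is the integral of e^(ikt) over [0, tau]: phi_1 is
    the average of the free evolution over a time step. *)
Lemma phi1_integral (k s : R) : 0 < s ->
  s%:C * phi1 (imag (k * s)) = cintegral (Icc 0 s) (fun t => cis (k * t)).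
Proof.
move=> s0; have [->|k0] := eqVneq k 0.
  rewrite (eq_cintegral (g := fun=> 1)); last by move=> t _; rewrite mul0r cis0.
  by rewrite cintegral_cst ?ltW // subr0 mul1r mul0r /phi1 /imag eqxx mulr1.
rewrite cintegral_cis ?ltW // /phi1.
have n0 (y : R) : y != 0 -> imag y != 0 :> R[i].
  by move=> y0; rewrite /imag eq_complex /= eqxx.
have ks0 : k * s != 0 by rewrite mulf_neq0 // gt_eqF.
rewrite (negPf (n0 _ ks0)) cexp_imag.
have -> : imag (k * s) = s%:C * imag k :> R[i].
  by apply: complexP; rewrite ?cReM ?cImM /=; ring.
have sn0 : s%:C != 0 :> R[i] by rewrite eq_complex /= eqxx andbT gt_eqF.
by field; rewrite sn0 n0.
Qed.

Lemma normc_phi1 (y : R) : normc (phi1 (imag y)) <= 2.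
Proof.
have := @phi1_integral y 1 ltr01; rewrite mulr1 mul1r => ->.
rewrite -[leRHS]mul1r -[X in _ <= X * _](subr0 1) -[X in _ <= _ * X]mulr1.
apply: cintegral_bound => //; first exact: cmfun_cis.
by move=> t _; rewrite normc_cis.
Qed.

Lemma phi1_dxC s B f : W B f ->
  WC (2 * B) (phi1_dx s f) (fun l => phi1 (imag (s * l%:~R)) * fourier f l).
Proof. by move=> hf; apply: WC_fmult hf => // l; exact: normc_phi1. Qed.

Lemma dxx_inv_phi1 s B f x : W B f ->
  dxx_inv (phi1_dx s f) x = phi1_dx s (dxx_inv f) x.
Proof.
move=> hf; have h1 := phi1_dxC s hf; have h2 := dxx_invC hf.
have h3 := phi1_dxC s (WC_W hr h2).
apply: (fmult_eq ler01 normc_dxx_sym (WC_W hr h1) (WC_coef_ext _ h3)) => l.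
by rewrite (WC_fourier hr l h2) (WC_fourier hr l h1) mulrCA.
Qed.

Lemma measurable_line (D : set R) (k x : R) : measurable_fun D (fun t => x + k * t).
Proof. by apply: measurable_funD => //; apply: measurable_funM. Qed.

Lemma W_line_bm (D : set R) B f (k x : R) : measurable D -> W B f ->
  bmfun D (fun t => f (x + k * t)).
Proof.
move=> mD hf; have [mf bf] := W_bm hr measurableT hf.
split.
  apply: (cmfun_comp measurableT _ mf) => //.
  exact: measurable_line.
by have [C hC] := bf; exists C => t _; exact: hC.
Qed.

(** The operator form of [phi1_integral]: phi_1 averages translates. All the
    filters of the scheme are integrals along characteristics in this way. The
    identity holds for each frequency and passes to the sum of the Fourier
    series. *)
Lemma phi1_dx_integral (k s : R) B f x : 0 < s -> W B f ->
  s%:C * phi1_dx (k * s) f x = cintegral (Icc 0 s) (fun t => f (x + k * t)).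
Proof.
move=> s0 hf; have s_ge0 := ltW s0.
have sn0 : s%:C != 0 :> R[i] by rewrite eq_complex /= eqxx andbT gt_eqF.
set z := cintegral _ _.
suff -> : phi1_dx (k * s) f x = s%:C^-1 * z by rewrite mulrA mulfV // mul1r.
rewrite /phi1_dx fmultE; apply: (@zseries_eq _ r hr _ _ (2 * B)) => N.
have bt l : bmfun (Icc 0 s) (fun t => cis (l%:~R * (x + k * t))).
  split.
    apply: (cmfun_comp measurableT _ (cmfun_cis l%:~R measurableT)) => //.
    exact: measurable_line.
  by exists 1 => t _; rewrite normc_cis.
have bts : bmfun (Icc 0 s) (fun t => tsum (zrange N) (fourier f) (x + k * t)).
  by apply: bmfun_sum => l; apply: bmfunM; first exact: bmfun_cst.
have -> : \sum_(l <- zrange N) phi1 (imag (k * s * l%:~R)) * fourier f l * cis (l%:~R * x)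
   = s%:C^-1 * cintegral (Icc 0 s) (fun t => tsum (zrange N) (fourier f) (x + k * t)).
  rewrite cintegral_sum; last by move=> l; apply: bmfunM; first exact: bmfun_cst.
  rewrite mulr_sumr; apply: eq_bigr => l _; rewrite cintegralZ //.
  have -> : cintegral (Icc 0 s) (fun t => cis (l%:~R * (x + k * t))) =
     cis (l%:~R * x) * (s%:C * phi1 (imag (l%:~R * k * s))).
    rewrite phi1_integral // -cintegralZ; last exact: bmfun_cis.
    by apply: eq_cintegral => t _; rewrite -cisD; congr cis; ring.
  rewrite (_ : k * s * l%:~R = l%:~R * k * s); last by ring.
  by field.
rewrite -mulrBr -cintegralB //; last exact: W_line_bm hf.
rewrite Normc.normcM Normc.normcV normcR gtr0_norm // ler_pdivrMl //.
have -> : s * (delta N * (2 * B)) = (s - 0) * (2 * (delta N * B)) by ring.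
apply: cintegral_bound => //.
  by apply: (bmfunB _ bts).1; exact: W_line_bm hf.
by move=> t _; exact: hf.2.
Qed.

End Multipliers.

(** * Time-dependent functions and their integrals *)

Section TimeFamilies.
Context {R : realType} (r : R) (hr : 2^-1 < r) (s : R) (s0 : 0 <= s).
Implicit Types (F G : R -> R -> R[i]) (B A : R -> R) (x : R) (l k : int).

Local Notation delta := (delta r).
Local Notation WC := (WC r).
Local Notation W := (W r).

(** A family in H^r that is weakly measurable in time. The radius depends on
    time because the norm of the exact solution is only essentially bounded a
    priori. *)
Definition fam F B := (forall t, Icc 0 s t -> W (B t) (F t)) /\
  forall l, cmfun (Icc 0 s) (fun t => fourier (F t) l).

Lemma fam_ext F G B : (forall t, Icc 0 s t -> forall x, F t x = G t x) ->
  fam F B -> fam G B.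
Proof.
move=> FG [hW hm].
have e t : Icc 0 s t -> F t = G t by move=> ht; apply/funext; exact: FG.
split; first by move=> t ht; rewrite -e //; exact: hW.
by move=> l; apply: cmfun_ext (hm l) => t ht; rewrite e.
Qed.

Lemma fam_mono F B A : (forall t, Icc 0 s t -> B t <= A t) -> fam F B -> fam F A.
Proof. by move=> BA [hW hm]; split=> // t ht; apply: WC_mono (hW t ht); exact: BA. Qed.

Lemma fam_series F B (c : R -> int -> R[i]) :
  (forall t, Icc 0 s t -> WC (B t) (F t) (c t)) ->
  (forall l, cmfun (Icc 0 s) (fun t => c t l)) -> fam F B.
Proof.
move=> h hm; split; first by move=> t /h /(WC_W hr).
move=> l; apply: cmfun_ext (hm l) => t ht; by rewrite (WC_fourier hr l (h t ht)).
Qed.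

Lemma fam_const (f : R -> R[i]) (b : R) : W b f -> fam (fun=> f) (fun=> b).
Proof. by move=> hf; split=> // l; exact: cmfun_cst. Qed.

Lemma famD F G B A : fam F B -> fam G A ->
  fam (fun t x => F t x + G t x) (fun t => B t + A t).
Proof.
move=> [hF mF] [hG mG].
apply: (fam_series (c := fun t l => fourier (F t) l + fourier (G t) l)).
  by move=> t ht; apply: WCD; [exact: hF|exact: hG].
by move=> l; exact: cmfunD.
Qed.

Lemma famZ (a : R[i]) F B : fam F B -> fam (fun t x => a * F t x) (fun t => normc a * B t).
Proof.
move=> [hF mF]; apply: (fam_series (c := fun t l => a * fourier (F t) l)).
  by move=> t ht; apply: WCZ; exact: hF.
by move=> l; apply: cmfunM => //; exact: cmfun_cst.
Qed.

Lemma famN F B : fam F B -> fam (fun t x => - F t x) B.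
Proof.
move=> [hF mF]; apply: (fam_series (c := fun t l => - fourier (F t) l)).
  by move=> t ht; apply: WCN; exact: hF.
by move=> l; exact: cmfunN.
Qed.

Lemma famB F G B A : fam F B -> fam G A ->
  fam (fun t x => F t x - G t x) (fun t => B t + A t).
Proof. by move=> hF hG; apply: famD => //; exact: famN. Qed.

Lemma fam_conj F B : fam F B -> fam (fun t x => Num.conj (F t x)) B.
Proof.
move=> [hF mF]; apply: (fam_series (c := fun t l => Num.conj (fourier (F t) (- l)))).
  by move=> t ht; apply: WC_conj; exact: hF.
by move=> l; exact: cmfunJ.
Qed.

Lemma fam_shift (a b : R) F B : fam F B -> fam (fun t x => F t (x + (a + b * t))) B.
Proof.
move=> [hF mF].
apply: (fam_series (c := fun t l => cis (l%:~R * (a + b * t)) * fourier (F t) l)).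
  by move=> t ht; apply: WC_shift; exact: hF.
move=> l; apply: cmfunM => //.
apply: cmfun_ext (_ : cmfun (Icc 0 s) (fun t => cis (l%:~R * a) * cis ((l%:~R * b) * t))).
  by move=> t _; rewrite -cisD; congr cis; ring.
by apply: cmfunM; [exact: cmfun_cst|exact: cmfun_cis].
Qed.

Lemma fam_dxx_inv F B : fam F B -> fam (fun t => dxx_inv (F t)) B.
Proof.
move=> [hF mF].
apply: (fam_series (c := fun t l => dxx_sym l * fourier (F t) l)).
  by move=> t ht; apply: dxx_invC => //; exact: hF.
by move=> l; apply: cmfunM => //; exact: cmfun_cst.
Qed.

(** The coefficients of the product are pointwise limits in time of finite
    convolutions, hence measurable. *)
Lemma famM F G B A : fam F B -> fam G A ->
  fam (fun t x => F t x * G t x) (fun t => algcst r * B t * A t).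
Proof.
move=> [hF mF] [hG mG]; split.
  by move=> t ht; apply: WM => //; [exact: hF|exact: hG].
move=> l; apply: (@cmfun_lim _ _ (fun N t => \sum_(j <- zrange N)
    fourier (F t) j * fourier (G t) (l - j)) _ delta
    (fun t => 4 * kappa r * B t * A t)).
- by move=> N; apply: cmfun_sum => j; exact: cmfunM.
- exact: delta_cvg.
- by move=> N t ht; apply: fourierM_approx => //; [exact: hF|exact: hG].
Qed.

Lemma fam_point_meas F B x : fam F B -> cmfun (Icc 0 s) (fun t => F t x).
Proof.
move=> [hF mF].
apply: (@cmfun_lim _ _ (fun N t => tsum (zrange N) (fourier (F t)) x) _ delta B).
- move=> N; apply: cmfun_sum => l; apply: cmfunM => //; exact: cmfun_cst.
- exact: delta_cvg.
- by move=> N t ht; exact: (hF t ht).2.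
Qed.

Lemma fam_point F (b : R) x : fam F (fun=> b) -> bmfun (Icc 0 s) (fun t => F t x).
Proof.
move=> hF; split; first exact: fam_point_meas hF.
by exists (2 * kappa r * b) => t ht; exact: WC_bound (hF.1 t ht).
Qed.

Lemma fam_coef_bm F (b : R) l : fam F (fun=> b) ->
  bmfun (Icc 0 s) (fun t => fourier (F t) l).
Proof.
move=> [hF mF]; split=> //; exists b => t ht; exact: wnorm_coef (hF t ht).1.
Qed.

Lemma integrable_Rintegral_sum (I : Type) (q : seq I) (u : I -> R -> R) :
  (forall i, mu.-integrable (Icc 0 s) (EFin \o u i)) ->
  mu.-integrable (Icc 0 s) (EFin \o (fun t => \sum_(i <- q) u i t)) /\
  \int[mu]_(t in Icc 0 s) (\sum_(i <- q) u i t) = \sum_(i <- q) \int[mu]_(t in Icc 0 s) u i t.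
Proof.
move=> iu; elim: q => [|i q [IH1 IH2]].
  have e : (fun t : R => \sum_(i <- [::]) u i t) = (fun=> 0).
    by apply/funext => t; rewrite big_nil.
  rewrite e big_nil; split; last by rewrite Rintegral_cst_Icc // mul0r.
  by apply: (@bm_integrable _ _ _ _ 0) => // t _; rewrite normr0.
have e : (fun t : R => \sum_(i <- i :: q) u i t) = (fun t => u i t + \sum_(i <- q) u i t).
  by apply/funext => t; rewrite big_cons.
rewrite e big_cons -IH2; split; first exact: (integrableD _ (iu i) IH1).
by rewrite RintegralD.
Qed.

(** Minkowski's integral inequality in H^r: coefficientwise Cauchy-Schwarz
    in time, summed against the weights. This is the only place where H^r norms
    of integrals are estimated. *)
Lemma fam_integral F (B : R) : fam F (fun=> B) ->
  W (s * B) (fun x => cintegral (Icc 0 s) (fun t => F t x)).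
Proof.
move=> hF; have B0 : 0 <= B.
  by apply: (WC_ge0 (hF.1 0 _)); rewrite /= in_itv /= lexx.
apply: W_closure => //; first exact: mulr_ge0.
move=> e e0; have [N hN] := @delta_small _ r hr (s * (2 * B)) e e0.
pose h l := cintegral (Icc 0 s) (fun t => fourier (F t) l).
have bc l := fam_coef_bm l hF.
have bts x : bmfun (Icc 0 s) (fun t => tsum (zrange N) (fourier (F t)) x).
  by apply: bmfun_sum => l; apply: bmfunM => //; exact: bmfun_cst.
exists (tsum (zrange N) h); last first.
  move=> x.
  have -> : tsum (zrange N) h x =
      cintegral (Icc 0 s) (fun t => tsum (zrange N) (fourier (F t)) x).
    rewrite cintegral_sum; last by move=> l; apply: bmfunM => //; exact: bmfun_cst.
    apply: eq_bigr => l _; rewrite /h mulrC -cintegralZ //.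
    by apply: eq_cintegral => t _; rewrite mulrC.
  rewrite -cintegralB //; last exact: fam_point hF.
  apply: le_trans (hN N (leqnn _)).
  have -> : delta N * (s * (2 * B)) = (s - 0) * (2 * (delta N * B)) by ring.
  apply: cintegral_bound => //; first exact: (bmfunB (fam_point x hF) (bts x)).1.
  by move=> t ht; exact: (hF.1 t ht).2.
apply: (WC_W hr (WC_tsum hr _ (zrange_uniq N) _)) => //; first exact: mulr_ge0.
pose v l t := wt r l * normc (fourier (F t) l) ^+ 2.
have i0 l : mu.-integrable (Icc 0 s) (EFin \o (fun t => normc (fourier (F t) l) ^+ 2)).
  have [[mr mi] _] := bc l.
  apply: (@bm_integrable _ _ _ _ (B ^+ 2)).
    apply: (@eq_measurable_fun _ _ _ _ _ (fun t => complex.Re (fourier (F t) l) ^+ 2 +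
      complex.Im (fourier (F t) l) ^+ 2)).
      by move=> t _; rewrite normcE2.
    by apply: measurable_funD; apply: measurable_funX.
  move=> t ht; rewrite ger0_norm ?sqr_ge0 //.
  by rewrite ler_pXn2r ?nnegrE ?normc_ge0 // (wnorm_coef hr l (hF.1 t ht).1).
have iv l : mu.-integrable (Icc 0 s) (EFin \o v l).
  exact: (integrableZl _ (wt r l) (i0 l)).
apply: le_trans (_ : \sum_(l <- zrange N) s * \int[mu]_(t in Icc 0 s) v l t <= _).
  apply: ler_sum => l _.
  apply: le_trans (_ : wt r l * (s * \int[mu]_(t in Icc 0 s) (normc (fourier (F t) l) ^+ 2)) <= _).
    by rewrite ler_wpM2l ?wt_ge0 // cintegral_sqr.
  by rewrite mulrCA ler_wpM2l // /v RintegralZl.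
have [i1 i2] := integrable_Rintegral_sum (zrange N) iv.
rewrite -mulr_sumr -i2 (_ : (s * B) ^+ 2 = s * (B ^+ 2 * (s - 0))); last by ring.
rewrite ler_wpM2l // -Rintegral_cst_Icc //.
apply: le_Rintegral => //; first by apply: (@bm_integrable _ _ _ _ `|B ^+ 2|).
by move=> t ht; apply: (hF.1 t ht).1.2; exact: zrange_uniq.
Qed.

End TimeFamilies.

(** * The Sobolev norm *)

(* From here on these operators are used through their lemmas only; comparing
   their bodies makes unification explode. *)
Local Opaque fmult fourier cintegral.

Section SobolevNorm.
Context {R : realType} (r : R) (hr : 2^-1 < r).
Implicit Types (f g : R -> R[i]) (B x : R) (l : int).
Local Notation W := (W r).

Lemma sqrte_le (x : \bar R) (B : R) : 0 <= B ->
  (sqrte x <= B%:E)%E = (x <= (B ^+ 2)%:E)%E.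
Proof.
move=> B0; have -> : B%:E = sqrte (B ^+ 2)%:E.
  by rewrite /sqrte sqrtr_sqr ger0_norm.
by rewrite lee_sqrt // lee_fin sqr_ge0.
Qed.

Lemma sobolev_norm_le B f : square_integrable f -> wnorm_le r (fourier f) B ->
  (sobolev_norm r f <= B%:E)%E.
Proof.
move=> sf [B0 hB]; rewrite /sobolev_norm asboolT // sqrte_le //.
apply: ub_ereal_sup => _ [A [finA _] <-].
rewrite fsbig_finite //= sumEFin lee_fin; apply: hB; exact: finmap.fset_uniq.
Qed.

Lemma sobolev_norm_ge B f : 0 <= B -> (sobolev_norm r f <= B%:E)%E ->
  square_integrable f /\ wnorm_le r (fourier f) B.
Proof.
move=> B0; rewrite /sobolev_norm; case: asboolP => [sf|//].
rewrite sqrte_le // => h; split=> //; split=> // s us.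
rewrite -lee_fin; apply: le_trans h; apply: esum_ge.
exists [set` s]; first by split=> //; exact: finite_seq.
by rewrite -fsbig_seq // /wsum sumEFin.
Qed.

Lemma Hr_norm_comp_le B (Psi : R -> 'cV[R[i]]_2) : 0 <= B -> (Hr_norm r Psi <= B%:E)%E ->
  (sobolev_norm r (comp1 Psi) <= B%:E)%E /\ (sobolev_norm r (comp2 Psi) <= B%:E)%E.
Proof.
move=> B0; rewrite /Hr_norm sqrte_le // => h.
have sge f : (0 <= sobolev_norm r f)%E.
  by rewrite /sobolev_norm; case: asboolP => // _; exact: sqrte_ge0.
have hB : (0 <= B%:E)%E by rewrite lee_fin.
split; apply: lee_sqrE => //; apply: (le_trans _ h).
  by apply: leeDl; exact: expe_ge0.
by apply: leeDr; exact: expe_ge0.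
Qed.

Lemma W_square_integrable B f : W B f -> square_integrable f.
Proof.
move=> hf; have [[mr mi] _] := W_bm hr measurableT hf; split=> //.
  by move=> x; exact: (WC_periodic hr x hf).
have [[mr' mi'] _] := W_bm hr (measurable_itv `[0, 2 * pi]) hf.
apply: (@bm_integrable _ _ _ _ ((2 * kappa r * B) ^+ 2)).
  apply: (@eq_measurable_fun _ _ _ _ _ (fun t => complex.Re (f t) ^+ 2 +
    complex.Im (f t) ^+ 2)).
    by move=> t _; rewrite normcE2.
  by apply: measurable_funD; apply: measurable_funX.
move=> t _; have h := WC_bound hr t hf; have h0 := normc_ge0 (f t).
by rewrite ger0_norm ?sqr_ge0 // ler_pXn2r ?nnegrE // (le_trans h0 h).
Qed.

Lemma W_half_sum B f g : W B f -> W B g -> W B (fun x => 2^-1 * (f x + g x)).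
Proof.
move=> hf hg; apply: (WC_W hr (WC_mono _ (WCZ 2^-1 (WCD hf hg)))).
have -> : 2^-1 = (2^-1)%:C :> R[i] by rewrite fmorphV rmorph_nat.
by rewrite normcR ger0_norm ?invr_ge0 // le_eqVlt; apply/orP; left; apply/eqP; field.
Qed.

Lemma W_half_diff B f g : W B f -> W B g -> W B (fun x => 2^-1 * (f x - g x)).
Proof.
move=> hf hg; apply: W_half_sum => //; exact: (WC_W hr (WCN hg)).
Qed.

(** Passing from the characteristic components back to the spinor; the
    constant 2 leaves room for the two components. *)
Lemma Hr_norm_W B (Psi : R -> 'cV[R[i]]_2) : W B (phi_p Psi) -> W B (phi_m Psi) ->
  (Hr_norm r Psi <= (2 * B)%:E)%E.
Proof.
move=> hp hm; have B0 := WC_ge0 hp.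
have two : 2 != 0 :> R[i] by rewrite pnatr_eq0.
have h1 : W B (comp1 Psi).
  apply: WC_W => //; apply: WC_ext (W_half_sum hp hm) => x.
  by rewrite /phi_p /phi_m; field.
have h2 : W B (comp2 Psi).
  apply: WC_W => //; apply: WC_ext (W_half_diff hp hm) => x.
  by rewrite /phi_p /phi_m; field.
have s1 := sobolev_norm_le (W_square_integrable h1) h1.1.
have s2 := sobolev_norm_le (W_square_integrable h2) h2.1.
have sge f : (0 <= sobolev_norm r f)%E.
  by rewrite /sobolev_norm; case: asboolP => // _; exact: sqrte_ge0.
have hB : (0 <= B%:E)%E by rewrite lee_fin.
rewrite /Hr_norm sqrte_le ?mulr_ge0 //.
move: s1 s2 (sge (comp1 Psi)) (sge (comp2 Psi)).
move: (sobolev_norm r (comp1 Psi)) (sobolev_norm r (comp2 Psi)) => a b s1 s2 a0 b0.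
have q1 : (a ^+ 2 <= B%:E ^+ 2)%E by rewrite lee_sqr.
have q2 : (b ^+ 2 <= B%:E ^+ 2)%E by rewrite lee_sqr.
apply: le_trans (leeD q1 q2) _; rewrite -!EFin_expe -EFinD lee_fin.
have := sqr_ge0 B; lra.
Qed.

(** Linearity of the Fourier coefficients is needed for functions that are
    not yet known to be bounded; 1 + |f|^2 dominates the integrand. *)
Lemma square_integrable_cis (f : R -> R[i]) l : square_integrable f ->
  cintble 0 (2 * pi) (fun x => f x * cis (- l%:~R * x)).
Proof.
move=> [_ mr mi fi].
have mD := measurable_itv `[(0:R), 2 * pi].
have mf : cmfun (Icc 0 (2 * pi)) (fun x => f x * cis (- l%:~R * x)).
  apply: cmfunM; last exact: cmfun_cis.
  by split; apply: measurable_funTS.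
have dom : mu.-integrable (Icc 0 (2 * pi)) (EFin \o (fun x : R => 1 + normc (f x) ^+ 2)).
  have i1 : mu.-integrable (Icc 0 (2 * pi)) (EFin \o (fun _ : R => 1 : R)).
    by apply: (@bm_integrable _ _ _ _ `|1|).
  exact: (integrableD _ i1 fi).
have bd x : normc (f x * cis (- l%:~R * x)) <= 1 + normc (f x) ^+ 2.
  rewrite Normc.normcM normc_cis mulr1; have := sqr_ge0 (normc (f x) - 1).
  have := normc_ge0 (f x); rewrite sqrrB; nra.
split.
- apply: (le_integrable _ _ _ dom) => //; first by apply/measurable_EFinP; exact: mf.1.
  move=> x _ /=; rewrite lee_fin [leRHS]ger0_norm ?addr_ge0 ?sqr_ge0 //.
  exact: le_trans (le_Re_normc _) (bd x).
- apply: (le_integrable _ _ _ dom) => //; first by apply/measurable_EFinP; exact: mf.2.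
  move=> x _ /=; rewrite lee_fin [leRHS]ger0_norm ?addr_ge0 ?sqr_ge0 //.
  exact: le_trans (le_Im_normc _) (bd x).
Qed.

Lemma fourier_lin (a b : R[i]) f g l : square_integrable f -> square_integrable g ->
  fourier (fun x => a * f x + b * g x) l = a * fourier f l + b * fourier g l.
Proof.
move=> sf sg; have hf := square_integrable_cis l sf; have hg := square_integrable_cis l sg.
have sc (c : R[i]) u : cintble 0 (2 * pi) u -> cintble 0 (2 * pi) (fun x => c * u x).
  move=> [ur ui]; split.
    have -> : (fun x => complex.Re (c * u x)) = (fun x => complex.Re c * complex.Re (u x)
        - complex.Im c * complex.Im (u x)) by apply/funext => x; rewrite cReM.
    exact: (integrableB _ (integrable_scale (complex.Re c) ur)
      (integrable_scale (complex.Im c) ui)).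
  have -> : (fun x => complex.Im (c * u x)) = (fun x => complex.Re c * complex.Im (u x)
      + complex.Im c * complex.Re (u x)) by apply/funext => x; rewrite cImM.
  exact: (integrableD _ (integrable_scale (complex.Re c) ui)
    (integrable_scale (complex.Im c) ur)).
rewrite !fourierE; have -> : cintegral (Icc 0 (2 * pi))
    (fun x => (a * f x + b * g x) * cis (- l%:~R * x)) =
  cintegral (Icc 0 (2 * pi))
    (fun x => a * (f x * cis (- l%:~R * x)) + b * (g x * cis (- l%:~R * x))).
  by apply: eq_cintegral => x _; ring.
rewrite cintegralD_int; [|exact: sc..].
rewrite !cintegralZ_int //; ring.
Qed.

End SobolevNorm.

(** * Characteristic components of spinors *)

Section Spinors.
Context {R : realType} (r : R) (hr : 2^-1 < r).
Implicit Types (f p m : R -> R[i]) (Psi : R -> 'cV[R[i]]_2) (s x y tau lam : R).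
Local Notation W := (W r).

Let two : (2 : R[i]) != 0. Proof. by rewrite pnatr_eq0. Qed.

Lemma vec2_0 (a b : R[i]) : vec2 a b 0 0 = a. Proof. by rewrite mxE. Qed.
Lemma vec2_1 (a b : R[i]) : vec2 a b 1 0 = b. Proof. by rewrite mxE. Qed.

Lemma mulmx2 (A : 'M[R[i]]_2) (u : 'cV[R[i]]_2) (i : 'I_2) :
  (A *m u) i 0 = A i 0 * u 0 0 + A i 1 * u 1 0.
Proof.
rewrite mxE !big_ord_recl big_ord0 addr0.
by congr (_ + A i _ * u _ _); apply: val_inj.
Qed.

Lemma vec2D0 (a b c d : R[i]) : (vec2 a b + vec2 c d) 0 0 = a + c.
Proof. by rewrite !mxE. Qed.
Lemma vec2D1 (a b c d : R[i]) : (vec2 a b + vec2 c d) 1 0 = b + d.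
Proof. by rewrite !mxE. Qed.

Lemma fmultZ (a : R[i]) (mm : int -> R[i]) (K B : R) f x : 0 <= K ->
  (forall l, normc (mm l) <= K) -> W B f -> fmult mm (fun y => a * f y) x = a * fmult mm f x.
Proof.
move=> K0 hm hf; have h := WCZ a hf; have hw := WC_fmult hr K0 hm hf.
apply: (fmult_eq hr K0 hm (WC_W hr h) (WC_coef_ext _ (WCZ a hw))) => l.
by rewrite (WC_fourier hr l h) mulrCA.
Qed.

Lemma Pi_plus_comp Psi x : mx_act Pi_plus Psi x = vec2 (2^-1 * phi_p Psi x) (2^-1 * phi_p Psi x).
Proof.
apply/matrixP => i j; rewrite ord1 /mx_act mulmx2 /phi_p /comp1 /comp2 !mxE.
by case: i => -[|[|//]] hi /=; ring.
Qed.

Lemma Pi_minus_comp Psi x :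
  mx_act Pi_minus Psi x = vec2 (2^-1 * phi_m Psi x) (- 2^-1 * phi_m Psi x).
Proof.
apply/matrixP => i j; rewrite ord1 /mx_act mulmx2 /phi_m /comp1 /comp2 !mxE.
by case: i => -[|[|//]] hi /=; ring.
Qed.

Lemma beta_comp (u : 'cV[R[i]]_2) : beta *m u = vec2 (u 0 0) (- u 1 0).
Proof.
apply/matrixP => i j; rewrite ord1 mulmx2 !mxE.
by case: i => -[|[|//]] hi /=; ring.
Qed.

Local Opaque beta Pi_plus Pi_minus.

Lemma flow_0 s Psi x : flow s Psi x 0 0 =
  exp_dx s (comp1 (mx_act Pi_plus Psi)) x + exp_dx (- s) (comp1 (mx_act Pi_minus Psi)) x.
Proof.
exact: (vec2D0 (exp_dx s (comp1 (mx_act Pi_plus Psi)) x) (exp_dx s (comp2 (mx_act Pi_plus Psi)) x)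
  (exp_dx (- s) (comp1 (mx_act Pi_minus Psi)) x) (exp_dx (- s) (comp2 (mx_act Pi_minus Psi)) x)).
Qed.

Lemma flow_1 s Psi x : flow s Psi x 1 0 =
  exp_dx s (comp2 (mx_act Pi_plus Psi)) x + exp_dx (- s) (comp2 (mx_act Pi_minus Psi)) x.
Proof.
exact: (vec2D1 (exp_dx s (comp1 (mx_act Pi_plus Psi)) x) (exp_dx s (comp2 (mx_act Pi_plus Psi)) x)
  (exp_dx (- s) (comp1 (mx_act Pi_minus Psi)) x) (exp_dx (- s) (comp2 (mx_act Pi_minus Psi)) x)).
Qed.

Lemma phi_pB_scale (u v : R -> 'cV[R[i]]_2) (a : R[i]) x :
  phi_p (fun y => u y - a *: v y) x = phi_p u x - a * phi_p v x.
Proof. by rewrite /phi_p /comp1 /comp2 !mxE; ring. Qed.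

Lemma phi_mB_scale (u v : R -> 'cV[R[i]]_2) (a : R[i]) x :
  phi_m (fun y => u y - a *: v y) x = phi_m u x - a * phi_m v x.
Proof. by rewrite /phi_m /comp1 /comp2 !mxE; ring. Qed.

Lemma phi_pD3 (u v w : R -> 'cV[R[i]]_2) x :
  phi_p (fun y => u y + v y + w y) x = phi_p u x + phi_p v x + phi_p w x.
Proof. by rewrite /phi_p /comp1 /comp2 !mxE; ring. Qed.

Lemma phi_mD3 (u v w : R -> 'cV[R[i]]_2) x :
  phi_m (fun y => u y + v y + w y) x = phi_m u x + phi_m v x + phi_m w x.
Proof. by rewrite /phi_m /comp1 /comp2 !mxE; ring. Qed.

(** On H^r the free flow translates the two characteristic components in
    opposite directions. *)
Lemma flow_pm s B Psi x : W B (phi_p Psi) -> W B (phi_m Psi) ->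
  phi_p (flow s Psi) x = phi_p Psi (x + s) /\ phi_m (flow s Psi) x = phi_m Psi (x - s).
Proof.
move=> hp hm.
have ez (a : R[i]) k f y : W B f -> exp_dx k (fun z => a * f z) y = a * f (y + k).
  by move=> hf; rewrite -(exp_dxE hr k y (WC_W hr (WCZ a hf))).
have c1 : comp1 (mx_act Pi_plus Psi) = fun z => 2^-1 * phi_p Psi z.
  by apply/funext => z; rewrite /comp1 Pi_plus_comp vec2_0.
have c2 : comp2 (mx_act Pi_plus Psi) = fun z => 2^-1 * phi_p Psi z.
  by apply/funext => z; rewrite /comp2 Pi_plus_comp vec2_1.
have c3 : comp1 (mx_act Pi_minus Psi) = fun z => 2^-1 * phi_m Psi z.
  by apply/funext => z; rewrite /comp1 Pi_minus_comp vec2_0.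
have c4 : comp2 (mx_act Pi_minus Psi) = fun z => - 2^-1 * phi_m Psi z.
  by apply/funext => z; rewrite /comp2 Pi_minus_comp vec2_1.
have e0 : flow s Psi x 0 0 = 2^-1 * phi_p Psi (x + s) + 2^-1 * phi_m Psi (x - s).
  rewrite flow_0 c1 c3.
  rewrite (ez 2^-1 s (phi_p Psi) x hp).
  by rewrite (ez 2^-1 (- s) (phi_m Psi) x hm).
have e1 : flow s Psi x 1 0 = 2^-1 * phi_p Psi (x + s) + - 2^-1 * phi_m Psi (x - s).
  rewrite flow_1 c2 c4.
  by rewrite (ez 2^-1 s (phi_p Psi) x hp) (ez (- 2^-1) (- s) (phi_m Psi) x hm).
move: e0 e1; rewrite {3}/phi_p {3}/phi_m /comp1 /comp2 => -> ->.
by split; field.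
Qed.

(** The p-component of beta Psi + V Psi + F(Psi); the m-component is
    obtained by exchanging p and m. Indeed |phi_1|^2 - |phi_2|^2 = Re (p conj
    m). *)
Definition Nlin lam (V p m : R -> R[i]) x : R[i] :=
  m x + V x * p x +
  (lam / 2)%:C * ((p x * Num.conj (m x) + Num.conj (p x) * m x) * m x).

Lemma dirac_rhs_pm lam V Psi x :
  phi_p (dirac_rhs lam V Psi) x = Nlin lam V (phi_p Psi) (phi_m Psi) x /\
  phi_m (dirac_rhs lam V Psi) x = Nlin lam V (phi_m Psi) (phi_p Psi) x.
Proof.
set u1 := Psi x 0 0; set u2 := Psi x 1 0.
have d : (adjoint (Psi x) *m beta *m Psi x) 0 0 = Num.conj u1 * u1 - Num.conj u2 * u2.
  rewrite -mulmxA beta_comp mxE !big_ord_recl big_ord0 addr0 !mxE /=.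
  by rewrite (_ : lift ord0 ord0 = 1) ?mulrN //; apply: val_inj.
have h2 : (lam / 2)%:C = lam%:C / 2 :> R[i] by rewrite rmorphM fmorphV rmorph_nat.
rewrite /phi_p /phi_m /Nlin /comp1 /comp2 /dirac_rhs /nonlin d beta_comp !mxE /=.
rewrite -/u1 -/u2 h2 !rmorphD !rmorphN /=.
by split; field.
Qed.

End Spinors.

(** * Estimates on the right-hand side *)

Ltac solve_bm := repeat (first [assumption | exact: bmfun_cst
  | apply: bmfunD | apply: bmfunM]).

Section Nonlinearity.
Context {R : realType} (r : R) (hr : 2^-1 < r) (lam : R).
Implicit Types (F G : R -> R -> R[i]) (B A : R -> R) (x t : R).
Local Notation W := (W r).
Local Notation fam := (fam r).
Local Notation K := (algcst r).

(** The H^r bound of the right-hand side when V has norm at most k and the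
    components have norm at most a. *)
Definition Nbound (k a : R) : R :=
  (a + K * k * a) + normc (lam / 2)%:C * (K * (K * a * a + K * a * a) * a).

Lemma fam_Nlin s V P M (k a : R -> R) : fam s V k -> fam s P a -> fam s M a ->
  fam s (fun t => Nlin lam (V t) (P t) (M t)) (fun t => Nbound (k t) (a t)).
Proof.
move=> hV hP hM; have cP := fam_conj hr hP; have cM := fam_conj hr hM.
exact: (famD hr (famD hr hM (famM hr hV hP)) (famZ hr (lam / 2)%:C
  (famM hr (famD hr (famM hr hP cM) (famM hr cP hM)) hM))).
Qed.

(** The Lipschitz constant of the right-hand side on the ball of radius a,
    when V has norm at most k and Lipschitz constant v. *)
Definition Nlip (k a v : R) : R :=
  1 + K * v * a + K * k + normc (lam / 2)%:C * (6 * K * K * a * a).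

Lemma fam_Nlin_lip s V V' P P' M M' (k a v E : R) :
  fam s V' (fun=> k) -> fam s (fun t x => V t x - V' t x) (fun=> v * E) ->
  fam s P (fun=> a) -> fam s P' (fun=> a) -> fam s M (fun=> a) -> fam s M' (fun=> a) ->
  fam s (fun t x => P t x - P' t x) (fun=> E) ->
  fam s (fun t x => M t x - M' t x) (fun=> E) ->
  fam s (fun t x => Nlin lam (V t) (P t) (M t) x - Nlin lam (V' t) (P' t) (M' t) x)
    (fun=> Nlip k a v * E).
Proof.
move=> hV' dV hP hP' hM hM' dP dM.
have cM := fam_conj hr hM; have cM' := fam_conj hr hM'.
have cP' := fam_conj hr hP'.
have dcM := fam_conj hr dM; have dcP := fam_conj hr dP.
have S1 := famD hr (famD hr (famM hr dP cM) (famM hr hP' dcM))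
             (famD hr (famM hr dcP hM) (famM hr cP' dM)).
have S2 := famD hr (famM hr hP' cM') (famM hr cP' hM').
have T := famZ hr (lam / 2)%:C (famD hr (famM hr S1 hM) (famM hr S2 dM)).
have L := famD hr dM (famD hr (famM hr dV hP) (famM hr hV' dP)).
apply: fam_ext (fam_mono _ (famD hr L T)).
  move=> t _ x; rewrite /Nlin !rmorphB /=; ring.
by move=> t _; rewrite /Nlip le_eqVlt; apply/orP; left; apply/eqP; ring.
Qed.

Lemma fam_translate f (b k : R) s : W b f -> fam s (fun t x => f (x + (0 + k * t))) (fun=> b).
Proof. by move=> hf; exact: (fam_shift hr 0 k (fam_const s hf)). Qed.

End Nonlinearity.

(** * The scheme as a Duhamel formula along free waves *)

(** A potential PV depending on the characteristic components p and m,
    together with the term J of the scheme that represents it. On balls of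
    radius a it has norm at most KV a and Lipschitz constant LV a. The last
    field says that J integrates the potential exactly along the free waves p(x
    - t) and m(x + t); the sums 0 + k * t match [fam_shift]. *)
Record potential (R : realType) (r : R) (PV : (R -> R[i]) -> (R -> R[i]) -> R -> R[i])
    (J : R -> (R -> 'cV[R[i]]_2) -> R -> 'cV[R[i]]_2) (KV LV : R -> R) : Prop := {
  pot_fam : forall (s : R) (P M : R -> R -> R[i]) (a : R -> R), 0 <= s ->
    fam r s P a -> fam r s M a ->
    fam r s (fun t => PV (P t) (M t)) (fun t => KV (a t)) ;
  pot_lip : forall (s : R) (P M P' M' : R -> R -> R[i]) (a E : R), 0 <= s ->
    fam r s P (fun=> a) -> fam r s M (fun=> a) ->
    fam r s P' (fun=> a) -> fam r s M' (fun=> a) ->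
    fam r s (fun t x => P t x - P' t x) (fun=> E) ->
    fam r s (fun t x => M t x - M' t x) (fun=> E) ->
    fam r s (fun t x => PV (P t) (M t) x - PV (P' t) (M' t) x) (fun=> LV a * E) ;
  pot_cst_ge0 : forall a, 0 <= a -> 0 <= KV a /\ 0 <= LV a ;
  pot_step : forall (tau : R) (b : R) Psi, 0 < tau -> W r b (phi_p Psi) -> W r b (phi_m Psi) ->
    forall y,
    phi_p (J tau Psi) y = cintegral (Icc 0 tau) (fun t =>
      PV (fun x => phi_p Psi (x + (0 + (-1) * t))) (fun x => phi_m Psi (x + (0 + 1 * t)))
         (y + (0 + 1 * t)) * phi_p Psi y) /\
    phi_m (J tau Psi) y = cintegral (Icc 0 tau) (fun t =>
      PV (fun x => phi_p Psi (x + (0 + (-1) * t))) (fun x => phi_m Psi (x + (0 + 1 * t)))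
         (y + (0 + (-1) * t)) * phi_m Psi y)
}.

Section Step.
Context {R : realType} (r : R) (hr : 2^-1 < r) (lam : R).
Variables (PV : (R -> R[i]) -> (R -> R[i]) -> R -> R[i])
  (J : R -> (R -> 'cV[R[i]]_2) -> R -> 'cV[R[i]]_2) (KV LV : R -> R).
Hypothesis pot : potential r PV J KV LV.
Implicit Types (p m : R -> R[i]) (Psi : R -> 'cV[R[i]]_2) (x y t tau : R).
Local Notation W := (W r).
Local Notation fam := (fam r).

Let two : (2 : R[i]) != 0. Proof. by rewrite pnatr_eq0. Qed.

Definition free_p Psi t x := phi_p Psi (x + (0 + (-1) * t)).
Definition free_m Psi t x := phi_m Psi (x + (0 + 1 * t)).

Definition free_rhs_p Psi t := Nlin lam (PV (free_p Psi t) (free_m Psi t)) (free_p Psi t) (free_m Psi t).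
Definition free_rhs_m Psi t := Nlin lam (PV (free_p Psi t) (free_m Psi t)) (free_m Psi t) (free_p Psi t).

Lemma scale_entry (a : R[i]) (u : 'cV[R[i]]_2) (i : 'I_2) : (a *: u) i 0 = a * u i 0.
Proof. by rewrite mxE. Qed.

Lemma scale_vec2D0 (k a b c d : R[i]) : (k *: (vec2 a b + vec2 c d)) 0 0 = k * (a + c).
Proof. by rewrite !mxE. Qed.

Lemma scale_vec2D1 (k a b c d : R[i]) : (k *: (vec2 a b + vec2 c d)) 1 0 = k * (b + d).
Proof. by rewrite !mxE. Qed.

Lemma I1_0 tau Psi y (f g : R -> R[i]) :
  comp1 (mx_act (beta *m Pi_minus) Psi) = f -> comp1 (mx_act (beta *m Pi_plus) Psi) = g ->
  I1 tau Psi y 0 0 = tau%:C * (phi1_dx (2 * tau) f y + phi1_dx (- (2 * tau)) g y).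
Proof.
move=> <- <-.
exact: (scale_vec2D0 tau%:C (phi1_dx (2 * tau) (comp1 (mx_act (beta *m Pi_minus) Psi)) y)
  (phi1_dx (2 * tau) (comp2 (mx_act (beta *m Pi_minus) Psi)) y)
  (phi1_dx (- (2 * tau)) (comp1 (mx_act (beta *m Pi_plus) Psi)) y)
  (phi1_dx (- (2 * tau)) (comp2 (mx_act (beta *m Pi_plus) Psi)) y)).
Qed.

Lemma I1_1 tau Psi y (f g : R -> R[i]) :
  comp2 (mx_act (beta *m Pi_minus) Psi) = f -> comp2 (mx_act (beta *m Pi_plus) Psi) = g ->
  I1 tau Psi y 1 0 = tau%:C * (phi1_dx (2 * tau) f y + phi1_dx (- (2 * tau)) g y).
Proof.
move=> <- <-.
exact: (scale_vec2D1 tau%:C (phi1_dx (2 * tau) (comp1 (mx_act (beta *m Pi_minus) Psi)) y)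
  (phi1_dx (2 * tau) (comp2 (mx_act (beta *m Pi_minus) Psi)) y)
  (phi1_dx (- (2 * tau)) (comp1 (mx_act (beta *m Pi_plus) Psi)) y)
  (phi1_dx (- (2 * tau)) (comp2 (mx_act (beta *m Pi_plus) Psi)) y)).
Qed.

(** In characteristic components the matrix beta exchanges p and m, and
    following the other wave doubles the relative speed: hence phi_1(+-2 tau
    d_x). *)
Lemma I1_pm tau b Psi y : 0 < tau -> W b (phi_p Psi) -> W b (phi_m Psi) ->
  phi_p (I1 tau Psi) y = cintegral (Icc 0 tau) (fun t => phi_m Psi (y + 2 * t)) /\
  phi_m (I1 tau Psi) y = cintegral (Icc 0 tau) (fun t => phi_p Psi (y + (-2) * t)).
Proof.
move=> tau0 hp hm.
have ez (a : R[i]) k f z : W b f -> phi1_dx k (fun z => a * f z) z = a * phi1_dx k f z.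
  move=> hf; apply: (fmultZ hr a (K := 2) _ _ _ hf) => // l; exact: normc_phi1.
have bm_ u : beta *m Pi_minus *m Psi u = vec2 (2^-1 * phi_m Psi u) (2^-1 * phi_m Psi u).
  rewrite -mulmxA -/(mx_act Pi_minus Psi u) Pi_minus_comp beta_comp vec2_0 vec2_1.
  by rewrite mulNr opprK.
have bp_ u : beta *m Pi_plus *m Psi u = vec2 (2^-1 * phi_p Psi u) (- 2^-1 * phi_p Psi u).
  rewrite -mulmxA -/(mx_act Pi_plus Psi u) Pi_plus_comp beta_comp vec2_0 vec2_1.
  by rewrite mulNr.
have c1 : comp1 (mx_act (beta *m Pi_minus) Psi) = fun z => 2^-1 * phi_m Psi z.
  by apply/funext => z; rewrite /comp1 /mx_act bm_ vec2_0.
have c2 : comp2 (mx_act (beta *m Pi_minus) Psi) = fun z => 2^-1 * phi_m Psi z.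
  by apply/funext => z; rewrite /comp2 /mx_act bm_ vec2_1.
have c3 : comp1 (mx_act (beta *m Pi_plus) Psi) = fun z => 2^-1 * phi_p Psi z.
  by apply/funext => z; rewrite /comp1 /mx_act bp_ vec2_0.
have c4 : comp2 (mx_act (beta *m Pi_plus) Psi) = fun z => - 2^-1 * phi_p Psi z.
  by apply/funext => z; rewrite /comp2 /mx_act bp_ vec2_1.
have e0 : I1 tau Psi y 0 0 = tau%:C * (2^-1 * phi1_dx (2 * tau) (phi_m Psi) y
    + 2^-1 * phi1_dx (- (2 * tau)) (phi_p Psi) y).
  rewrite (I1_0 _ _ c1 c3).
  by rewrite (ez 2^-1 _ _ y hm) (ez 2^-1 _ _ y hp).
have e1 : I1 tau Psi y 1 0 = tau%:C * (2^-1 * phi1_dx (2 * tau) (phi_m Psi) y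
    + - 2^-1 * phi1_dx (- (2 * tau)) (phi_p Psi) y).
  rewrite (I1_1 _ _ c2 c4).
  by rewrite (ez 2^-1 _ _ y hm) (ez (- 2^-1) _ _ y hp).
rewrite -(phi1_dx_integral hr 2 y tau0 hm) -(phi1_dx_integral hr (-2) y tau0 hp).
rewrite mulNr; move: e0 e1; move: (phi1_dx _ _ y) (phi1_dx _ _ y) => X Y.
by rewrite {1}/phi_p {1}/phi_m /comp1 /comp2 => -> ->; split; field.
Qed.

(** On the characteristic of p the component p is frozen and only m moves,
    with relative speed 2. *)
Lemma I3_pm tau b Psi y : 0 < tau -> W b (phi_p Psi) -> W b (phi_m Psi) ->
  let p := phi_p Psi in let m := phi_m Psi in
  phi_p (I3 lam tau Psi) y = (lam / 2)%:C *
    (Num.conj (p y) * cintegral (Icc 0 tau) (fun t => m (y + 2 * t) * m (y + 2 * t)) +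
     p y * cintegral (Icc 0 tau) (fun t => m (y + 2 * t) * Num.conj (m (y + 2 * t)))) /\
  phi_m (I3 lam tau Psi) y = (lam / 2)%:C *
    (m y * cintegral (Icc 0 tau) (fun t => p (y + (-2) * t) * Num.conj (p (y + (-2) * t))) +
     Num.conj (m y) * cintegral (Icc 0 tau) (fun t => p (y + (-2) * t) * p (y + (-2) * t))).
Proof.
move=> tau0 hp hm p m.
have sc (a : R[i]) (u : 'cV[R[i]]_2) (i : 'I_2) : (a *: u) i 0 = a * u i 0 by rewrite mxE.
have sqE f : (fun y : R => f y ^+ 2) = (fun y => f y * f y) :> (R -> R[i]).
  by apply/funext => z; rewrite expr2.
have nE f : (fun y : R => `|f y| ^+ 2) = (fun y => f y * Num.conj (f y)) :> (R -> R[i]).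
  by apply/funext => z; rewrite normCK.
have WMc f : W b f -> W (algcst r * b * b) (fun y => f y * Num.conj (f y)).
  by move=> hf; apply: WM => //; exact: (WC_W hr (WC_conj hf)).
rewrite -(phi1_dx_integral hr 2 y tau0 (WM hr hm hm)).
rewrite -(phi1_dx_integral hr 2 y tau0 (WMc _ hm)).
rewrite -(phi1_dx_integral hr (-2) y tau0 (WM hr hp hp)).
rewrite -(phi1_dx_integral hr (-2) y tau0 (WMc _ hp)) mulNr.
have e0 : I3 lam tau Psi y 0 0 = (tau * lam / 4)%:C * _ := etrans (sc _ _ _) (congr1 _ (vec2_0 _ _)).
have e1 : I3 lam tau Psi y 1 0 = (tau * lam / 4)%:C * _ := etrans (sc _ _ _) (congr1 _ (vec2_1 _ _)).
rewrite -/p -/m !sqE !nE in e0 e1.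
rewrite /phi_p /phi_m /comp1 /comp2 e0 e1 !(rmorphM, fmorphV, rmorph_nat) /=.
move: (phi1_dx _ _ y) (phi1_dx _ _ y) (phi1_dx _ _ y) (phi1_dx _ _ y) => X Y Z T.
have four : (4 : R[i]) != 0 by rewrite pnatr_eq0.
by split; field.
Qed.

Lemma cintegral_combine (a b : R) (M V u w : R -> R[i]) (z k k1 k2 : R[i]) :
  bmfun (Icc a b) M -> bmfun (Icc a b) V -> bmfun (Icc a b) u -> bmfun (Icc a b) w ->
  cintegral (Icc a b) M + cintegral (Icc a b) (fun t => V t * z) +
    k * (k1 * cintegral (Icc a b) u + k2 * cintegral (Icc a b) w) =
  cintegral (Icc a b) (fun t => M t + V t * z + k * (k1 * u t + k2 * w t)).
Proof.
move=> hM hV hu hw.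
rewrite [RHS]cintegralD; [|by solve_bm..].
rewrite [X in _ = X + _]cintegralD; [|by solve_bm..].
rewrite [X in _ = _ + X]cintegralZ; last by solve_bm.
by rewrite [X in _ = _ + _ * X]cintegralD ?cintegralZ //; solve_bm.
Qed.

(** The sum of the three terms of the scheme is the integral over the time
    step of the full right-hand side, evaluated on the free wave and followed
    along characteristics. *)
Lemma uli_rhs_pm tau b Psi y : 0 < tau -> W b (phi_p Psi) -> W b (phi_m Psi) ->
  let S := fun y => I1 tau Psi y + J tau Psi y + I3 lam tau Psi y in
  phi_p S y = cintegral (Icc 0 tau) (fun t => free_rhs_p Psi t (y + (0 + 1 * t))) /\
  phi_m S y = cintegral (Icc 0 tau) (fun t => free_rhs_m Psi t (y + (0 + (-1) * t))).
Proof.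
move=> tau0 hp hm S; have t0 := ltW tau0.
have [a1 a2] := I1_pm y tau0 hp hm.
have [b1 b2] := pot_step pot tau0 hp hm y.
have [c1 c2] := I3_pm y tau0 hp hm.
have ep : phi_p S y = phi_p (I1 tau Psi) y + phi_p (J tau Psi) y + phi_p (I3 lam tau Psi) y.
  exact: phi_pD3.
have em : phi_m S y = phi_m (I1 tau Psi) y + phi_m (J tau Psi) y + phi_m (I3 lam tau Psi) y.
  exact: phi_mD3.
have mD : measurable (Icc 0 tau : set R) by exact: measurable_itv.
have famP : fam tau (free_p Psi) (fun=> b) by exact: fam_translate.
have famQ : fam tau (free_m Psi) (fun=> b) by exact: fam_translate.
have famV := pot_fam pot t0 famP famQ.
have bmV (k : R) : bmfun (Icc 0 tau) (fun t => PV (free_p Psi t) (free_m Psi t) (y + (0 + k * t))).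
  exact: (fam_point hr y (fam_shift hr 0 k famV)).
have bmJ f : bmfun (Icc 0 tau) f -> bmfun (Icc 0 tau) (fun t => Num.conj (f t)).
  move=> [mf [B bf]]; split; first exact: cmfunJ.
  by exists B => t ht; rewrite normc_conj; exact: bf.
have bp : bmfun (Icc 0 tau) (fun t => phi_p Psi (y + (-2) * t)) := W_line_bm hr _ y mD hp.
have bm : bmfun (Icc 0 tau) (fun t => phi_m Psi (y + 2 * t)) := W_line_bm hr _ y mD hm.
have bpJ := bmJ _ bp; have bmJ' := bmJ _ bm.
have bV1 := bmV 1; have bV2 := bmV (-1).
split.
- rewrite ep a1 b1 c1.
  apply: etrans (cintegral_combine _ _ _ _ bm bV1 (bmfunM bm bm) (bmfunM bm bmJ')) _.
  apply: eq_cintegral => t _; rewrite /free_rhs_p /Nlin /free_p /free_m.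
  have -> : y + (0 + 1 * t) + (0 + 1 * t) = y + 2 * t by ring.
  have -> : y + (0 + 1 * t) + (0 + -1 * t) = y by ring.
  ring.
- rewrite em a2 b2 c2.
  apply: etrans (cintegral_combine _ _ _ _ bp bV2 (bmfunM bp bpJ) (bmfunM bp bp)) _.
  apply: eq_cintegral => t _; rewrite /free_rhs_m /Nlin /free_p /free_m.
  have -> : y + (0 + -1 * t) + (0 + -1 * t) = y + (-2) * t by ring.
  have -> : y + (0 + -1 * t) + (0 + 1 * t) = y by ring.
  ring.
Qed.

(** One step of the scheme is Duhamel's formula with the solution replaced
    by the free wave with the same initial value inside the integral. This
    exactness is what makes the scheme converge without loss of derivatives. *)
Lemma uli_step_pm tau b Psi x : 0 < tau -> W b (phi_p Psi) -> W b (phi_m Psi) ->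
  phi_p (uli_step lam tau (J tau) Psi) x = phi_p Psi (x - tau)
    - 'i%C * cintegral (Icc 0 tau) (fun t => free_rhs_p Psi t (x + (- tau + 1 * t))) /\
  phi_m (uli_step lam tau (J tau) Psi) x = phi_m Psi (x + tau)
    - 'i%C * cintegral (Icc 0 tau) (fun t => free_rhs_m Psi t (x + (tau + (-1) * t))).
Proof.
move=> tau0 hp hm; have t0 := ltW tau0.
set S := fun y => I1 tau Psi y + J tau Psi y + I3 lam tau Psi y.
have famP : fam tau (free_p Psi) (fun=> b) by exact: fam_translate.
have famQ : fam tau (free_m Psi) (fun=> b) by exact: fam_translate.
have famV := pot_fam pot t0 famP famQ.
have fGp := fam_Nlin hr lam famV famP famQ.
have fGm := fam_Nlin hr lam famV famQ famP.
have hSp : W (tau * Nbound r lam (KV b) b) (phi_p S).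
  apply: (WC_W hr (WC_ext _ (fam_integral hr t0 (fam_shift hr 0 1 fGp)))) => y.
  by rewrite (uli_rhs_pm y tau0 hp hm).1.
have hSm : W (tau * Nbound r lam (KV b) b) (phi_m S).
  apply: (WC_W hr (WC_ext _ (fam_integral hr t0 (fam_shift hr 0 (-1) fGm)))) => y.
  by rewrite (uli_rhs_pm y tau0 hp hm).2.
have [f1 f2] := flow_pm hr (- tau) x hp hm.
have [g1 g2] := flow_pm hr (- tau) x hSp hSm.
have lp := phi_pB_scale (flow (- tau) Psi) (flow (- tau) S) 'i%C x.
have lm := phi_mB_scale (flow (- tau) Psi) (flow (- tau) S) 'i%C x.
have [e1 _] := uli_rhs_pm (x - tau) tau0 hp hm.
have [_ e2] := uli_rhs_pm (x + tau) tau0 hp hm.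
rewrite -/S in e1 e2.
rewrite opprK in f2 g2.
have L (A A' B B' : R[i]) : A = A' -> B = B' -> A - 'i%C * B = A' - 'i%C * B'.
  by move=> -> ->.
split.
- apply: etrans lp (L _ _ _ _ f1 (etrans g1 (etrans e1 _))).
  by apply: eq_cintegral => t _; have -> : x + (- tau + 1 * t) = x - tau + (0 + 1 * t) by ring.
- apply: etrans lm (L _ _ _ _ f2 (etrans g2 (etrans e2 _))).
  by apply: eq_cintegral => t _; have -> : x + (tau + -1 * t) = x + tau + (0 + -1 * t) by ring.
Qed.

End Step.

(** * The exact solution and the local error *)

Section ExactSolution.
Context {R : realType} (r : R) (hr : 2^-1 < r) (lam T : R) (hT : 0 < T).
Variables (PV : (R -> R[i]) -> (R -> R[i]) -> R -> R[i])
  (J : R -> (R -> 'cV[R[i]]_2) -> R -> 'cV[R[i]]_2) (KV LV : R -> R).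
Hypothesis pot : potential r PV J KV LV.
Variables (V : R -> R -> R[i]) (Phi : R -> R -> 'cV[R[i]]_2).
Hypothesis sol : mild_solution lam T r V Phi.
Hypothesis VE : forall t, 0 <= t <= T -> V t = PV (phi_p (Phi t)) (phi_m (Phi t)).
Implicit Types (x s t b : R) (l : int).
Local Notation W := (W r).
Local Notation WC := (WC r).
Local Notation fam := (fam r).

Let half_ge0 : 0 <= 2^-1 :> R. Proof. by rewrite invr_ge0. Qed.
Let two : (2 : R[i]) != 0. Proof. by rewrite pnatr_eq0. Qed.

Lemma normc_half : normc (2^-1 : R[i]) = 2^-1 :> R.
Proof.
have -> : 2^-1 = (2^-1)%:C :> R[i] by rewrite fmorphV rmorph_nat.
by rewrite normcR ger0_norm.
Qed.

Lemma exp_dx0_WC b f : wnorm_le r (fourier f) b -> WC b (exp_dx 0 f) (fourier f).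
Proof.
move=> hf; apply: WC_ext (WC_series hr hf) => x.
rewrite /exp_dx fmultE; congr zseries; apply/funext => l.
by rewrite mul0r cexp_imag cis0 mul1r.
Qed.

(** At s = 0 Duhamel's formula says that Phi t is the sum of its Fourier
    series, so that a finite H^r norm puts its components in a ball. *)
Lemma mild_W t b : 0 <= t <= T -> 0 <= b -> (Hr_norm r (Phi t) <= b%:E)%E ->
  W (2 * b) (phi_p (Phi t)) /\ W (2 * b) (phi_m (Phi t)).
Proof.
move=> /andP[t0 tT] b0 hb.
have [/(sobolev_norm_ge b0)[s1 n1] /(sobolev_norm_ge b0)[s2 n2]] := Hr_norm_comp_le b0 hb.
have D x (i : 'I_2) : Phi t x i 0 = flow 0 (Phi t) x i 0.
  have := mild_duhamel sol x t0 (lexx 0).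
  rewrite addr0 oppr0 => /(_ tT) ->.
  by rewrite mxE [X in _ + X]mxE scale_entry mxE cintegral_pt mulr0 subr0.
set p := phi_p (Phi t); set m := phi_m (Phi t).
(* the matrices Pi_plus and Pi_minus take half-sums of components; their
   coefficients are those of the components by linearity *)
have c1 : comp1 (mx_act Pi_plus (Phi t)) =
    fun z => 2^-1 * comp1 (Phi t) z + 2^-1 * comp2 (Phi t) z.
  by apply/funext => z; rewrite /comp1 Pi_plus_comp vec2_0 -mulrDr.
have c2 : comp2 (mx_act Pi_plus (Phi t)) =
    fun z => 2^-1 * comp1 (Phi t) z + 2^-1 * comp2 (Phi t) z.
  by apply/funext => z; rewrite /comp2 Pi_plus_comp vec2_1 -mulrDr.
have c3 : comp1 (mx_act Pi_minus (Phi t)) =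
    fun z => 2^-1 * comp1 (Phi t) z + (- 2^-1) * comp2 (Phi t) z.
  by apply/funext => z; rewrite /comp1 Pi_minus_comp vec2_0 /phi_m mulrBr mulNr.
have c4 : comp2 (mx_act Pi_minus (Phi t)) =
    fun z => (- 2^-1) * comp1 (Phi t) z + 2^-1 * comp2 (Phi t) z.
  by apply/funext => z; rewrite /comp2 Pi_minus_comp vec2_1 /phi_m /comp1 /comp2; ring.
have nl (e1 e2 : R[i]) : normc e1 = 2^-1 -> normc e2 = 2^-1 ->
    WC b (exp_dx 0 (fun z => e1 * comp1 (Phi t) z + e2 * comp2 (Phi t) z))
      (fun l => e1 * fourier (comp1 (Phi t)) l + e2 * fourier (comp2 (Phi t)) l).
  move=> h1 h2.
  have e : fourier (fun z => e1 * comp1 (Phi t) z + e2 * comp2 (Phi t) z) =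
      (fun l => e1 * fourier (comp1 (Phi t)) l + e2 * fourier (comp2 (Phi t)) l).
    by apply/funext => l; exact: fourier_lin.
  rewrite -e; apply: exp_dx0_WC; rewrite e.
  have -> : b = 2^-1 * b + 2^-1 * b by field.
  by apply: wnorm_D; apply: wnorm_M => //; rewrite ?h1 ?h2.
have nh : normc (- 2^-1 : R[i]) = 2^-1 :> R by rewrite normcN normc_half.
have X := nl _ _ normc_half normc_half.
have Y := nl _ _ normc_half nh.
have Y' := nl _ _ nh normc_half.
have f0 x : Phi t x 0 0 = exp_dx 0 (fun z => 2^-1 * comp1 (Phi t) z + 2^-1 * comp2 (Phi t) z) x
    + exp_dx 0 (fun z => 2^-1 * comp1 (Phi t) z + (- 2^-1) * comp2 (Phi t) z) x.
  by rewrite D flow_0 oppr0 c1 c3.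
have f1 x : Phi t x 1 0 = exp_dx 0 (fun z => 2^-1 * comp1 (Phi t) z + 2^-1 * comp2 (Phi t) z) x
    + exp_dx 0 (fun z => (- 2^-1) * comp1 (Phi t) z + 2^-1 * comp2 (Phi t) z) x.
  by rewrite D flow_1 oppr0 c2 c4.
have YY x : exp_dx 0 (fun z => (- 2^-1) * comp1 (Phi t) z + 2^-1 * comp2 (Phi t) z) x =
    - exp_dx 0 (fun z => 2^-1 * comp1 (Phi t) z + (- 2^-1) * comp2 (Phi t) z) x.
  apply: (WC_uniq hr Y' (WC_coef_ext _ (WCN Y))) => l; ring.
have n2' : normc (2 : R[i]) = 2 :> R.
  by rewrite -(rmorph_nat (real_complex R)) normcR ger0_norm.
have {}f1 x : Phi t x 1 0 = exp_dx 0 (fun z => 2^-1 * comp1 (Phi t) z + 2^-1 * comp2 (Phi t) z) x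
    - exp_dx 0 (fun z => 2^-1 * comp1 (Phi t) z + (- 2^-1) * comp2 (Phi t) z) x.
  by rewrite f1 YY.
clear YY Y' nl c1 c2 c3 c4 D; move: f0 f1 X Y; move: (exp_dx 0 _) (exp_dx 0 _) => A B f0 f1 X Y.
split.
- apply: (WC_W hr); rewrite -n2'; apply: WC_ext (WCZ 2 X) => x.
  by rewrite /p /phi_p /comp1 /comp2 f0 f1; ring.
- apply: (WC_W hr); rewrite -n2'; apply: WC_ext (WCZ 2 Y) => x.
  by rewrite /m /phi_m /comp1 /comp2 f0 f1; ring.
Qed.

(** The actual radius at time t, known only to be finite for each t. *)
Definition mild_radius t : R := 2 * fine (Hr_norm r (Phi t)).

Lemma mild_ball t : 0 <= t <= T -> W (mild_radius t) (phi_p (Phi t)) /\ W (mild_radius t) (phi_m (Phi t)).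
Proof.
move=> ht; have h0 : (0 <= Hr_norm r (Phi t))%E by exact: sqrte_ge0.
apply: mild_W => //; first by rewrite fine_ge0.
by rewrite fineK // ge0_fin_numE // (mild_Hr sol).
Qed.

Lemma mild_coef_meas l :
  cmfun (Icc 0 T) (fun t => fourier (phi_p (Phi t)) l) /\
  cmfun (Icc 0 T) (fun t => fourier (phi_m (Phi t)) l).
Proof.
have hc (i : 'I_2) : cmfun (Icc 0 T) (fun t => fourier (fun x => Phi t x i 0) l).
  have [mr mi] := mild_measurable sol l i.
  by split; [exact: measurable_fun_itv_cc mr|exact: measurable_fun_itv_cc mi].
have sq t : 0 <= t <= T -> square_integrable (comp1 (Phi t)) /\ square_integrable (comp2 (Phi t)).
  move=> ht; have h0 : (0 <= Hr_norm r (Phi t))%E by exact: sqrte_ge0.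
  have hb : (Hr_norm r (Phi t) <= (fine (Hr_norm r (Phi t)))%:E)%E.
    by rewrite fineK // ge0_fin_numE // (mild_Hr sol).
  have b0 : 0 <= fine (Hr_norm r (Phi t)) by rewrite fine_ge0.
  by have [/(sobolev_norm_ge b0)[? _] /(sobolev_norm_ge b0)[? _]] := Hr_norm_comp_le b0 hb.
split.
- apply: cmfun_ext (cmfunD (hc 0) (hc 1)) => t; rewrite /= in_itv /= => ht.
  have [s1 s2] := sq t ht; rewrite -[X in X + _]mul1r -[X in _ + X]mul1r.
  rewrite -fourier_lin //; apply: eq_fourier => x; by rewrite !mul1r.
- apply: cmfun_ext (cmfunD (hc 0) (cmfunN (hc 1))) => t; rewrite /= in_itv /= => ht.
  have [s1 s2] := sq t ht; rewrite -[X in X + _]mul1r -[X in _ + X]mulN1r.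
  rewrite -fourier_lin //; apply: eq_fourier => x; by rewrite mul1r mulN1r.
Qed.

Section Window.
Variables (t s : R).
Hypotheses (t0 : 0 <= t) (s0 : 0 <= s) (tsT : t + s <= T).

Definition window_p rho := phi_p (Phi (t + rho)).
Definition window_m rho := phi_m (Phi (t + rho)).

Lemma window_itv rho : Icc 0 s rho -> 0 <= t + rho <= T.
Proof. rewrite /= in_itv /= => /andP[h1 h2].
by rewrite addr_ge0 //= (le_trans _ tsT) // lerD2l. Qed.

Lemma window_fam (b : R -> R) :
  (forall rho, Icc 0 s rho -> W (b rho) (window_p rho) /\ W (b rho) (window_m rho)) ->
  fam s window_p b /\ fam s window_m b.
Proof.
move=> hb; have hline : measurable_fun (Icc 0 s) (fun rho => t + rho).
  by apply: measurable_funD.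
split; split.
- by move=> rho /hb [].
- move=> l; apply: (cmfun_comp (E := Icc 0 T) (measurable_itv _) _ (mild_coef_meas l).1 hline).
  by move=> rho /window_itv; rewrite /= in_itv.
- by move=> rho /hb [].
- move=> l; apply: (cmfun_comp (E := Icc 0 T) (measurable_itv _) _ (mild_coef_meas l).2 hline).
  by move=> rho /window_itv; rewrite /= in_itv.
Qed.

Definition window_rhs_p rho := Nlin lam (PV (window_p rho) (window_m rho)) (window_p rho) (window_m rho).
Definition window_rhs_m rho := Nlin lam (PV (window_p rho) (window_m rho)) (window_m rho) (window_p rho).

Lemma window_rhs_fam (b : R -> R) : fam s window_p b -> fam s window_m b ->
  fam s window_rhs_p (fun rho => Nbound r lam (KV (b rho)) (b rho)) /\
  fam s window_rhs_m (fun rho => Nbound r lam (KV (b rho)) (b rho)).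
Proof.
move=> hP hM; have hV := pot_fam pot s0 hP hM.
by split; [exact: (fam_Nlin hr lam hV hP hM)|exact: (fam_Nlin hr lam hV hM hP)].
Qed.

(** Duhamel's formula in characteristic components. The integrands may be
    replaced by bounded ones that agree with them almost everywhere, which is
    how an essential bound in time is exploited. *)
Lemma duhamel_pm (N : set R) (GP GM : R -> R -> R[i]) (k : R) x :
  measurable N -> lebesgue_measure N = 0%E ->
  fam s GP (fun=> k) -> fam s GM (fun=> k) ->
  (forall rho, Icc 0 s rho -> ~ N rho -> GP rho = window_rhs_p rho /\ GM rho = window_rhs_m rho) ->
  phi_p (Phi (t + s)) x = phi_p (Phi t) (x - s)
     - 'i%C * cintegral (Icc 0 s) (fun rho => GP rho (x + (- s + 1 * rho))) /\
  phi_m (Phi (t + s)) x = phi_m (Phi t) (x + s)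
     - 'i%C * cintegral (Icc 0 s) (fun rho => GM rho (x + (s + (-1) * rho))).
Proof.
move=> mN N0 hGP hGM hG.
have tT : 0 <= t <= T by apply/andP; split=> //; move: s0 tsT; lra.
have [FP FM] := window_fam (fun rho h => mild_ball (window_itv h)).
have [FGP FGM] := window_rhs_fam FP FM.
set rhs := fun rho => dirac_rhs lam (V (t + rho)) (Phi (t + rho)).
have rhsE rho : Icc 0 s rho -> phi_p (rhs rho) = window_rhs_p rho /\ phi_m (rhs rho) = window_rhs_m rho.
  move=> h; have hV := VE (window_itv h).
  by split; apply/funext => y; rewrite /rhs hV;
    have [e1 e2] := dirac_rhs_pm lam (PV (window_p rho) (window_m rho)) (Phi (t + rho)) y.
have fl rho : Icc 0 s rho ->
    phi_p (flow (- (s - rho)) (rhs rho)) x = window_rhs_p rho (x + (- s + 1 * rho)) /\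
    phi_m (flow (- (s - rho)) (rhs rho)) x = window_rhs_m rho (x + (s + (-1) * rho)).
  move=> h; have [e1 e2] := rhsE rho h.
  have w1 := FGP.1 rho h; have w2 := FGM.1 rho h.
  rewrite -e1 in w1; rewrite -e2 in w2.
  have [-> ->] := flow_pm hr (- (s - rho)) x w1 w2.
  rewrite e1 e2; have -> : x + (- s + 1 * rho) = x - (s - rho) by ring.
  by have -> : x + (s + -1 * rho) = x - - (s - rho) by ring.
have bP := fam_point hr x (fam_shift hr (- s) 1 hGP).
have bM := fam_point hr x (fam_shift hr s (-1) hGM).
have mP := fam_point_meas hr x (fam_shift hr (- s) 1 FGP).
have mM := fam_point_meas hr x (fam_shift hr s (-1) FGM).
set a := fun rho => GP rho (x + (- s + 1 * rho)).
set c := fun rho => GM rho (x + (s + (-1) * rho)).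
have half (i : 'I_2) (e : R[i]) :
    (forall u : 'cV[R[i]]_2, u i 0 = 2^-1 * (u 0 0 + u 1 0) + e * (u 0 0 - u 1 0)) ->
    cintegral (Icc 0 s) (fun rho => flow (- (s - rho)) (rhs rho) x i 0) =
    2^-1 * cintegral (Icc 0 s) a + e * cintegral (Icc 0 s) c.
  move=> hu.
  have -> : cintegral (Icc 0 s) (fun rho => flow (- (s - rho)) (rhs rho) x i 0) =
     cintegral (Icc 0 s) (fun rho => 2^-1 * window_rhs_p rho (x + (- s + 1 * rho))
        + e * window_rhs_m rho (x + (s + (-1) * rho))).
    apply: eq_cintegral => rho h; rewrite (hu (flow _ _ x)).
    by have [<- <-] := fl rho h.
  rewrite -cintegralZ // -cintegralZ // -cintegralD; [|by solve_bm..].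
  apply: (cintegral_ae (measurable_itv _) mN N0).
  - by apply: cmfunD; apply: cmfunM => //; exact: cmfun_cst.
  - by apply: cmfunD; apply: cmfunM; [exact: cmfun_cst|exact: bP.1|exact: cmfun_cst|exact: bM.1].
  - by move=> rho h nN; rewrite /a /c; have [-> ->] := hG rho h nN.
have h0 := half 0 2^-1; have h1 := half 1 (- 2^-1).
have {}h0 := h0 ltac:(by move=> u; field).
have {}h1 := h1 ltac:(by move=> u; field).
have D (i : 'I_2) : Phi (t + s) x i 0 = flow (- s) (Phi t) x i 0 -
    'i%C * cintegral (Icc 0 s) (fun rho => flow (- (s - rho)) (rhs rho) x i 0).
  by rewrite (mild_duhamel sol x t0 s0 tsT) mxE [X in _ + X]mxE scale_entry mxE.
have [w1 w2] := mild_ball tT.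
have [f1 f2] := flow_pm hr (- s) x w1 w2.
rewrite opprK in f2; rewrite -f1 -f2 /phi_p /phi_m /comp1 /comp2.
rewrite (D 0) (D 1) h0 h1; move: (cintegral _ a) (cintegral _ c) => A C.
by split; field.
Qed.

End Window.

Local Notation Kc b := (Nbound r lam (KV b) b).

Lemma Nlin_W a p m : W a p -> W a m ->
  W (Kc a) (Nlin lam (PV p m) p m) /\ W (Kc a) (Nlin lam (PV p m) m p).
Proof.
move=> hp hm; have h0 : Icc (0 : R) 0 0 by rewrite /= in_itv /= lexx.
have fp0 := fam_const 0 hp; have fm0 := fam_const 0 hm.
have hV := pot_fam pot (lexx 0) fp0 fm0.
split; first exact: (fam_Nlin hr lam hV fp0 fm0).1 0 h0.
exact: (fam_Nlin hr lam hV fm0 fp0).1 0 h0.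
Qed.

(** Setting a family to 0 on a null set of times turns an almost everywhere
    bound into an everywhere bound. *)
Lemma fam_mask (s k : R) (N : set R) G (b : R -> R) : measurable N -> 0 <= k ->
  fam s G b -> (forall rho, Icc 0 s rho -> ~ N rho -> W k (G rho)) ->
  fam s (fun rho => if rho \in N then (fun=> 0) else G rho) (fun=> k).
Proof.
move=> mN k0 [_ mG] hG; split.
  move=> rho h; case: ifPn => [_|]; first exact: (WC_W hr (WC_mono k0 (WC0 r))).
  by rewrite notin_setE => nN; exact: hG.
move=> l; apply: cmfun_ext (cmfunM (_ : cmfun _ (fun rho => (\1_(~` N) rho)%:C)) (mG l)).
  move=> rho _; rewrite indicE in_setC; case: (rho \in N) => /=; last by rewrite mul1r.
  by rewrite mul0r (WC_fourier hr l (WC0 r)).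
split=> /=; last exact: measurable_cst.
by apply: measurable_indic; exact: measurableC.
Qed.

(** An essential bound in time on the H^r norm gives a bound at every time:
    Duhamel's formula from time 0 to one good time bounds Phi 0, and from 0 to t
    it then bounds Phi t. Starting always at time 0 avoids translating the null
    set. *)
Lemma uniform_bound (M : R) : 0 <= M -> (Linfty_Hr_norm T r Phi <= M%:E)%E ->
  forall t, 0 <= t <= T ->
  W (2 * M + 2 * (T * Kc (2 * M))) (phi_p (Phi t)) /\
  W (2 * M + 2 * (T * Kc (2 * M))) (phi_m (Phi t)).
Proof.
move=> M0 /ess_supP [N0 [mN0 mu0 hN0]].
(* the essential supremum ranges over the open interval, so the end points
   are discarded too *)
set N := N0 `|` ([set 0] `|` [set T]).
have mN : measurable N by apply: measurableU => //; apply: measurableU; exact: measurable_set1.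
have muN : lebesgue_measure N = 0%E.
  have ng : lebesgue_measure.-negligible N.
    apply: negligibleU; first by exists N0; split.
    apply: negligibleU.
      by exists [set 0]; split=> //; exact: lebesgue_measure_set1.
    by exists [set T]; split=> //; exact: lebesgue_measure_set1.
  by apply/negligibleP.
have good t : 0 <= t <= T -> ~ N t ->
    W (2 * M) (phi_p (Phi t)) /\ W (2 * M) (phi_m (Phi t)).
  move=> ht nN; apply: (mild_W ht M0).
  have tin : (t \in `]0, T[%classic).
    rewrite inE /= in_itv /=; case/andP: ht => t0 tT; apply/andP; split.
      by rewrite lt_neqAle t0 andbT; apply/eqP => e; apply: nN; right; left.
    by rewrite lt_neqAle tT andbT; apply/eqP => e; apply: nN; right; right.
  have := contrapT (fun h => nN (or_introl (hN0 t h))).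
  by rewrite /= patchE tin.
have M20 : 0 <= 2 * M by rewrite mulr_ge0.
set k := Kc (2 * M).
have k0 : 0 <= k.
  have h0 : Icc (0 : R) 0 0 by rewrite /= in_itv /= lexx.
  have z := WC_W hr (WC_mono M20 (WC0 r)).
  exact: (WC_ge0 (Nlin_W z z).1).
(* Duhamel from time 0 to s: a free wave plus a term of norm at most s k *)
have D s : 0 <= s <= T -> exists fP fM : R -> R[i], [/\ W (s * k) fP, W (s * k) fM,
   (forall x, phi_p (Phi s) x = phi_p (Phi 0) (x - s) - 'i%C * fP (x - s)) &
   (forall x, phi_m (Phi s) x = phi_m (Phi 0) (x + s) - 'i%C * fM (x + s))].
  move=> /andP[s0 sT]; have s0T : 0 + s <= T by rewrite add0r.
  have [FP FM] := window_fam (lexx 0) s0T (fun rho h => mild_ball (window_itv (lexx 0) s0T h)).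
  have [FGP FGM] := window_rhs_fam s0 FP FM.
  have WG rho : Icc 0 s rho -> ~ N rho -> W k (window_rhs_p 0 rho) /\ W k (window_rhs_m 0 rho).
    move=> h nN; have ht := window_itv (lexx 0) s0T h.
    rewrite -[X in N X]add0r in nN; have [w1 w2] := good _ ht nN.
    exact: Nlin_W.
  have hP := fam_mask mN k0 FGP (fun rho h nN => (WG rho h nN).1).
  have hM := fam_mask mN k0 FGM (fun rho h nN => (WG rho h nN).2).
  have hE rho : Icc 0 s rho -> ~ N rho ->
      (if rho \in N then (fun=> 0) else window_rhs_p 0 rho) = window_rhs_p 0 rho /\
      (if rho \in N then (fun=> 0) else window_rhs_m 0 rho) = window_rhs_m 0 rho.
    by move=> _ nN; rewrite memNset.
  have dh x := duhamel_pm (lexx 0) s0 s0T x mN muN hP hM hE.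
  exists (fun z => cintegral (Icc 0 s) (fun rho =>
     (if rho \in N then (fun=> 0) else window_rhs_p 0 rho) (z + (0 + 1 * rho)))).
  exists (fun z => cintegral (Icc 0 s) (fun rho =>
     (if rho \in N then (fun=> 0) else window_rhs_m 0 rho) (z + (0 + (-1) * rho)))).
  split.
  - exact: (fam_integral hr s0 (fam_shift hr 0 1 hP)).
  - exact: (fam_integral hr s0 (fam_shift hr 0 (-1) hM)).
  - move=> x; have [e _] := dh x; rewrite add0r in e; rewrite e; congr (_ - _ * _).
    apply: eq_cintegral => rho _.
    by rewrite (_ : x - s + (0 + 1 * rho) = x + (- s + 1 * rho)) //; ring.
  - move=> x; have [_ e] := dh x; rewrite add0r in e; rewrite e; congr (_ - _ * _).
    apply: eq_cintegral => rho _.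
    by rewrite (_ : x + s + (0 + -1 * rho) = x + (s + -1 * rho)) //; ring.
(* a null set cannot contain [0, T] *)
have [t1 ht1 nt1] : exists2 t1, 0 <= t1 <= T & ~ N t1.
  apply: contrapT => hno.
  have sub : `[0, T]%classic `<=` N.
    move=> u; rewrite /= in_itv /= => hu; apply: contrapT => nu; apply: hno; by exists u.
  have ng : lebesgue_measure.-negligible (Icc 0 T) by exists N; split.
  have h : lebesgue_measure (Icc 0 T) = 0%E :> \bar R by apply/negligibleP.
  move: h; rewrite lebesgue_measure_itv /= lte_fin hT sube0 => -[] e.
  by move: hT; rewrite e ltxx.
have i1 : normc ('i%C : R[i]) = 1 by rewrite /= expr0n expr1n add0r sqrtr1.
have [gp gm] := good t1 ht1 nt1.
have W0 : W (2 * M + T * k) (phi_p (Phi 0)) /\ W (2 * M + T * k) (phi_m (Phi 0)).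
  have [fP [fM [wP wM eP eM]]] := D t1 ht1.
  have hk : 2 * M + t1 * k <= 2 * M + T * k.
    by rewrite lerD2l ler_wpM2r //; case/andP: ht1.
  have zP := WCZ 'i%C wP; have zM := WCZ 'i%C wM.
  rewrite i1 mul1r in zP; rewrite i1 mul1r in zM.
  split; apply: (WC_W hr); apply: WC_mono hk _.
  - apply: WC_ext (WCD (WC_shift t1 gp) zP) => x.
    by rewrite eP addrK subrK.
  - apply: WC_ext (WCD (WC_shift (- t1) gm) zM) => x.
    by rewrite eM subrK subrK.
move=> t ht; have [fP [fM [wP wM eP eM]]] := D t ht.
have zP := WCN (WCZ 'i%C (WC_shift (- t) wP)); have zM := WCN (WCZ 'i%C (WC_shift t wM)).
rewrite i1 mul1r in zP; rewrite i1 mul1r in zM.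
have hk : 2 * M + T * k + t * k <= 2 * M + 2 * (T * k).
  rewrite -addrA lerD2l mulrDl mul1r lerD2l ler_wpM2r //; by case/andP: ht.
split; apply: (WC_W hr); apply: WC_mono hk _.
- by apply: WC_ext (WCD (WC_shift (- t) W0.1) zP) => x; rewrite eP.
- by apply: WC_ext (WCD (WC_shift t W0.2) zM) => x; rewrite eM.
Qed.

Lemma exact_fam (t s A : R) : 0 <= t -> 0 <= s -> t + s <= T ->
  (forall u, 0 <= u <= T -> W A (phi_p (Phi u)) /\ W A (phi_m (Phi u))) ->
  fam s (window_p t) (fun=> A) /\ fam s (window_m t) (fun=> A).
Proof.
move=> t0 s0 ts hA; apply: (window_fam t0 ts) => rho h; apply: hA.
exact: (window_itv t0 ts h).
Qed.

(** The exact solution stays within O(s) of the free wave, in H^r itself: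
    the translations are isometries, so the difference is an integral of bounded
    terms over a time s. *)
Lemma free_flow_error (t s A : R) : 0 <= t -> 0 <= s -> t + s <= T ->
  (forall u, 0 <= u <= T -> W A (phi_p (Phi u)) /\ W A (phi_m (Phi u))) ->
  W (s * Kc A) (fun x => phi_p (Phi (t + s)) x - phi_p (Phi t) (x - s)) /\
  W (s * Kc A) (fun x => phi_m (Phi (t + s)) x - phi_m (Phi t) (x + s)).
Proof.
move=> t0 s0 ts hA; have [hP hM] := exact_fam t0 s0 ts hA.
have [hG1 hG2] := window_rhs_fam s0 hP hM.
have D x := duhamel_pm t0 s0 ts x (measurable0) (measure0 _) hG1 hG2
  (fun _ _ _ => conj erefl erefl).
have i1 : normc (- 'i%C : R[i]) = 1.
  by rewrite normcN /= expr0n expr1n add0r sqrtr1.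
have w1 := WCZ (- 'i%C) (fam_integral hr s0 (fam_shift hr (- s) 1 hG1)).
have w2 := WCZ (- 'i%C) (fam_integral hr s0 (fam_shift hr s (-1) hG2)).
rewrite i1 mul1r in w1; rewrite i1 mul1r in w2.
split; apply: (WC_W hr).
- by apply: WC_ext w1 => x; have [-> _] := D x; rewrite addrAC subrr add0r mulNr.
- by apply: WC_ext w2 => x; have [_ ->] := D x; rewrite addrAC subrr add0r mulNr.
Qed.

Local Notation Lc A := (Nlip r lam (KV A) A (LV A)).

(** Subtracting [uli_step_pm] from Duhamel's formula leaves the integral
    over the step of a difference of right-hand sides. By the Lipschitz bound
    the integrand is at most L times the distance between the exact solution and
    the numerical free wave, which is at most K tau (by [free_flow_error]) plus
    the error E already present. *)
Lemma error_step (t tau A E : R) (Psi : R -> 'cV[R[i]]_2) :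
  0 <= t -> 0 < tau -> t + tau <= T ->
  (forall u, 0 <= u <= T -> W A (phi_p (Phi u)) /\ W A (phi_m (Phi u))) ->
  W A (phi_p Psi) -> W A (phi_m Psi) ->
  W E (fun x => phi_p (Phi t) x - phi_p Psi x) ->
  W E (fun x => phi_m (Phi t) x - phi_m Psi x) ->
  let E' := E + tau * (Lc A * (tau * Kc A + E)) in
  W E' (fun x => phi_p (Phi (t + tau)) x - phi_p (uli_step lam tau (J tau) Psi) x) /\
  W E' (fun x => phi_m (Phi (t + tau)) x - phi_m (uli_step lam tau (J tau) Psi) x).
Proof.
move=> t0 tau0 ts hA hp hm ep em E'; have s0 := ltW tau0.
have [hP hM] := exact_fam t0 s0 ts hA.
have hP' : fam tau (free_p Psi) (fun=> A) by exact: fam_translate.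
have hM' : fam tau (free_m Psi) (fun=> A) by exact: fam_translate.
have K0 : 0 <= Kc A.
  have [hG _] := window_rhs_fam s0 hP hM.
  by apply: (WC_ge0 (hG.1 0 _)); rewrite /= in_itv /= lexx.
(* distance between the exact solution and the free wave issued from Psi *)
have err rho : Icc 0 tau rho ->
    W (tau * Kc A + E) (fun x => window_p t rho x - free_p Psi rho x) /\
    W (tau * Kc A + E) (fun x => window_m t rho x - free_m Psi rho x).
  rewrite /= in_itv /= => /andP[r0 rt].
  have tr : t + rho <= T by apply: le_trans ts; rewrite lerD2l.
  have [q1 q2] := free_flow_error t0 r0 tr hA.
  split; apply: (WC_W hr).
  - apply: WC_ext (WC_mono _ (WCD q1 (WC_shift (- rho) ep))).
      move=> x; rewrite /window_p /free_p (_ : x + (0 + -1 * rho) = x - rho); last by ring.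
      ring.
    by rewrite lerD2r ler_wpM2r.
  - apply: WC_ext (WC_mono _ (WCD q2 (WC_shift rho em))).
      move=> x; rewrite /window_m /free_m (_ : x + (0 + 1 * rho) = x + rho); last by ring.
      ring.
    by rewrite lerD2r ler_wpM2r.
have dP : fam tau (fun rho x => window_p t rho x - free_p Psi rho x) (fun=> tau * Kc A + E).
  by split; [move=> rho /err []|exact: (famB hr hP hP').2].
have dM : fam tau (fun rho x => window_m t rho x - free_m Psi rho x) (fun=> tau * Kc A + E).
  by split; [move=> rho /err []|exact: (famB hr hM hM').2].
have hV' := pot_fam pot s0 hP' hM'.
have dV := pot_lip pot s0 hP hM hP' hM' dP dM.
have dG1 := fam_Nlin_lip hr lam hV' dV hP hP' hM hM' dP dM.
have dG2 := fam_Nlin_lip hr lam hV' dV hM hM' hP hP' dM dP.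
have [hG1 hG2] := window_rhs_fam s0 hP hM.
have hG1' := fam_Nlin hr lam hV' hP' hM'.
have hG2' := fam_Nlin hr lam hV' hM' hP'.
have D x := duhamel_pm t0 s0 ts x (measurable0) (measure0 _) hG1 hG2
  (fun _ _ _ => conj erefl erefl).
have S x := uli_step_pm hr lam pot x tau0 hp hm.
have i1 : normc (- 'i%C : R[i]) = 1.
  by rewrite normcN /= expr0n expr1n add0r sqrtr1.
have w1 := WCZ (- 'i%C) (fam_integral hr s0 (fam_shift hr (- tau) 1 dG1)).
have w2 := WCZ (- 'i%C) (fam_integral hr s0 (fam_shift hr tau (-1) dG2)).
rewrite i1 mul1r in w1; rewrite i1 mul1r in w2.
split; apply: (WC_W hr).
- apply: WC_ext (WCD (WC_shift (- tau) ep) w1) => x.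
  have eP : cintegral (Icc 0 tau) (fun rho => window_rhs_p t rho (x + (- tau + 1 * rho)) -
      free_rhs_p lam PV Psi rho (x + (- tau + 1 * rho))) =
      cintegral (Icc 0 tau) (fun rho => window_rhs_p t rho (x + (- tau + 1 * rho))) -
      cintegral (Icc 0 tau) (fun rho => free_rhs_p lam PV Psi rho (x + (- tau + 1 * rho))).
    apply: cintegralB.
      exact: (fam_point hr x (fam_shift hr (- tau) 1 hG1)).
    exact: (fam_point hr x (fam_shift hr (- tau) 1 hG1')).
  apply: etrans (congr1 (fun z => phi_p (Phi t) (x - tau) - phi_p Psi (x - tau) +
    - 'i%C * z) eP) _.
  have [-> _] := D x; have [-> _] := S x; ring.
- apply: WC_ext (WCD (WC_shift tau em) w2) => x.
  have eM : cintegral (Icc 0 tau) (fun rho => window_rhs_m t rho (x + (tau + (-1) * rho)) -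
      free_rhs_m lam PV Psi rho (x + (tau + (-1) * rho))) =
      cintegral (Icc 0 tau) (fun rho => window_rhs_m t rho (x + (tau + (-1) * rho))) -
      cintegral (Icc 0 tau) (fun rho => free_rhs_m lam PV Psi rho (x + (tau + (-1) * rho))).
    apply: cintegralB.
      exact: (fam_point hr x (fam_shift hr tau (-1) hG2)).
    exact: (fam_point hr x (fam_shift hr tau (-1) hG2')).
  apply: etrans (congr1 (fun z => phi_m (Phi t) (x + tau) - phi_m Psi (x + tau) +
    - 'i%C * z) eM) _.
  have [_ ->] := D x; have [_ ->] := S x; ring.
Qed.

End ExactSolution.

(** * Accumulation of the errors *)

Section Convergence.
Context {R : realType} (r : R) (hr : 2^-1 < r) (lam T : R) (hT : 0 < T).
Variables (PV : (R -> R[i]) -> (R -> R[i]) -> R -> R[i])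
  (J : R -> (R -> 'cV[R[i]]_2) -> R -> 'cV[R[i]]_2) (KV LV : R -> R).
Hypothesis pot : potential r PV J KV LV.
Local Notation W := (W r).
Local Notation Kc b := (Nbound r lam (KV b) b).
Local Notation Lc A := (Nlip r lam (KV A) A (LV A)).

Lemma Kc_ge0 a : 0 <= a -> 0 <= Kc a.
Proof.
move=> a0; have [k0 _] := pot_cst_ge0 pot a0.
rewrite /Nbound; have := algcst_ge0 r; have := normc_ge0 ((lam / 2)%:C : R[i]).
move: (algcst r) (normc _) (KV a) k0 => K c k k0 c0 K0.
by repeat (first [assumption | apply: addr_ge0 | apply: mulr_ge0]).
Qed.

Lemma Lc_ge0 a : 0 <= a -> 0 <= Lc a.
Proof.
move=> a0; have [k0 v0] := pot_cst_ge0 pot a0.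
rewrite /Nlip; have := algcst_ge0 r; have := normc_ge0 ((lam / 2)%:C : R[i]).
have i0 : 0 <= 1 :> R by []. have i6 : 0 <= 6 :> R by [].
move: (algcst r) (normc _) (KV a) (LV a) k0 v0 => K c k v k0 v0 c0 K0.
by repeat (first [assumption | apply: addr_ge0 | apply: mulr_ge0]).
Qed.

(** The discrete Gronwall factor. *)
Lemma growth_bound (L tau : R) (n : nat) : 0 <= L -> 0 <= tau -> n%:R * tau <= T ->
  (1 + L * tau) ^+ n <= expR (L * T).
Proof.
move=> L0 t0 nT; apply: le_trans (_ : expR (L * tau) ^+ n <= _).
  apply: lerXn2r; rewrite ?nnegrE ?expR_ge0 ?expR_ge1Dx //.
  by rewrite addr_ge0 // mulr_ge0.
by rewrite -expRM_natl ler_expR mulrCA ler_wpM2l.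
Qed.

(** The recursion E_(n+1) = E_n + tau L (K tau + E_n), E_0 = 0, has the
    solution K tau ((1 + L tau)^n - 1) = O(tau). The constants K and L refer to
    a ball of radius larger by 1 than the one containing the exact solution, and
    the smallness of tau keeps the numerical solution inside it. *)
Theorem uli_convergence (M : R) : exists tau0 C : R, 0 < tau0 /\ 0 < C /\
  forall (V : R -> R -> R[i]) (Phi : R -> R -> 'cV[R[i]]_2),
    mild_solution lam T r V Phi ->
    (forall t, 0 <= t <= T -> V t = PV (phi_p (Phi t)) (phi_m (Phi t))) ->
    (Linfty_Hr_norm T r Phi <= M%:E)%E ->
    forall tau : R, 0 < tau <= tau0 ->
    forall n : nat, n%:R * tau <= T ->
      (Hr_norm r (fun x => (Phi (n%:R * tau) x -
         iter n (uli_step lam tau (J tau)) (Phi 0) x)%R) <= (C * tau)%:E)%E.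
Proof.
set M' := Num.max M 0; have M'0 : 0 <= M' by rewrite le_max lexx orbT.
have M20 : 0 <= 2 * M' by rewrite mulr_ge0.
set A0 := 2 * M' + 2 * (T * Kc (2 * M')).
have A00 : 0 <= A0.
  by rewrite addr_ge0 // mulr_ge0 // mulr_ge0 ?(ltW hT) // Kc_ge0.
set A := A0 + 1; have A10 : 0 <= A by rewrite addr_ge0.
have A0A : A0 <= A by rewrite lerDl.
have K0 := Kc_ge0 A10; have L0 := Lc_ge0 A10.
set K := Kc A in K0 *; set L := Lc A in L0 *.
set C1 := K * expR (L * T).
have C10 : 0 <= C1 by rewrite mulr_ge0 // expR_ge0.
have C11 : 0 < C1 + 1 by rewrite ltr_wpDl.
(* C1 tau bounds the error of the components; the step restriction makes it
   at most 1, the factor 2 passes from components to spinors, and the terms + 1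
   ensure positivity *)
exists (C1 + 1)^-1, (2 * C1 + 1); split; first by rewrite invr_gt0.
split; first by rewrite ltr_wpDl // mulr_ge0.
move=> V Phi sol VE hM tau /andP[tau0 htau].
have t_ge0 := ltW tau0.
have hM' : (Linfty_Hr_norm T r Phi <= M'%:E)%E.
  by apply: le_trans hM _; rewrite lee_fin le_max lexx.
have ub := uniform_bound hr hT pot sol VE M'0 hM'.
have ubA u : 0 <= u <= T -> W A (phi_p (Phi u)) /\ W A (phi_m (Phi u)).
  by move=> /ub[w1 w2]; split; [exact: WC_mono w1|exact: WC_mono w2].
pose E (n : nat) := K * tau * ((1 + L * tau) ^+ n - 1).
pose Y n := iter n (uli_step lam tau (J tau)) (Phi 0).
have EC n : n%:R * tau <= T -> E n <= C1 * tau.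
  move=> nT; rewrite /E /C1 mulrAC ler_wpM2r //.
  rewrite ler_wpM2l // lerBlDr; apply: le_trans (growth_bound L0 t_ge0 nT) _.
  by rewrite lerDl.
have E1 n : n%:R * tau <= T -> E n <= 1.
  move=> nT; apply: le_trans (EC n nT) _.
  apply: le_trans (_ : C1 * (C1 + 1)^-1 <= _); first by rewrite ler_wpM2l.
  by rewrite ler_pdivrMr // mul1r lerDl.
have claim n : n%:R * tau <= T ->
    W (E n) (fun x => phi_p (Phi (n%:R * tau)) x - phi_p (Y n) x) /\
    W (E n) (fun x => phi_m (Phi (n%:R * tau)) x - phi_m (Y n) x).
  elim: n => [|n IH] nT.
    rewrite mul0r /E expr0 subrr mulr0; split; apply: (WC_W hr);
      by apply: WC_ext (WC0 r) => x; rewrite subrr.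
  have tS : n.+1%:R * tau = n%:R * tau + tau by rewrite -natr1 mulrDl mul1r.
  have nT' : n%:R * tau <= T by apply: le_trans nT; rewrite tS lerDl.
  have [ep em] := IH nT'; have tn0 : 0 <= n%:R * tau by rewrite mulr_ge0.
  have tnT : 0 <= n%:R * tau <= T by rewrite tn0.
  have [b1 b2] := ub _ tnT.
  have hA : A0 + E n <= A by rewrite lerD2l E1.
  have yp : W A (phi_p (Y n)).
    apply: (WC_W hr); apply: WC_mono hA _; apply: WC_ext (WCD b1 (WCN ep)) => x; ring.
  have ym : W A (phi_m (Y n)).
    apply: (WC_W hr); apply: WC_mono hA _; apply: WC_ext (WCD b2 (WCN em)) => x; ring.
  have tT : n%:R * tau + tau <= T by rewrite -tS.
  have := error_step hr pot sol VE tn0 tau0 tT ubA yp ym ep em.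
  rewrite -/K -/L -tS; have -> : E n + tau * (L * (tau * K + E n)) = E n.+1.
    by rewrite /E exprS; ring.
  by [].
move=> n nT; have [cp cm] := claim n nT.
apply: le_trans (_ : ((2 * E n)%:E <= _)%E); last first.
  rewrite lee_fin; apply: le_trans (_ : 2 * (C1 * tau) <= _).
    by rewrite ler_wpM2l // EC.
  by rewrite mulrA ler_wpM2r // lerDl.
apply: Hr_norm_W => //.
- apply: (WC_W hr); apply: WC_ext cp => x.
  by rewrite /phi_p /comp1 /comp2 !mxE; ring.
- apply: (WC_W hr); apply: WC_ext cm => x.
  by rewrite /phi_m /comp1 /comp2 !mxE; ring.
Qed.

End Convergence.

(** * The Poisson potential *)

Section PoissonPotential.
Context {R : realType} (r : R) (hr : 2^-1 < r).
Local Notation W := (W r).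
Local Notation fam := (fam r).
Local Notation K := (algcst r).
Implicit Types (p m f : R -> R[i]) (Psi : R -> 'cV[R[i]]_2).

Let two : (2 : R[i]) != 0. Proof. by rewrite pnatr_eq0. Qed.

(** |phi_1|^2 + |phi_2|^2 in characteristic components. *)
Definition density p m : R -> R[i] :=
  fun y => 2^-1 * (p y * Num.conj (p y) + m y * Num.conj (m y)).

Definition poisson_pm p m : R -> R[i] := fun x => - dxx_inv (density p m) x.

Lemma poisson_potentialE Psi : poisson_potential Psi = poisson_pm (phi_p Psi) (phi_m Psi).
Proof.
apply/funext => x; rewrite /poisson_potential /poisson_pm; congr (- dxx_inv _ x).
apply/funext => y; rewrite /density !normCK /phi_p /phi_m !(rmorphD, rmorphN) /=.
by field.
Qed.

Lemma fam_density s P M (a : R -> R) : fam s P a -> fam s M a ->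
  fam s (fun t => density (P t) (M t))
    (fun t => normc (2^-1 : R[i]) * (K * a t * a t + K * a t * a t)).
Proof.
move=> hP hM.
exact: (famZ hr 2^-1 (famD hr (famM hr hP (fam_conj hr hP)) (famM hr hM (fam_conj hr hM)))).
Qed.

Lemma W_absq b f : W b f -> W (K * b * b) (fun y => f y * Num.conj (f y)).
Proof. by move=> hf; apply: (WM hr hf); exact: (WC_W hr (WC_conj hf)). Qed.

(** Along a free wave |p|^2 and |m|^2 are merely translated, and d_xx^{-1}
    commutes with translations. *)
Lemma poisson_pm_wave b p m (t y : R) : W b p -> W b m ->
  poisson_pm (fun x => p (x + (0 + (-1) * t))) (fun x => m (x + (0 + 1 * t))) y =
  - 2^-1 * (dxx_inv (fun z => p z * Num.conj (p z)) (y - t) +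
            dxx_inv (fun z => m z * Num.conj (m z)) (y + t)).
Proof.
move=> hp hm; have qp := W_absq hp; have qm := W_absq hm.
have sp := WC_W hr (WC_shift (0 + (-1) * t) qp).
have sm := WC_W hr (WC_shift (0 + 1 * t) qm).
have spm := WC_W hr (WCD sp sm).
rewrite /poisson_pm /density /dxx_inv (fmultZ hr 2^-1 y ler01 (@normc_dxx_sym R) spm).
rewrite -/(dxx_inv _ y) (dxx_invD hr y sp sm).
rewrite (dxx_inv_shift hr _ y qp) (dxx_inv_shift hr _ y qm).
have -> : y + (0 + -1 * t) = y - t by ring.
have -> : y + (0 + 1 * t) = y + t by ring.
by rewrite mulNr.
Qed.

(** The potential is a bounded operator applied to a quadratic expression,
    which gives the bounds. Seen from the characteristic of p the part created
    by p is frozen and the part created by m moves with speed 2, which is the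
    term c of the scheme; the term d is symmetric. *)
Lemma poisson_is_potential : potential r poisson_pm (@I2_DP R)
  (fun a => normc (2^-1 : R[i]) * (K * a * a + K * a * a))
  (fun a => normc (2^-1 : R[i]) * (4 * K * a)).
Proof.
split.
- move=> s P M a s0 hP hM.
  exact: (famN hr (fam_dxx_inv hr (fam_density hP hM))).
- move=> s P M P' M' a E s0 hP hM hP' hM' dP dM.
  have cP := fam_conj hr hP; have cM := fam_conj hr hM.
  have h := famZ hr 2^-1 (famD hr
     (famD hr (famM hr dP cP) (famM hr hP' (fam_conj hr dP)))
     (famD hr (famM hr dM cM) (famM hr hM' (fam_conj hr dM)))).
  apply: fam_ext (fam_mono _ (famN hr (fam_dxx_inv hr h))).
    move=> t ht x; rewrite /poisson_pm.
    have hd := (fam_density hP' hM').1 t ht.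
    have -> : density (P t) (M t) = (fun y => density (P' t) (M' t) y +
       2^-1 * ((P t y - P' t y) * Num.conj (P t y) + P' t y * Num.conj (P t y - P' t y) +
         ((M t y - M' t y) * Num.conj (M t y) + M' t y * Num.conj (M t y - M' t y)))).
      by apply/funext => y; rewrite /density !rmorphB /=; ring.
    have aux (u v w : R[i]) : w = u + v -> - v = - w - - u by move=> ->; ring.
    exact: aux (dxx_invD hr x hd (h.1 t ht)).
  by move=> t _; rewrite le_eqVlt; apply/orP; left; apply/eqP; ring.
- move=> a a0; have := algcst_ge0 r; have := normc_ge0 (2^-1 : R[i]).
  have i4 : 0 <= 4 :> R by [].
  move: (algcst r) (normc _) => k c c0 k0.
  by split; repeat (first [assumption | apply: addr_ge0 | apply: mulr_ge0]).
- move=> tau b Psi tau0 hp hm y; set p := phi_p Psi; set m := phi_m Psi.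
  have t0 := ltW tau0.
  have qp := W_absq hp; have qm := W_absq hm.
  set ap := fun z => p z * Num.conj (p z); set am := fun z => m z * Num.conj (m z).
  have dp := WC_W hr (dxx_invC hr qp); have dm := WC_W hr (dxx_invC hr qm).
  have nE f : (fun y : R => `|f y| ^+ 2) = (fun y => f y * Num.conj (f y)) :> (R -> R[i]).
    by apply/funext => z; rewrite normCK.
  have cE : dxx_inv (fun z => phi1_dx (2 * tau) (fun z => `|m z| ^+ 2) z + `|p z| ^+ 2) y =
      phi1_dx (2 * tau) (dxx_inv am) y + dxx_inv ap y.
    rewrite nE; under [X in dxx_inv X]funext do rewrite normCK.
    exact: etrans (dxx_invD hr y (WC_W hr (phi1_dxC hr _ qm)) qp)
      (congr1 (fun u => u + dxx_inv ap y) (dxx_inv_phi1 hr _ y qm)).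
  have dE : dxx_inv (fun z => phi1_dx (- (2 * tau)) (fun z => `|p z| ^+ 2) z + `|m z| ^+ 2) y =
      phi1_dx (- (2 * tau)) (dxx_inv ap) y + dxx_inv am y.
    rewrite nE; under [X in dxx_inv X]funext do rewrite normCK.
    exact: etrans (dxx_invD hr y (WC_W hr (phi1_dxC hr _ qp)) qm)
      (congr1 (fun u => u + dxx_inv am y) (dxx_inv_phi1 hr _ y qp)).
  have e0 : I2_DP tau Psi y 0 0 = - (tau / 4)%:C *
      (p y * (phi1_dx (2 * tau) (dxx_inv am) y + dxx_inv ap y) +
       m y * (phi1_dx (- (2 * tau)) (dxx_inv ap) y + dxx_inv am y)).
    exact: etrans (scale_entry _ _ _) (congr1 _ (etrans (vec2_0 _ _)
      (f_equal2 (fun u v => p y * u + m y * v) cE dE))).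
  have e1 : I2_DP tau Psi y 1 0 = - (tau / 4)%:C *
      (p y * (phi1_dx (2 * tau) (dxx_inv am) y + dxx_inv ap y) -
       m y * (phi1_dx (- (2 * tau)) (dxx_inv ap) y + dxx_inv am y)).
    exact: etrans (scale_entry _ _ _) (congr1 _ (etrans (vec2_1 _ _)
      (f_equal2 (fun u v => p y * u - m y * v) cE dE))).
  have i1 := phi1_dx_integral hr 2 y tau0 dm.
  have i2 := phi1_dx_integral hr (-2) y tau0 dp.
  rewrite mulNr in i2.
  have mD : measurable (Icc 0 tau : set R) by exact: measurable_itv.
  have b1 : bmfun (Icc 0 tau) (fun t => dxx_inv am (y + 2 * t)) := W_line_bm hr _ y mD dm.
  have b2 : bmfun (Icc 0 tau) (fun t => dxx_inv ap (y + (-2) * t)) := W_line_bm hr _ y mD dp.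
  have cst (z : R[i]) : cintegral (Icc 0 tau) (fun=> z) = z * tau%:C.
    by rewrite cintegral_cst // subr0.
  have four : (4 : R[i]) != 0 by rewrite pnatr_eq0.
  have t4 : (tau / 4)%:C = tau%:C / 4 :> R[i] by rewrite rmorphM fmorphV rmorph_nat.
  split.
  + have -> : cintegral (Icc 0 tau) (fun t => poisson_pm (fun x => p (x + (0 + -1 * t)))
        (fun x => m (x + (0 + 1 * t))) (y + (0 + 1 * t)) * p y) =
      cintegral (Icc 0 tau) (fun t => (- 2^-1 * p y) * (dxx_inv am (y + 2 * t) + dxx_inv ap y)).
      apply: eq_cintegral => t _; rewrite (poisson_pm_wave t _ hp hm).
      have -> : y + (0 + 1 * t) - t = y by ring.
      have -> : y + (0 + 1 * t) + t = y + 2 * t by ring.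
      by rewrite -/ap -/am; ring.
    rewrite cintegralZ; last by solve_bm.
    rewrite (cintegralD b1 (bmfun_cst _ _)) cst -i1.
    rewrite {1}/phi_p /comp1 /comp2 e0 e1 t4.
    by move: (phi1_dx _ _ _) (phi1_dx _ _ _) (dxx_inv _ _) (dxx_inv _ _) => X1 X2 X3 X4; field.
  + have -> : cintegral (Icc 0 tau) (fun t => poisson_pm (fun x => p (x + (0 + -1 * t)))
        (fun x => m (x + (0 + 1 * t))) (y + (0 + -1 * t)) * m y) =
      cintegral (Icc 0 tau) (fun t => (- 2^-1 * m y) * (dxx_inv ap (y + (-2) * t) + dxx_inv am y)).
      apply: eq_cintegral => t _; rewrite (poisson_pm_wave t _ hp hm).
      have -> : y + (0 + -1 * t) - t = y + (-2) * t by ring.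
      have -> : y + (0 + -1 * t) + t = y by ring.
      by rewrite -/ap -/am; ring.
    rewrite cintegralZ; last by solve_bm.
    rewrite (cintegralD b2 (bmfun_cst _ _)) cst -i2.
    rewrite {1}/phi_m /comp1 /comp2 e0 e1 t4.
    by move: (phi1_dx _ _ _) (phi1_dx _ _ _) (dxx_inv _ _) (dxx_inv _ _) => X1 X2 X3 X4; field.
Qed.

End PoissonPotential.

(** * A given potential *)

Section ExternalPotential.
Context {R : realType} (r : R) (hr : 2^-1 < r).
Variables (Ve : R -> R) (bV : R).
Hypothesis hV : W r bV (fun x => (Ve x)%:C).
Implicit Types (Psi : R -> 'cV[R[i]]_2).

(** A function of H^r that does not depend on the solution; the phi_1(+-tau
    d_x) V of the scheme are its averages along the two families of
    characteristics. *)
Lemma external_is_potential :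
  potential r (fun _ _ x => (Ve x)%:C) (I2_ext Ve) (fun=> bV) (fun=> 0).
Proof.
split.
- by move=> s P M a s0 _ _; exact: fam_const.
- move=> s P M P' M' a E s0 _ _ _ _ _ _; rewrite mul0r.
  apply: fam_ext (fam_const s (WC_W hr (WC0 r))) => t _ x; by rewrite subrr.
- by move=> a _; split=> //; exact: WC_ge0 hV.
- move=> tau b Psi tau0 hp hm y.
  have mD : measurable (Icc 0 tau : set R) by exact: measurable_itv.
  have i1 := phi1_dx_integral hr 1 y tau0 hV.
  have i2 := phi1_dx_integral hr (-1) y tau0 hV.
  have b1 := W_line_bm hr 1 y mD hV; have b2 := W_line_bm hr (-1) y mD hV.
  rewrite mul1r in i1; rewrite mulN1r in i2.
  have e (i : 'I_2) : I2_ext Ve tau Psi y i 0 = tau%:C *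
      (phi1_dx tau (fun x => (Ve x)%:C) y * (mx_act Pi_plus Psi y) i 0 +
       phi1_dx (- tau) (fun x => (Ve x)%:C) y * (mx_act Pi_minus Psi y) i 0).
    by rewrite /I2_ext /mx_act /= mxE [X in _ * X]mxE [X in X + _]mxE [X in _ + X]mxE.
  have [two e0 e1] : [/\ (2 : R[i]) != 0, I2_ext Ve tau Psi y 0 0 = tau%:C *
      (phi1_dx tau (fun x => (Ve x)%:C) y * (2^-1 * phi_p Psi y) +
       phi1_dx (- tau) (fun x => (Ve x)%:C) y * (2^-1 * phi_m Psi y)) &
      I2_ext Ve tau Psi y 1 0 = tau%:C *
      (phi1_dx tau (fun x => (Ve x)%:C) y * (2^-1 * phi_p Psi y) +
       phi1_dx (- tau) (fun x => (Ve x)%:C) y * (- 2^-1 * phi_m Psi y))].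
    by split; rewrite ?pnatr_eq0 // e Pi_plus_comp Pi_minus_comp ?vec2_0 ?vec2_1.
  split.
  + have -> : cintegral (Icc 0 tau) (fun t => (Ve (y + (0 + 1 * t)))%:C * phi_p Psi y) =
       cintegral (Icc 0 tau) (fun t => phi_p Psi y * (Ve (y + 1 * t))%:C).
      by apply: eq_cintegral => t _; rewrite add0r mulrC.
    rewrite cintegralZ // -i1 {1}/phi_p /comp1 /comp2 e0 e1.
    by move: (phi1_dx _ _ _) (phi1_dx _ _ _) => X1 X2; field.
  + have -> : cintegral (Icc 0 tau) (fun t => (Ve (y + (0 + -1 * t)))%:C * phi_m Psi y) =
       cintegral (Icc 0 tau) (fun t => phi_m Psi y * (Ve (y + -1 * t))%:C).
      by apply: eq_cintegral => t _; rewrite add0r mulrC.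
    rewrite cintegralZ // -i2 {1}/phi_m /comp1 /comp2 e0 e1.
    by move: (phi1_dx _ _ _) (phi1_dx _ _ _) => X1 X2; field.
Qed.

End ExternalPotential.

(** * Convergence of the two schemes *)

Theorem theorem3p1 (R : realType) (lam r T : R) (hr : 2^-1 < r) (hT : 0 < T) :
  (forall M : R, exists tau0 C : R, 0 < tau0 /\ 0 < C /\
    forall Phi : R -> R -> 'cV[R[i]]_2,
      DP_solution lam T r Phi ->
      (Linfty_Hr_norm T r Phi <= M%:E)%E ->
      forall tau : R, 0 < tau <= tau0 ->
      forall n : nat, n%:R * tau <= T ->
        (Hr_norm r (fun x => (Phi (n%:R * tau) x
                     - iter n (Theta_DP lam tau) (Phi 0) x)%R)
         <= (C * tau)%:E)%E)
  /\
  (forall Ve : R -> R, periodic2pi Ve -> smooth Ve ->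
   forall M : R, exists tau0 C : R, 0 < tau0 /\ 0 < C /\
    forall Phi : R -> R -> 'cV[R[i]]_2,
      NDE_solution lam T r Ve Phi ->
      (Linfty_Hr_norm T r Phi <= M%:E)%E ->
      forall tau : R, 0 < tau <= tau0 ->
      forall n : nat, n%:R * tau <= T ->
        (Hr_norm r (fun x => (Phi (n%:R * tau) x
                     - iter n (Theta_ext lam Ve tau) (Phi 0) x)%R)
         <= (C * tau)%:E)%E).
Proof.
split=> [M|Ve pV sV M].
- have [tau0 [C [t0 [C0 h]]]] := uli_convergence hr lam hT (poisson_is_potential hr) M.
  exists tau0, C; split=> //; split=> // Phi sol hM tau htau n hn.
  by apply: (h _ Phi sol _ hM tau htau n hn) => t _; exact: poisson_potentialE.
- have [B hV] := smooth_W hr sV pV.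
  have [tau0 [C [t0 [C0 h]]]] := uli_convergence hr lam hT (external_is_potential hr hV) M.
  exists tau0, C; split=> //; split=> // Phi sol hM tau htau n hn.
  exact: (h _ Phi sol _ hM tau htau n hn).
Qed.
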